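(* Assume the two standing assumptions on $P$ (with parameter $s$) stated in the context, and let $s<1$. Let $n_k=2^{2^k}$. Then for $P$-a.e. environment $\omega$ there exist a random subsequence $n_{k_m}=n_{k_m}(\omega)$ of $(n_k)$ and a random sequence $t_m=t_m(\omega)$ such that $$\lim_{m\to\infty}\frac{\log t_m}{\log n_{k_m}}=\frac1s$$ and $$\lim_{m\to\infty}P_\omega\left(\frac{X_{t_m}}{n_{k_m}}\le x\right)=\begin{cases}0,& x\le 0,\\ \tfrac12,& 0<x<\infty.\end{cases}$$
   Context: Setting. $\Omega=[0,1]^{\mathbb Z}$ with its Borel $\sigma$-algebra; a random environment is $\omega=(\omega_i)_{i\in\mathbb Z}\in\Omega$ with law $P$. For fixed $\omega$, $P_\omega$ is the (quenched) law of the Markov chain $(X_n)_{n\ge 0}$ on $\mathbb Z$ with $X_0=0$, $P_\omega(X_{n+1}=i+1\mid X_n=i)=\omega_i$, $P_\omega(X_{n+1}=i-1\mid X_n=i)=1-\omega_i$. $E_P$ is expectation under $P$. Put $\rho_i=(1-\omega_i)/\omega_i$ and $\rho=\rho_0$. Standing assumptions: (1) $P$ is an i.i.d. product measure on $\Omega$ with $E_P\log\rho<0$ and $E_P\rho^s=1$ for some $s>0$; (2) the distribution of $\log\rho$ under $P$ is nonlattice and $E_P(\rho^s\log\rho)<\infty$. ''Random'' (sub)sequences depend only on the environment $\omega$ (not on the walk). For non-integer $t\ge0$, $X_t$ means $X_{\lfloor t\rfloor}$. *)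

(* Defs.v *)
From HB Require Import structures.
From mathcomp Require Import all_boot all_order all_algebra.
From mathcomp Require Import zify.
From mathcomp Require Import all_classical all_reals all_analysis.

Set Implicit Arguments.
Unset Strict Implicit.
Unset Printing Implicit Defensive.
Import Order.TTheory GRing.Theory Num.Theory.
Import numFieldNormedType.Exports.
Local Open Scope classical_set_scope.
Local Open Scope ring_scope.

Definition unit_itv (R : realType) : set R := `[0, 1]%classic.
Arguments unit_itv : clear implicits.

Lemma unit_itv0 (R : realType) : (0 : R) \in unit_itv R.
Proof. by rewrite inE /unit_itv/= in_itv/= lexx ler01. Qed.

HB.instance Definition _ (R : realType) :=
  isPointed.Build (set_type (unit_itv R)) (exist _ 0 (unit_itv0 R)).

(* [0,1]^Z with the Borel sigma-algebra of the product topology *)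
Definition env (R : realType) : Type :=
  g_sigma_algebraType (@open {ptws int -> set_type (unit_itv R)}).
HB.instance Definition _ (R : realType) := Measurable.on (env R).

Definition env_at (R : realType) (w : env R) (i : int) : R := set_val (w i).

(* (1 - w_i) / w_i in \bar R: it is +oo at w_i = 0 (as 0^-1 = +oo there),
   so that lne, poweR and the integrals below see the value +oo. *)
Definition rho (R : realType) (w : env R) (i : int) : \bar R :=
  ((1 - env_at w i)%:E / (env_at w i)%:E)%E.

Definition iid_product (R : realType) (P : probability (env R) R) : Prop :=
  exists mu : probability (measurableTypeR R) R,
    forall (J : seq int) (A : int -> set (measurableTypeR R)), uniq J ->
      (forall i, measurable (A i)) ->
      P [set w | forall i, i \in J -> A i (env_at w i)] =
      (\prod_(i <- J) mu (A i))%E.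

(* Renewal-theoretic sense: log rho_0 is not concentrated on h Z for any h > 0,
   where the mass that log rho_0 may have at -oo (i.e. at w_0 = 1) is
   disregarded. *)
Definition nonlattice (R : realType) (P : probability (env R) R) : Prop :=
  forall h : R, 0 < h ->
    (P [set w | lne (rho w 0) = -oo \/
                exists z : int, lne (rho w 0) = (z%:~R * h)%:E] < 1)%E.

HB.instance Definition _ := isPointed.Build int 0.

(* The paths (X_n)_n of the walk, with the product of the discrete
   sigma-algebras on Z. *)
Definition coordinate_events : set (set (nat -> int)) :=
  [set A | exists n i, A = [set X | X n = i]].
Definition walk : Type := g_sigma_algebraType coordinate_events.
HB.instance Definition _ := Measurable.on walk.

Definition history (n : nat) (x : nat -> int) : set walk :=
  [set X | forall j, (j <= n)%N -> X j = x j].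

(* Q is the law of the Markov chain started at 0 that jumps from i to i + 1
   with probability w_i and to i - 1 with probability 1 - w_i; the conditional
   probabilities given the history are multiplied out, so that histories of
   probability 0 need no convention. *)
Definition quenched_law (R : realType) (w : env R) (Q : probability walk R)
    : Prop :=
  Q [set X | X 0%N = 0] = 1%E /\
  forall (n : nat) (x : nat -> int),
    Q (history n x `&` [set X | X n.+1 = x n + 1]) =
      (Q (history n x) * (env_at w (x n))%:E)%E /\
    Q (history n x `&` [set X | X n.+1 = x n - 1]) =
      (Q (history n x) * (1 - env_at w (x n))%:E)%E.

(* Existence of the quenched law, by cutting [0, 1] into the subintervals
   that correspond to the finite sequences of steps (most recent step first,
   true for a step to the right). *)
Section quenched_law_exists.
Context {R : realType} (w : env R).

(* position, left endpoint and length *)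
Fixpoint cell (b : seq bool) : int * R * R :=
  if b is c :: b' then
    let: (p, a, l) := cell b' in
    if c then (p + 1, a, l * env_at w p)
    else (p - 1, a + l * env_at w p, l * (1 - env_at w p))
  else (0, 0, 1).

Definition cut (b : seq bool) : R :=
  let: (p, a, l) := cell b in a + l * env_at w p.

Fixpoint steps (n : nat) (u : R) : seq bool :=
  if n is m.+1 then (u < cut (steps m u)) :: steps m u else [::].

Definition walk_of (u : measurableTypeR R) : walk := fun n => (cell (steps n u)).1.1.

Lemma env_at01 i : 0 <= env_at w i <= 1.
Proof.
by have := set_valP (w i); rewrite /unit_itv/= in_itv.
Qed.

Lemma cell_sub01 b : let: (p, a, l) := cell b in
  [/\ 0 <= a, 0 <= l & a + l <= 1].
Proof.
elim: b => [|c b]; first by rewrite /= add0r lexx ler01.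
rewrite /=; case: (cell b) => -[p a] l [a0 l0 al1].
have /andP[w0 w1] := env_at01 p.
case: c; split => //.
- exact: mulr_ge0.
- by rewrite (le_trans _ al1)// lerD2l ler_piMr.
- by rewrite addr_ge0// mulr_ge0.
- by rewrite mulr_ge0// subr_ge0.
- by rewrite -addrA -mulrDr subrKC mulr1.
Qed.

Lemma size_steps n u : size (steps n u) = n.
Proof. by elim: n => //= n ->. Qed.

Lemma stepsP b u : 0 <= u < 1 ->
  let: (p, a, l) := cell b in
  (steps (size b) u == b) = (a <= u < a + l).
Proof.
move=> u01; elim: b => [|c b]; first by rewrite /= add0r u01 eqxx.
rewrite /= eqseq_cons; have := cell_sub01 b.
case: (eqVneq (steps (size b) u) b) => [->|_]; rewrite ?andbT ?andbF /cut.
- case: (cell b) => -[p a] l [a0 l0 al1] /esym aul.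
  have /andP[w0 w1] := env_at01 p; move: aul => /andP[au ul].
  case: c; rewrite ?au/=; first by case: (u < _).
  rewrite -addrA -mulrDr subrKC mulr1 ul andbT.
  by rewrite leNgt; case: (u < _).
- case: (cell b) => -[p a] l [a0 l0 al1] /esym aul.
  have /andP[w0 w1] := env_at01 p.
  case: c; apply/esym/negbTE/negP => /andP[h1 h2]; move/negP: aul; apply.
  + by rewrite h1 (lt_le_trans h2)// lerD2l ler_piMr.
  + move: h2; rewrite -addrA -mulrDr subrKC mulr1 => ->.
    by rewrite (le_trans _ h1)// lerDl mulr_ge0.
Qed.

Definition unif01 : set (measurableTypeR R) -> \bar R :=
  mrestr lebesgue_measure (measurable_itv `[(0 : R), 1[).
HB.instance Definition _ := Measure.on unif01.

Let unif01_setT : unif01 setT = 1%E.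
Proof.
by rewrite /unif01 /mrestr setTI lebesgue_measure_itv/= lte_fin ltr01 oppr0 adde0.
Qed.
HB.instance Definition _ :=
  Measure_isProbability.Build _ _ R unif01 unif01_setT.

Lemma measurable_steps n b : measurable [set u : measurableTypeR R | steps n u = b].
Proof.
elim: n b => [|n IH] b /=.
  have [->|/eqP b0] := eqVneq b [::].
    by rewrite (_ : [set _ | _] = setT)//; apply/seteqP; split.
  rewrite (_ : [set _ | _] = set0)//; apply/seteqP; split => // u /= h.
  by rewrite h in b0.
case: b => [|c b].
  by rewrite (_ : [set _ | _] = set0)//; apply/seteqP; split.
rewrite (_ : [set _ | _] = [set u | steps n u = b] `&`
   (if c then [set` `]-oo, (cut b)[] else [set` `[(cut b), +oo[])).
  by apply: measurableI; [exact: IH | case: c; exact: measurable_itv].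
apply/seteqP; split => u /=.
  case=> h1 h2; rewrite -h2 -h1; split => //.
  by case: ltP => h /=; rewrite in_itv/= ?h// andbT.
case=> h1; rewrite h1; case: c => /=; rewrite in_itv/= ?andbT => h.
  by rewrite h.
by rewrite ltNge h.
Qed.

Lemma unif01_steps b : unif01 [set u | steps (size b) u = b] = (cell b).2%:E.
Proof.
have := cell_sub01 b; have := @stepsP b.
case: (cell b) => -[p a] l /= hb [a0 l0 al1].
rewrite /unif01 /mrestr (_ : _ `&` _ = `[a, (a + l)[%classic).
  rewrite lebesgue_measure_itv/= lte_fin ltrDl -EFinD addrAC subrr add0r.
  by case: ltP => // l0'; congr EFin; apply/le_anti/andP.
apply/seteqP; split => u /=; rewrite !in_itv/=.
  by case=> /eqP h u01; rewrite -hb.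
move=> /[dup] aul /andP[au ul].
have u01 : 0 <= u < 1 by rewrite (le_trans a0 au) (lt_le_trans ul al1).
by split=> //; apply/eqP; rewrite hb.
Qed.

Lemma measurable_walk_of : measurable_fun [set: measurableTypeR R] walk_of.
Proof.
apply: (@measurability _ _ (measurableTypeR R) walk setT walk_of coordinate_events) => [//|_ [_ [n [i ->]] <-]].
rewrite setTI (_ : _ @^-1` _ = \bigcup_(b in [set b | (cell b).1.1 = i])
  [set u | steps n u = b]).
  rewrite bigcup_mkcond; apply: countable_bigcupT_measurable => [//|b].
  by case: ifPn => // _; exact: measurable_steps.
apply/seteqP; split => u /=; first by move=> h; exists (steps n u).
by case=> b /= <- <-.
Qed.

HB.instance Definition _ := isMeasurableFun.Build _ _ _ _ walk_of
  measurable_walk_of.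

Lemma quenched_law_exists : exists Q : probability walk R, quenched_law w Q.
Proof.
pose Q : probability walk R := distribution unif01 walk_of.
have QE A : Q A = unif01 (walk_of @^-1` A) by [].
exists Q; split.
  rewrite QE -unif01_setT; congr (unif01 _).
  by apply/seteqP; split.
move=> n x; rewrite !QE !preimage_setI.
pose b := fix b m := if m is k.+1 then (x k.+1 == x k + 1) :: b k else [::].
have sizeb m : size (b m) = m by elim: m => //= m ->.
have histS m u : history m.+1 x (walk_of u) -> history m x (walk_of u).
  by move=> h j jm; apply: h; rewrite ltnW.
have pm1 (i : int) : (i - 1 == i + 1) = false by apply/negbTE; lia.
have walkS u m : walk_of u m.+1 =
    walk_of u m + (if u < cut (steps m u) then 1 else - 1).
  by rewrite /walk_of/=; case: (cell _) => -[p a] l; case: ifP.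
have hist_steps m u : history m x (walk_of u) -> steps m u = b m.
  elim: m => // m IH h /=; rewrite (IH (histS _ _ h)); congr (_ :: _).
  rewrite -(h m.+1)// -(h m)// walkS (IH (histS _ _ h)).
  by case: ifP => _; rewrite ?eqxx ?pm1.
have steps_le m u v : steps m u = steps m v ->
    forall j, (j <= m)%N -> steps j u = steps j v.
  elim: m => [_ [|]//|m IH /[dup] h /= [_ h'] j].
  by rewrite leq_eqVlt => /predU1P[->//|]; rewrite ltnS; exact: IH.
have [[u0 hu0]|nex] := pselect (exists u, history n x (walk_of u)); last first.
  have -> : walk_of @^-1` history n x = set0.
    by apply/seteqP; split => // u hu; apply: nex; exists u.
  by rewrite !set0I measure0 !mul0e.
have -> : walk_of @^-1` history n x = [set u | steps n u = b n].
  apply/seteqP; split => u /=; first exact: hist_steps.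
  rewrite -(hist_steps _ _ hu0) => h j jn.
  by rewrite -(hu0 _ jn) /walk_of (steps_le _ _ _ h).
have posb : (cell (b n)).1.1 = x n.
  by rewrite -(hist_steps _ _ hu0) -(hu0 n).
have step_eq c : [set u | steps n u = b n] `&`
    walk_of @^-1` [set X | X n.+1 = x n + (if c then 1 else - 1)] =
    [set u | steps n.+1 u = c :: b n].
  apply/seteqP; split => u /=.
    case=> h; rewrite walkS /walk_of h posb => /addrI e; congr (_ :: _).
    by case: c e; case: ifP.
  case=> <- h; split => //.
  by rewrite walkS /walk_of h posb.
have /= := step_eq true; have /= := step_eq false => -> ->.
have := unif01_steps (b n); rewrite sizeb => ->.
have /= := unif01_steps (true :: b n); rewrite sizeb => ->.
have /= := unif01_steps (false :: b n); rewrite sizeb => ->.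
by move: posb; case: (cell (b n)) => -[p a] l /= ->; rewrite !EFinM.
Qed.

End quenched_law_exists.

Definition scale (k : nat) : nat := (2 ^ (2 ^ k))%N.

(* Main.v *)
Require Import Defs.
From HB Require Import structures.
From mathcomp Require Import all_boot all_order all_algebra.
From mathcomp Require Import zify ring lra.
From mathcomp Require Import all_classical all_reals all_analysis.
From mathcomp Require Import measurable_realfun.
Set Implicit Arguments.
Unset Strict Implicit.
Unset Printing Implicit Defensive.
Import Order.TTheory GRing.Theory Num.Theory.
Import numFieldNormedType.Exports.
Local Open Scope classical_set_scope.
Local Open Scope ring_scope.

(** Write rho for the odds (1 - w) / w of a step to the left.

    The walk drifts to the right, but it is slowed down by traps, the stretches
    of sites along which the product Pi of the odds is large: leaving such a
    stretch to the right takes a time of order Pi. Since rho^s has mean 1, Pi^s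
    is a martingale along a stretch, and optional stopping shows that a stretch
    started at a given site exceeds x with probability of order x^-s: at most
    that by [passage_weight] and [tail_count], at least that by
    [passage_lower], where the integrability of rho^s log rho controls the
    overshoot. A second-moment computation turns this into a lower bound for
    the probability that n sites contain a trap of depth n^(1/s)
    ([trap_probability_ge]). Because s < 1, the mean time needed to cross n
    sites is also of order n^(1/s), outside an event whose probability is small
    if the constant is large ([crossing_mean_tail]).

    Fix a large integer D and put n = 2^(2^k). Call the scale k favourable if
    there is a trap before the site n/(2D) whose depth is 2 D^2 times larger
    than the mean time needed to cross from n/D to 2Dn. The trap and the
    crossing concern disjoint sets of sites, hence are independent, and each
    has a probability bounded below: the first because a constant factor in the
    depth costs only a constant factor in the probability. The sites
    involved at scale k lie beyond 2 D n', where n' is the previous scale, and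
    n' is negligible with respect to n, as it is its square root. So distinct
    scales are independent and infinitely many of them are favourable. The
    other requirements on the environment fail at scale k with a probability
    that tends to 0 ([rare_atypical]); as the block of consecutive independent
    scales that is needed to see a favourable one has bounded length, they may
    be imposed as well ([infinitely_often]).

    At such a scale let t be the median of the time at which the walk first
    reaches y0, the right end of the trap region, about n/D. The walk reaches
    y0 at a given instant with probability at most the inverse of the depth
    ([hitting_density]), by comparison with a stationary flow. Hence t is at
    least half the depth, and shifting t by a time eta that is short with
    respect to the depth hardly changes the probability that y0 is reached
    before. Since eta suffices to go from y0 to 2Dn, and since the walk does
    not go back far, the walk at time t is either left of y0 or right of Dn,
    with probabilities close to 1/2, and it is to the right of 0 with
    probability close to 1 ([quenched_median]). Finally t is
    between n^(1/s) and n^(1/s + 2/D), and letting D tend to infinity along a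
    subsequence of scales gives both limits ([halfway_limit]). *)

(** * Independence of the information on disjoint sets of sites *)

Section independent_maps.
Context d d1 d2 (T : measurableType d) (T1 : measurableType d1)
  (T2 : measurableType d2) (R : realType) (P : probability T R).
Variables (u : T -> T1) (v : T -> T2).
Hypotheses (mu : measurable_fun setT u) (mv : measurable_fun setT v).
Hypothesis indep_uv : forall A B, measurable A -> measurable B ->
  P (u @^-1` A `&` v @^-1` B) = (P (u @^-1` A) * P (v @^-1` B))%E.

(** The joint law of u and v is the product of their laws, and Fubini applies. *)
Lemma indep_map_integral (f : T1 -> R) (g : T2 -> R) :
  (forall x, 0 <= f x) -> (forall y, 0 <= g y) ->
  measurable_fun setT f -> measurable_fun setT g ->
  (\int[P]_w (f (u w) * g (v w))%:E =
   \int[P]_w (f (u w))%:E * \int[P]_w (g (v w))%:E)%E.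
Proof.
move=> f0 g0 mf mg.
pose P1 : probability T1 R := distribution P (mfun_Sub (mem_set mu)).
pose P2 : probability T2 R := distribution P (mfun_Sub (mem_set mv)).
have mphi : measurable_fun setT (fun w => (u w, v w)).
  exact: measurable_fun_pair.
pose phi : {mfun T >-> (T1 * T2)%type} := mfun_Sub (mem_set mphi).
pose PP : probability (T1 * T2)%type R := distribution P phi.
have PPE X : measurable X -> (P1 \x P2)%E X = PP X.
  apply: product_measure_unique => A B mA mB.
  by rewrite -[RHS](indep_uv mA mB).
pose F (z : (T1 * T2)%type) : \bar R := (f z.1 * g z.2)%:E.
have mF : measurable_fun setT F.
  apply/measurable_EFinP; apply: measurable_funM.
  - exact: (measurableT_comp mf measurable_fst).
  - exact: (measurableT_comp mg measurable_snd).
transitivity (\int[PP]_z F z)%E.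
  rewrite [RHS](@ge0_integral_pushforward _ _ _ _ _ _ mphi P setT)//.
  by move=> z _; rewrite lee_fin mulr_ge0.
transitivity (\int[(P1 \x P2)%E]_z F z)%E.
  by apply: eq_measure_integral => X mX _; exact/esym/PPE.
rewrite fubini_tonelli1//; last by move=> z; rewrite lee_fin mulr_ge0.
rewrite /fubini_F/F/=.
under eq_integral => x _.
  under eq_integral do rewrite EFinM.
  rewrite ge0_integralZl//; last 3 first.
  - exact/measurable_EFinP.
  - by move=> y _; rewrite lee_fin.
  - by rewrite lee_fin.
  over.
rewrite ge0_integralZr//; last 3 first.
- exact/measurable_EFinP.
- by move=> y _; rewrite lee_fin.
- by apply: integral_ge0 => y _; rewrite lee_fin.
congr (_ * _)%E.
- rewrite [LHS](@ge0_integral_pushforward _ _ _ _ _ _ mu P setT)//.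
  + exact/measurable_EFinP.
  + by move=> z _; rewrite lee_fin.
- rewrite [LHS](@ge0_integral_pushforward _ _ _ _ _ _ mv P setT)//.
  + exact/measurable_EFinP.
  + by move=> z _; rewrite lee_fin.
Qed.

End independent_maps.

Section independence.
Context d (T : measurableType d) (R : realType) (P : probability T R).
Variables (G1 G2 : set (set T)).
Hypotheses (mG1 : G1 `<=` measurable) (mG2 : G2 `<=` measurable).
Hypotheses (G1I : setI_closed G1) (G2I : setI_closed G2).
Hypotheses (G1T : G1 setT) (G2T : G2 setT).
Hypothesis indepG : forall A B, G1 A -> G2 B -> P (A `&` B) = (P A * P B)%E.

Let fineP_ge0 A : 0 <= fine (P A). Proof. exact: fine_ge0. Qed.

Let mscaleE A B : measurable A -> measurable B ->
  mscale (NngNum (fineP_ge0 B)) P A = (P A * P B)%E.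
Proof. by move=> mA mB; rewrite /mscale/= fineK ?fin_num_measure// muleC. Qed.

Let sG1m : <<s G1 >> `<=` (measurable : set (set T)).
Proof. exact: smallest_sub (@sigma_algebra_measurable _ T) mG1. Qed.

Let sG2m : <<s G2 >> `<=` (measurable : set (set T)).
Proof. exact: smallest_sub (@sigma_algebra_measurable _ T) mG2. Qed.

(** Uniqueness of finite measures on a generating pi-system extends the product
    rule from G1 and G2 to the generated sigma-algebras, one side at a time. *)
Lemma indep_sigma A B : <<s G1 >> A -> <<s G2 >> B ->
  P (A `&` B) = (P A * P B)%E.
Proof.
have step A' B' : G1 A' -> <<s G2 >> B' -> P (A' `&` B') = (P A' * P B')%E.
  move=> GA sB; have mA := mG1 GA; have mB := sG2m sB.
  rewrite setIC muleC -(mscaleE mB mA) -[LHS]/(mrestr P mA B').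
  apply: (g_sigma_algebra_measure_unique G2 mG2 (fun=> setT)) sB => //.
  - by rewrite bigcup_const//; exists 0%N.
  - move=> C GC; have mC := mG2 GC.
    rewrite [RHS](mscaleE mC mA) -[LHS]/(P (C `&` A')) setIC muleC.
    exact: indepG.
  - move=> _; rewrite -[X in (X < _)%E]/(P (setT `&` A')) setTI.
    by rewrite (le_lt_trans (probability_le1 P mA))// ltry.
move=> sA sB; have mA := sG1m sA; have mB := sG2m sB.
rewrite -(mscaleE mA mB) -[LHS]/(mrestr P mB A).
apply: (g_sigma_algebra_measure_unique G1 mG1 (fun=> setT)) sA => //.
- by rewrite bigcup_const//; exists 0%N.
- move=> C GC; have mC := mG1 GC.
  by rewrite [RHS](mscaleE mC mB); exact: step.
- move=> _; rewrite -[X in (X < _)%E]/(P (setT `&` B)) setTI.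
  by rewrite (le_lt_trans (probability_le1 P mB))// ltry.
Qed.

Let T1 := g_sigma_algebraType G1.
Let T2 := g_sigma_algebraType G2.

Lemma indep_integral (f g : T -> R) :
  (forall w, 0 <= f w) -> (forall w, 0 <= g w) ->
  measurable_fun [set: T1] f -> measurable_fun [set: T2] g ->
  (\int[P]_w (f w * g w)%:E = \int[P]_w (f w)%:E * \int[P]_w (g w)%:E)%E.
Proof.
move=> f0 g0 mf mg.
apply: (@indep_map_integral _ _ _ T T1 T2 R P id id) => //.
- by move=> _ B mB; rewrite setTI; exact: sG1m.
- by move=> _ B mB; rewrite setTI; exact: sG2m.
- exact: indep_sigma.
Qed.

End independence.

Section sites.
Context {R : realType}.
Implicit Types (w : env R) (I J : set int) (f g : env R -> R).

Lemma measurable_env_at i :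
  measurable_fun [set: env R] (fun w : env R => env_at w i : measurableTypeR R).
Proof.
apply: (measurability (@RGenOInfty.G R)).
  exact: RGenOInfty.measurableE.
move=> _ [_ [a ->] <-]; rewrite setTI; apply: sub_sigma_algebra.
have cts : continuous (fun w : {ptws int -> set_type (unit_itv R)} =>
    set_val (w i) : R).
  move=> w; apply: continuous_comp; last exact: initial_continuous.
  exact: (@proj_continuous int (fun=> set_type (unit_itv R)) i).
have /continuousP := cts; apply.
by rewrite set_itvoy; exact: open_gt.
Qed.

(** The events about finitely many sites of I: a pi-system that generates the
    information carried by the environment on I. *)
Definition cylinder I : set (set (env R)) := [set A | exists (K : seq int) B,
  [/\ uniq K, forall i, i \in K -> I i,
      forall i, measurable (B i : set (measurableTypeR R)) &
      A = [set w : env R | forall i, i \in K -> B i (env_at w i)]]].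

Definition site_algebra I : Type := g_sigma_algebraType (cylinder I).
HB.instance Definition _ I := Measurable.on (site_algebra I).

Definition depends I f := measurable_fun (setT : set (site_algebra I)) f.

Lemma cylinder_measurable I : cylinder I `<=` measurable.
Proof.
move=> _ [J [B [_ _ mB ->]]].
rewrite (_ : [set w | _] = \bigcap_(i in [set` J]) ((fun w : env R => env_at w i) @^-1` B i))//.
apply: fin_bigcap_measurable => // i _.
by rewrite -[X in measurable X]setTI; exact: measurable_env_at.
Qed.

Lemma cylinderI I : setI_closed (cylinder I).
Proof.
move=> _ _ [J [B [uJ IJ mB ->]]] [J' [B' [uJ' IJ' mB' ->]]].
exists (undup (J ++ J')), (fun i => (if i \in J then B i else setT) `&`
                                    (if i \in J' then B' i else setT)).
split; first exact: undup_uniq.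
- by move=> i; rewrite mem_undup mem_cat => /orP[/IJ|/IJ'].
- by move=> i; apply: measurableI; case: ifP.
- apply/seteqP; split => w /=.
    move=> [h h'] i _; split; first by case: ifPn => // /h.
    by case: ifPn => // /h'.
  move=> h; split => i iJ.
    have [|] := h i; first by rewrite mem_undup mem_cat iJ.
    by rewrite iJ.
  have [|] := h i; first by rewrite mem_undup mem_cat iJ orbT.
  by rewrite iJ.
Qed.

Lemma cylinderT I : cylinder I setT.
Proof.
exists [::], (fun=> setT); split => //.
by apply/seteqP; split => w.
Qed.

Lemma depends_sub I J f : I `<=` J -> depends I f -> depends J f.
Proof.
move=> IJ df _ B mB; have := df measurableT B mB.
rewrite !setTI; apply: sub_sigma_algebra2.
move=> _ [K [C [uK IK mC ->]]].
by exists K, C; split => // i /IK /IJ.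
Qed.

Lemma depends_measurable I f : depends I f -> measurable_fun [set: env R] f.
Proof.
move=> df _ B mB; have := df measurableT B mB; rewrite !setTI.
exact: smallest_sub (@sigma_algebra_measurable _ _) (@cylinder_measurable I) _.
Qed.

Lemma depends_env_at I i : I i -> depends I (fun w => env_at w i).
Proof.
move=> Ii _ B mB; rewrite setTI; apply: sub_sigma_algebra.
exists [:: i], (fun=> B); split => //.
  by move=> j; rewrite inE => /eqP ->.
apply/seteqP; split => w /=; first by move=> h j; rewrite inE => /eqP ->.
by apply; rewrite inE.
Qed.

Lemma depends_indep I J (P : probability (env R) R) f g : iid_product P ->
  I `&` J = set0 -> (forall w, 0 <= f w) -> (forall w, 0 <= g w) ->
  depends I f -> depends J g ->
  (\int[P]_w (f w * g w)%:E = \int[P]_w (f w)%:E * \int[P]_w (g w)%:E)%E.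
Proof.
move=> [mu muP] IJ0 f0 g0 df dg.
apply: (indep_integral (@cylinder_measurable I) (@cylinder_measurable J)
  (@cylinderI I) (@cylinderI J) (cylinderT I) (cylinderT J)) => //.
move=> _ _ [K [B [uK IK mB ->]]] [K' [B' [uK' JK' mB' ->]]].
have dis i : i \in K -> i \in K' = false.
  move=> /IK Ii; apply/negP => /JK' Ji.
  by have : (I `&` J) i by []; rewrite IJ0.
pose C i := if i \in K then B i else B' i.
have mC i : measurable (C i) by rewrite /C; case: ifP.
rewrite (_ : _ `&` _ = [set w | forall i, i \in K ++ K' -> C i (env_at w i)]).
  rewrite !muP// ?big_cat/=; last first.
    rewrite cat_uniq uK uK' andbT/=; apply/hasPn => i iK'.
    by apply/negP => /dis; rewrite iK'.
  congr (_ * _)%E.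
    by apply: eq_big_seq => i iK; rewrite /C iK.
  apply: eq_big_seq => i iK'; rewrite /C.
  by case: ifPn => // /dis; rewrite iK'.
apply/seteqP; split => w /=.
  move=> [h h'] i; rewrite mem_cat /C => /orP[iK|iK'].
    by rewrite iK; exact: h.
  by case: ifPn => [/h//|_]; exact: h'.
move=> h; split => i iK.
  by have := h i; rewrite mem_cat iK /C iK; exact.
have := h i; rewrite mem_cat iK orbT /C.
by case: ifPn => [/dis|_]; [rewrite iK|exact].
Qed.

Lemma iid_integral_at (P : probability (env R) R) (F : R -> R) i :
  iid_product P -> (forall x, 0 <= F x) ->
  measurable_fun [set: measurableTypeR R] F ->
  (\int[P]_w (F (env_at w i))%:E = \int[P]_w (F (env_at w 0))%:E)%E.
Proof.
move=> [mu muP] F0 mF.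
suff H j : (\int[P]_w (F (env_at w j))%:E = \int[mu]_x (F x)%:E)%E by rewrite !H.
pose u : {mfun env R >-> measurableTypeR R} :=
  mfun_Sub (mem_set (measurable_env_at j)).
transitivity (\int[distribution P u]_x (F x)%:E)%E.
  rewrite [RHS](@ge0_integral_pushforward _ _ _ _ _ _ (measurable_env_at j) P setT)//.
    exact/measurable_EFinP.
  by move=> x _; rewrite lee_fin.
apply: eq_measure_integral => A mA _.
have := muP [:: j] (fun=> A) isT (fun=> mA); rewrite big_seq1.
apply: etrans; congr (P _); apply/seteqP; split => w /=.
  by move=> h k; rewrite inE => /eqP ->.
by apply; rewrite inE.
Qed.

End sites.

(** * Observables of the environment and their expectations *)

Section observables.
Context {R : realType}.
Implicit Types (w : env R) (I J : set int) (f g : env R -> R) (x y : R).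

(** Nonnegativity gives every observable an integral, so that sums, multiples
    and products of observables need no integrability condition. *)
Definition obs I f := depends I f /\ forall w, 0 <= f w.

Lemma obs_ge0 I f : obs I f -> forall w, 0 <= f w. Proof. by case. Qed.

Lemma obs_sub I J f : I `<=` J -> obs I f -> obs J f.
Proof. by move=> IJ [df f0]; split => //; exact: depends_sub df. Qed.

Lemma obsT I f : obs I f -> obs setT f. Proof. exact: obs_sub. Qed.

Lemma obs_measurable I f : obs I f -> measurable_fun [set: env R] f.
Proof. by move=> [/depends_measurable]. Qed.

Lemma obs_cst I x : 0 <= x -> obs I (fun=> x).
Proof. by move=> x0; split => //; exact: measurable_cst. Qed.

Lemma obsD I f g : obs I f -> obs I g -> obs I (fun w => f w + g w).
Proof.
move=> [df f0] [dg g0]; split; first exact: measurable_funD.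
by move=> w; rewrite addr_ge0.
Qed.

Lemma obsM I f g : obs I f -> obs I g -> obs I (fun w => f w * g w).
Proof.
move=> [df f0] [dg g0]; split; first exact: measurable_funM.
by move=> w; rewrite mulr_ge0.
Qed.

Lemma obsZ I x f : 0 <= x -> obs I f -> obs I (fun w => x * f w).
Proof. by move=> x0; apply: obsM; exact: obs_cst. Qed.

Lemma obs_sum I (T : Type) (r : seq T) (F : T -> env R -> R) :
  (forall i, obs I (F i)) -> obs I (fun w => \sum_(i <- r) F i w).
Proof.
move=> h; elim: r => [|i r IH].
  rewrite (_ : (fun _ => _) = fun=> 0); first exact: obs_cst.
  by apply/funext => w; rewrite big_nil.
rewrite (_ : (fun _ => _) = fun w => F i w + \sum_(i <- r) F i w).
  exact: obsD.
by apply/funext => w; rewrite big_cons.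
Qed.

Lemma obs_prod I (T : eqType) (r : seq T) (F : T -> env R -> R) :
  (forall i, i \in r -> obs I (F i)) -> obs I (fun w => \prod_(i <- r) F i w).
Proof.
elim: r => [|i r IH] h.
  rewrite (_ : (fun _ => _) = fun=> 1); first exact: obs_cst.
  by apply/funext => w; rewrite big_nil.
rewrite (_ : (fun _ => _) = fun w => F i w * \prod_(i <- r) F i w).
  apply: obsM; first by apply: h; rewrite inE eqxx.
  by apply: IH => j jr; apply: h; rewrite inE jr orbT.
by apply/funext => w; rewrite big_cons.
Qed.

Lemma obs_pow I f (p : R) : obs I f -> obs I (fun w => f w `^ p).
Proof.
move=> [df f0]; split; last by move=> w; exact: powR_ge0.
exact: (measurableT_comp (measurable_powR p) df).
Qed.

Lemma obs_lt I f g : obs I f -> obs I g -> obs I (fun w => (f w < g w)%R%:R).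
Proof.
move=> [df f0] [dg g0]; split; last by move=> w; exact: ler0n.
rewrite (_ : (fun _ => _) = fun w => if f w < g w then 1 else 0).
  by apply: measurable_fun_ifT => //; exact: measurable_fun_ltr.
by apply/funext => w; case: ifP.
Qed.

Lemma obs_le I f g : obs I f -> obs I g -> obs I (fun w => (f w <= g w)%R%:R).
Proof.
move=> [df f0] [dg g0]; split; last by move=> w; exact: ler0n.
rewrite (_ : (fun _ => _) = fun w => if f w <= g w then 1 else 0).
  by apply: measurable_fun_ifT => //; exact: measurable_fun_ler.
by apply/funext => w; case: ifP.
Qed.

Lemma obs_min I f g : obs I f -> obs I g -> obs I (fun w => Num.min (f w) (g w)).
Proof.
move=> [df f0] [dg g0]; split; first exact: measurable_minr.
by move=> w; rewrite le_min f0 g0.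
Qed.

Definition odds w (i : int) : R := (1 - env_at w i) / env_at w i.

Lemma odds_ge0 w i : 0 <= odds w i.
Proof.
have /andP[h0 h1] := env_at01 w i.
by rewrite divr_ge0// subr_ge0.
Qed.

(* The real power x `^ -1 is a measurable version of the inverse. *)
Let odds_fun x := (1 - x) * x `^ (-1).

Let oddsE w i : odds w i = odds_fun (env_at w i).
Proof.
by have /andP[h0 h1] := env_at01 w i; rewrite /odds_fun powR_inv1.
Qed.

Let measurable_odds_fun : measurable_fun [set: measurableTypeR R]
  (odds_fun : measurableTypeR R -> measurableTypeR R).
Proof.
apply: measurable_funM; first exact: measurable_funB.
exact: measurable_powR.
Qed.

Lemma obs_odds I i : I i -> obs I (fun w => odds w i).
Proof.
move=> Ii; split; last by move=> w; exact: odds_ge0.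
rewrite /depends (_ : (fun _ => _) = odds_fun \o (fun w => env_at w i)).
  exact: (measurableT_comp measurable_odds_fun (depends_env_at Ii)).
by apply/funext => w; exact: oddsE.
Qed.

Context (P : probability (env R) R).

Definition mean f : \bar R := (\int[P]_w (f w)%:E)%E.

Lemma mean_ge0 I f : obs I f -> (0 <= mean f)%E.
Proof. by move=> [_ f0]; apply: integral_ge0 => w _; rewrite lee_fin. Qed.

Lemma mean_le I J f g : obs I f -> obs J g -> (forall w, f w <= g w) ->
  (mean f <= mean g)%E.
Proof.
move=> of_ og fg; apply: ge0_le_integral => //.
- by move=> w _; rewrite lee_fin; exact: (obs_ge0 of_).
- by apply/measurable_EFinP; exact: obs_measurable of_.
- by apply/measurable_EFinP; exact: obs_measurable og.
- by move=> w _; rewrite lee_fin.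
Qed.

Lemma mean_cst x : mean (fun=> x) = x%:E.
Proof.
rewrite /mean integral_cst//= -[RHS]mule1; congr (_ * _)%E.
exact: probability_setT.
Qed.

Lemma mean0 : mean (fun=> 0) = 0%E. Proof. exact: mean_cst. Qed.

Lemma meanD I J f g : obs I f -> obs J g ->
  (mean (fun w => f w + g w)%R = mean f + mean g)%E.
Proof.
move=> of_ og; rewrite /mean -ge0_integralD//.
- by move=> w _; rewrite lee_fin; exact: (obs_ge0 of_).
- by apply/measurable_EFinP; exact: obs_measurable of_.
- by move=> w _; rewrite lee_fin; exact: (obs_ge0 og).
- by apply/measurable_EFinP; exact: obs_measurable og.
Qed.

Lemma meanZ I x f : 0 <= x -> obs I f -> (mean (fun w => x * f w)%R = x%:E * mean f)%E.
Proof.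
move=> x0 of_; rewrite /mean -ge0_integralZl//.
- by apply/measurable_EFinP; exact: obs_measurable of_.
- by move=> w _; rewrite lee_fin; exact: (obs_ge0 of_).
Qed.

Lemma mean_sum I (T : Type) (r : seq T) (F : T -> env R -> R) :
  (forall i, obs I (F i)) ->
  (mean (fun w => \sum_(i <- r) F i w)%R = \sum_(i <- r) mean (F i))%E.
Proof.
move=> h; elim: r => [|i r IH].
  by rewrite big_nil -mean0; congr mean; apply/funext => w; rewrite big_nil.
rewrite big_cons -IH -(meanD (h i) (obs_sum r h)).
by congr mean; apply/funext => w; rewrite big_cons.
Qed.

Hypothesis iidP : iid_product P.

Lemma meanM I J f g : I `&` J = set0 -> obs I f -> obs J g ->
  (mean (fun w => f w * g w)%R = mean f * mean g)%E.
Proof. by move=> IJ [df f0] [dg g0]; exact: depends_indep IJ _ _ df dg. Qed.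

Lemma mean_site (F : R -> R) i : (forall x, 0 <= F x) ->
  measurable_fun [set: measurableTypeR R] F ->
  mean (fun w => F (odds w i)) = mean (fun w => F (odds w 0)).
Proof.
move=> F0 mF; rewrite /mean.
under eq_integral do rewrite oddsE.
under [RHS]eq_integral do rewrite oddsE.
apply: (iid_integral_at (F := F \o odds_fun)) => // [x|]; first exact: F0.
exact: (measurableT_comp mF measurable_odds_fun).
Qed.

End observables.

Section expectation.
Context {R : realType} (P : probability (env R) R).
Implicit Types (w : env R) (I J : set int) (f g : env R -> R) (x y : R).

Definition L1 I f := obs I f /\ (mean P f < +oo)%E.

(** Real valued, and meaningful on L1 only, since fine sends +oo to 0. *)
Definition E f : R := fine (mean P f).

Lemma L1_obs I f : L1 I f -> obs I f. Proof. by case. Qed.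

Lemma L1E I f : L1 I f -> mean P f = (E f)%:E.
Proof.
move=> [of_ foo]; rewrite fineK// ge0_fin_numE//.
exact: mean_ge0 of_.
Qed.

Lemma E_ge0 f : (forall w, 0 <= f w) -> 0 <= E f.
Proof.
by move=> f0; apply: fine_ge0; apply: integral_ge0 => w _; rewrite lee_fin.
Qed.

Lemma L1_sub I J f : I `<=` J -> L1 I f -> L1 J f.
Proof. by move=> IJ [of_ foo]; split => //; exact: obs_sub of_. Qed.

Lemma L1_le I J f g : obs I f -> L1 J g -> (forall w, f w <= g w) -> L1 I f.
Proof.
move=> of_ [og goo] fg; split=> //; apply: le_lt_trans goo.
exact: mean_le of_ og fg.
Qed.

Lemma E_le I J f g : obs I f -> L1 J g -> (forall w, f w <= g w) -> E f <= E g.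
Proof.
move=> of_ Lg fg; have Lf := L1_le of_ Lg fg.
by rewrite -lee_fin -(L1E Lf) -(L1E Lg); apply: mean_le of_ (L1_obs Lg) fg.
Qed.

Lemma L1_cst I x : 0 <= x -> L1 I (fun=> x).
Proof. by move=> x0; split; [exact: obs_cst|rewrite mean_cst ltry]. Qed.

Lemma E_cst x : E (fun=> x) = x.
Proof. by rewrite /E mean_cst. Qed.

Lemma L1_bounded I f c : obs I f -> (forall w, f w <= c) -> L1 I f.
Proof.
move=> of_ fc; apply: (@L1_le _ I _ (fun=> Num.max c 0)) => //.
  by apply: L1_cst; rewrite le_max lexx orbT.
by move=> w; rewrite le_max fc.
Qed.

Lemma E_cst_le I f c : obs I f -> (forall w, f w <= c) -> E f <= c.
Proof.
move=> of_ fc; have c0 : 0 <= c := le_trans (obs_ge0 of_ point) (fc point).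
by rewrite -[leRHS]E_cst; apply: E_le of_ (@L1_cst I _ c0) fc.
Qed.

Lemma L1D I f g : L1 I f -> L1 I g -> L1 I (fun w => f w + g w).
Proof.
move=> [of_ foo] [og goo]; split; first exact: obsD.
by rewrite (meanD P of_ og) lte_add_pinfty.
Qed.

Lemma ED I J f g : L1 I f -> L1 J g -> E (fun w => f w + g w) = E f + E g.
Proof.
move=> Lf Lg; apply: EFin_inj; rewrite EFinD -(L1E Lf) -(L1E Lg).
rewrite -(@L1E setT) ?(meanD P (L1_obs Lf) (L1_obs Lg))//.
by apply: L1D; [exact: L1_sub (@subsetT _ I) Lf|exact: L1_sub (@subsetT _ J) Lg].
Qed.

Lemma L1Z I x f : 0 <= x -> L1 I f -> L1 I (fun w => x * f w).
Proof.
move=> x0 [of_ foo]; split; first exact: obsZ.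
by rewrite (meanZ P x0 of_) lte_mul_pinfty.
Qed.

Lemma EZ I x f : 0 <= x -> L1 I f -> E (fun w => x * f w) = x * E f.
Proof.
move=> x0 Lf; apply: EFin_inj; rewrite EFinM -(L1E Lf).
by rewrite -(@L1E I) ?(meanZ P x0 (L1_obs Lf))//; exact: L1Z.
Qed.

Lemma L1_sum I (T : Type) (r : seq T) (F : T -> env R -> R) :
  (forall i, L1 I (F i)) -> L1 I (fun w => \sum_(i <- r) F i w).
Proof.
move=> h; have h' i : obs I (F i) by have [] := h i.
split; first exact: obs_sum.
by rewrite (mean_sum _ r h') lte_sum_pinfty// => i _; have [] := h i.
Qed.

Lemma E_sum I (T : Type) (r : seq T) (F : T -> env R -> R) :
  (forall i, L1 I (F i)) ->
  E (fun w => \sum_(i <- r) F i w) = \sum_(i <- r) E (F i).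
Proof.
move=> h; have h' i : obs I (F i) by have [] := h i.
apply: EFin_inj; rewrite -(L1E (L1_sum r h)) (mean_sum _ r h') -sumEFin.
by apply: eq_bigr => i _; exact: L1E (h i).
Qed.

Hypothesis iidP : iid_product P.

Lemma L1M I J f g : I `&` J = set0 -> L1 I f -> L1 J g ->
  L1 (I `|` J) (fun w => f w * g w).
Proof.
move=> IJ Lf Lg; split.
  by apply: obsM; apply: obs_sub; [|exact: (L1_obs Lf)| |exact: (L1_obs Lg)] => i;
    [left|right].
rewrite (meanM iidP IJ (L1_obs Lf) (L1_obs Lg)) (L1E Lf) (L1E Lg) -EFinM.
exact: ltry.
Qed.

Lemma EM I J f g : I `&` J = set0 -> L1 I f -> L1 J g ->
  E (fun w => f w * g w) = E f * E g.
Proof.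
move=> IJ Lf Lg; apply: EFin_inj; rewrite -(L1E (L1M IJ Lf Lg)).
by rewrite (meanM iidP IJ (L1_obs Lf) (L1_obs Lg)) (L1E Lf) (L1E Lg) -EFinM.
Qed.

Lemma L1_site (F : R -> R) i : (forall x, 0 <= F x) ->
  measurable_fun [set: measurableTypeR R] F ->
  L1 [set 0] (fun w => F (odds w 0)) -> L1 [set i] (fun w => F (odds w i)).
Proof.
move=> F0 mF [of_ foo]; split; last by rewrite mean_site.
split; last by move=> w; exact: F0.
have [di _] := @obs_odds R [set i] i erefl.
exact: (measurableT_comp mF di).
Qed.

Lemma E_site (F : R -> R) i : (forall x, 0 <= F x) ->
  measurable_fun [set: measurableTypeR R] F ->
  E (fun w => F (odds w i)) = E (fun w => F (odds w 0)).
Proof. by move=> F0 mF; rewrite /E mean_site. Qed.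

End expectation.

(** * Products of odds and first passages *)

Section products.
Context {R : realType} (P : probability (env R) R).
Hypothesis iidP : iid_product P.
Implicit Types (w : env R) (x y : R) (sg : nat -> int).

Definition stretch sg (a b : nat) : set int :=
  [set i | exists2 j, (a <= j < b)%N & i = sg j].

(** The exponential of the increment of the potential of the walk. The
    enumeration sg of the sites allows stretches that are read from left to
    right as well as from right to left. *)
Definition Pi sg (a b : nat) w : R := \prod_(a <= j < b) odds w (sg j).

Lemma Pi_ge0 sg a b w : 0 <= Pi sg a b w.
Proof. by apply: prodr_ge0 => j _; exact: odds_ge0. Qed.

Lemma PiM sg a b c w : (a <= b <= c)%N -> Pi sg a c w = Pi sg a b w * Pi sg b c w.
Proof. by move=> /andP[ab bc]; rewrite /Pi (big_cat_nat ab bc). Qed.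

Lemma Pi_nil sg a w : Pi sg a a w = 1.
Proof. by rewrite /Pi big_geq. Qed.

Lemma Pi_recr sg a b w : (a <= b)%N -> Pi sg a b.+1 w = Pi sg a b w * odds w (sg b).
Proof. by move=> ab; rewrite /Pi big_nat_recr. Qed.

Lemma stretch_sub sg a b a' b' : (a' <= a)%N -> (b <= b')%N ->
  stretch sg a b `<=` stretch sg a' b'.
Proof.
move=> aa' bb' _ [j /andP[aj jb] ->]; exists j => //.
by rewrite (leq_trans aa') ?(leq_trans jb).
Qed.

Lemma obs_Pi sg a b : obs (stretch sg a b) (Pi sg a b).
Proof.
apply: obs_prod => j; rewrite mem_index_iota => jab.
by apply: obs_odds; exists j.
Qed.

Lemma obs_Pi_sub sg a b a' b' : (a' <= a)%N -> (b <= b')%N ->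
  obs (stretch sg a' b') (Pi sg a b).
Proof. by move=> aa' bb'; apply: obs_sub (obs_Pi sg a b); exact: stretch_sub. Qed.

Lemma stretch_disj sg a b c d : injective sg -> (b <= c)%N ->
  stretch sg a b `&` stretch sg c d = set0.
Proof.
move=> inj bc; apply/seteqP; split => // i [[j /andP[_ jb] ->] [k /andP[ck _] /inj jk]].
by move: jb; rewrite jk ltnNge (leq_trans bc ck).
Qed.

Section moments.
Variables (p M : R).
Hypothesis L1p : L1 P [set 0] (fun w => odds w 0 `^ p).
Hypothesis EM_p : E P (fun w => odds w 0 `^ p) = M.

Lemma L1_odds_pow i : L1 P [set i] (fun w => odds w i `^ p).
Proof.
apply: (@L1_site _ P iidP (fun x => x `^ p)) => //.
by move=> x; exact: powR_ge0.
Qed.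

Lemma E_odds_pow i : E P (fun w => odds w i `^ p) = M.
Proof.
rewrite -EM_p; apply: (@E_site _ P iidP (fun x => x `^ p)) => //.
by move=> x; exact: powR_ge0.
Qed.

Lemma Pi_moment sg a k : injective sg ->
  L1 P (stretch sg a (a + k)) (fun w => Pi sg a (a + k) w `^ p) /\
  E P (fun w => Pi sg a (a + k) w `^ p) = M ^+ k.
Proof.
move=> inj; elim: k => [|k [IHL IHE]].
  rewrite addn0 expr0.
  have -> : (fun w => Pi sg a a w `^ p) = fun=> 1.
    by apply/funext => w; rewrite Pi_nil powR1.
  by split; [exact: L1_cst|rewrite E_cst].
have -> : (fun w => Pi sg a (a + k.+1) w `^ p) =
    fun w => Pi sg a (a + k) w `^ p * odds w (sg (a + k)%N) `^ p.
  apply/funext => w; rewrite addnS Pi_recr ?leq_addr// powRM//.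
    exact: Pi_ge0.
  exact: odds_ge0.
have dis : stretch sg a (a + k) `&` [set sg (a + k)%N] = set0.
  apply/seteqP; split => // i [[j /andP[_ jk] ->]] /= /inj jE.
  by rewrite jE ltnn in jk.
split.
  apply: L1_sub (L1M iidP dis IHL (L1_odds_pow _)) => i [|->].
    by apply: stretch_sub => //; rewrite addnS.
  by exists (a + k)%N => //; rewrite leq_addr addnS /=.
by rewrite (EM iidP dis IHL (L1_odds_pow _)) IHE E_odds_pow exprSr.
Qed.

Lemma L1_Pi_pow sg a b : injective sg -> (a <= b)%N ->
  L1 P (stretch sg a b) (fun w => Pi sg a b w `^ p).
Proof. by move=> inj ab; have [] := @Pi_moment sg a (b - a) inj; rewrite subnKC. Qed.

Lemma E_Pi_pow sg a b : injective sg -> (a <= b)%N ->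
  E P (fun w => Pi sg a b w `^ p) = M ^+ (b - a).
Proof. by move=> inj ab; have [] := @Pi_moment sg a (b - a) inj; rewrite subnKC. Qed.

End moments.

Section first_passage.
Variables (sg : nat -> int) (a : nat) (y : R).

(** With values 0 and 1, [below k] indicates that no product of length less than
    k exceeds y, and [passage k] that k is the first length to do so. *)
Definition below k w : R := \prod_(j < k) (Pi sg a (a + j) w <= y)%R%:R.
Definition passage k w : R := below k w * (y < Pi sg a (a + k) w)%R%:R.

Lemma below_ge0 k w : 0 <= below k w.
Proof. by apply: prodr_ge0 => j _; exact: ler0n. Qed.

Lemma below_le1 k w : below k w <= 1.
Proof. by apply: prodr_ile1 => j _; rewrite ler0n lern1 leq_b1. Qed.

Lemma passage_ge0 k w : 0 <= passage k w.
Proof. by rewrite mulr_ge0 ?below_ge0. Qed.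

Lemma passage_le1 k w : passage k w <= 1.
Proof.
by rewrite mulr_ile1 ?below_ge0 ?ler0n ?below_le1// lern1 leq_b1.
Qed.

Lemma belowS k w : below k.+1 w = below k w - passage k w.
Proof.
rewrite /below big_ord_recr/= -/(below k w) /passage ltNge.
by case: (_ <= y); rewrite ?mulr1 ?mulr0 ?subr0 ?subrr.
Qed.

Lemma sum_passage k w : \sum_(j < k) passage j w = 1 - below k w.
Proof.
elim: k => [|k IH]; first by rewrite big_ord0 /below big_ord0 subrr.
by rewrite big_ord_recr/= IH belowS; ring.
Qed.

Lemma sum_passage_eq1 k w : y < Pi sg a (a + k) w -> \sum_(j < k.+1) passage j w = 1.
Proof.
move=> yk; rewrite sum_passage /below big_ord_recr/= leNgt yk/= mulr0.
by rewrite subr0.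
Qed.

Lemma sum_passage_le1 k w : \sum_(j < k) passage j w <= 1.
Proof. by rewrite sum_passage gerBl below_ge0. Qed.

Lemma obs_below k n : (k <= n.+1)%N -> 0 <= y -> obs (stretch sg a (a + n)) (below k).
Proof.
move=> kn y0; rewrite /below.
have -> : (fun w => \prod_(j < k) ((Pi sg a (a + j) w <= y)%R%:R : R)) =
   (fun w => \prod_(j <- enum 'I_k) ((Pi sg a (a + j) w <= y)%R%:R : R)).
  by apply/funext => w; rewrite big_enum.
apply: obs_prod => j _; apply: obs_le; last exact: obs_cst.
apply: obs_Pi_sub => //; rewrite leq_add2l.
by have := ltn_ord j; move: (nat_of_ord j) => j' jk; rewrite -ltnS (leq_trans jk).
Qed.

Lemma obs_passage k : 0 <= y -> obs (stretch sg a (a + k)) (passage k).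
Proof.
move=> y0; apply: obsM; first exact: obs_below.
by apply: obs_lt; [exact: obs_cst|exact: obs_Pi].
Qed.

End first_passage.

End products.

(** * Power tails of the products *)

Section geometric_sums.
Context {R : realType}.

Lemma sum_geometric_le (q : R) n : 0 <= q < 1 -> \sum_(i < n) q ^+ i <= (1 - q)^-1.
Proof.
move=> /andP[q0 q1]; have q1' : 0 < 1 - q by rewrite subr_gt0.
rewrite -[leRHS]mul1r ler_pdivlMr// mulrC.
have -> : (1 - q) * (\sum_(i < n) q ^+ i) = 1 - q ^+ n.
  by rewrite -[RHS]opprB subrX1 -mulNr opprB.
by rewrite gerBl exprn_ge0.
Qed.

Lemma powR_exprn (u p : R) n : 0 <= u -> (u ^+ n) `^ p = (u `^ p) ^+ n.
Proof.
move=> u0; rewrite -(powR_mulrn n u0) powRAC powR_mulrn//; exact: powR_ge0.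
Qed.

Lemma sum_convolution_le (q : R) (c : nat -> R) n : 0 <= q < 1 ->
  (forall j, 0 <= c j) ->
  \sum_(k < n) \sum_(j < k.+1) c j * q ^+ (k - j) <= (\sum_(j < n) c j) / (1 - q).
Proof.
move=> q01 c0.
have -> : \sum_(k < n) \sum_(j < k.+1) c j * q ^+ (k - j) =
    \sum_(j < n) c j * \sum_(i < n - j) q ^+ i.
  elim: n => [|n IH]; first by rewrite !big_ord0.
  rewrite big_ord_recr/= IH [in RHS]big_ord_recr/= [X in _ + X]big_ord_recr/=.
  rewrite subSn// subnn big_ord1 expr0 addrA; congr (_ + _).
  rewrite -big_split/=; apply: eq_bigr => j _.
  by rewrite subSn ?(ltnW (ltn_ord j))// big_ord_recr/= mulrDr.
rewrite mulr_suml; apply: ler_sum => j _.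
by rewrite ler_wpM2l// sum_geometric_le.
Qed.

End geometric_sums.

Lemma quarter_le (R : realFieldType) (u d e : R) : 1 <= u + (d + e) + 4^-1 ->
  d <= 4^-1 -> e <= 4^-1 -> 4^-1 <= u.
Proof. lra. Qed.

Section tails.
Context {R : realType} (P : probability (env R) R).
Hypothesis iidP : iid_product P.
Variables (s q : R).
Hypotheses (s0 : 0 < s).
Hypothesis L1s : L1 P [set 0] (fun w => odds w 0 `^ s).
Hypothesis E1s : E P (fun w => odds w 0 `^ s) = 1.
Hypothesis L1h : L1 P [set 0] (fun w => odds w 0 `^ (s / 2)).
Hypothesis Eqh : E P (fun w => odds w 0 `^ (s / 2)) = q.
Hypothesis q1 : q < 1.
Implicit Types (w : env R) (x y : R).

Let h0 : 0 < s / 2. Proof. exact: divr_gt0. Qed.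

Let q01 : 0 <= q < 1.
Proof. by rewrite q1 andbT -Eqh; apply: E_ge0 => w; exact: powR_ge0. Qed.

Variables (sg : nat -> int).
Hypothesis inj : injective sg.

Let L1Ps a b (ab : (a <= b)%N) := L1_Pi_pow iidP L1s E1s inj ab.
Let L1Ph a b (ab : (a <= b)%N) := L1_Pi_pow iidP L1h Eqh inj ab.
Let EPs a b : (a <= b)%N -> E P (fun w => Pi sg a b w `^ s) = 1.
Proof. by move=> ab; rewrite (E_Pi_pow iidP L1s E1s inj ab) expr1n. Qed.
Let EPh a b (ab : (a <= b)%N) := E_Pi_pow iidP L1h Eqh inj ab.

Lemma L1_passage_pow p a y k : L1 P (stretch sg a (a + k)) (fun w => Pi sg a (a + k) w `^ p) ->
  0 <= y ->
  L1 P (stretch sg a (a + k))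
    (fun w => passage sg a y k w * Pi sg a (a + k) w `^ p).
Proof.
move=> Lp y0; apply: L1_le Lp _.
  by apply: obsM; [exact: obs_passage|apply: obs_pow; exact: obs_Pi].
move=> w; rewrite ler_piMl ?powR_ge0//; exact: passage_le1.
Qed.

(** The martingale property of Pi^s, at a first passage: the passage and the
    product up to it involve other sites than the rest of the product, whose
    moment of order s is 1. *)
Lemma passage_martingale a y k J : 0 <= y -> (k <= J)%N ->
  L1 P (stretch sg a (a + J))
    (fun w => passage sg a y k w * Pi sg a (a + J) w `^ s) /\
  E P (fun w => passage sg a y k w * Pi sg a (a + k) w `^ s) =
  E P (fun w => passage sg a y k w * Pi sg a (a + J) w `^ s).
Proof.
move=> y0 kJ; have akJ : (a + k <= a + J)%N by rewrite leq_add2l.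
have -> : (fun w => passage sg a y k w * Pi sg a (a + J) w `^ s) =
    fun w => (passage sg a y k w * Pi sg a (a + k) w `^ s) *
             Pi sg (a + k) (a + J) w `^ s.
  apply/funext => w; rewrite (@PiM _ sg a (a + k)) ?leq_addr ?akJ//.
  by rewrite powRM ?Pi_ge0// mulrA.
have dis := @stretch_disj sg a (a + k) (a + k) (a + J) inj (leqnn _).
have L := L1_passage_pow (L1Ps (leq_addr k a)) y0.
split; last by rewrite (EM iidP dis L (L1Ps akJ)) EPs// mulr1.
apply: L1_sub (L1M iidP dis L (L1Ps akJ)) => i [|];
  by apply: stretch_sub; rewrite ?leq_addr.
Qed.

(** Optional stopping at the first passage above y. *)
Lemma passage_weight a y J : 0 <= y ->
  \sum_(k < J) E P (fun w => passage sg a y k w * Pi sg a (a + k) w `^ s) <= 1.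
Proof.
move=> y0; rewrite -(EPs (leq_addr J a)).
have step (k : 'I_J) := passage_martingale a y0 (ltnW (ltn_ord k)).
under eq_bigr do rewrite (proj2 (step _)).
have Lstep (k : 'I_J) := proj1 (step k).
rewrite -(E_sum _ Lstep).
apply: (E_le (L1_obs (L1_sum _ Lstep)) (L1Ps (leq_addr J a))) => w.
rewrite -mulr_suml ler_piMl ?powR_ge0//.
exact: sum_passage_le1.
Qed.

(** Follows from the bound on the weights of order s, as Pi^(s/2) <= y^(-s/2) Pi^s
    at a passage above y. *)
Lemma half_passage_weight a y J : 0 < y ->
  \sum_(k < J) E P (fun w => passage sg a y k w * Pi sg a (a + k) w `^ (s / 2)) <=
  y `^ (- (s / 2)).
Proof.
move=> y0; have y00 := ltW y0.
rewrite -[leRHS]mulr1; apply: le_trans (ler_wpM2l (powR_ge0 _ _) (passage_weight a J y00)).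
rewrite mulr_sumr; apply: ler_sum => k _.
have L := L1_passage_pow (L1Ps (leq_addr k a)) y00.
rewrite -(EZ (powR_ge0 _ _) L).
apply: E_le (L1Z (powR_ge0 _ _) L) _.
  exact: L1_obs (L1_passage_pow (L1Ph (leq_addr k a)) y00).
move=> w; rewrite /passage; case: ltP => yP; last by rewrite !(mulr0, mul0r).
rewrite mulr1 mulrCA ler_wpM2l ?below_ge0//.
have P0 : 0 < Pi sg a (a + k) w by exact: lt_trans yP.
have -> : Pi sg a (a + k) w `^ s =
    Pi sg a (a + k) w `^ (s / 2) * Pi sg a (a + k) w `^ (s / 2).
  by rewrite -powRD -?splitr// (gt_eqF P0) implybT.
rewrite powRN ler_pdivlMl ?powR_gt0//.
by rewrite ler_wpM2r ?powR_ge0// ge0_ler_powR ?nnegrE ?(ltW h0) ?ltW.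
Qed.

(** The mean number of lengths k, and not just the probability that there is
    one, is of order y^-s: beyond the first passage at j, Markov's inequality
    with the exponent s/2 makes the chance to exceed y again at k decay like
    q^(k - j). *)
Lemma tail_count a y J : 0 < y ->
  \sum_(k < J) E P (fun w => (y < Pi sg a (a + k) w)%R%:R) <= y `^ (- s) / (1 - q).
Proof.
move=> y0; have y00 := ltW y0.
pose c j := E P (fun w => passage sg a y j w * Pi sg a (a + j) w `^ (s / 2)).
have c0 j : 0 <= c j.
  by apply: E_ge0 => w; rewrite mulr_ge0 ?passage_ge0 ?powR_ge0.
suff step k : E P (fun w => (y < Pi sg a (a + k) w)%R%:R) <=
    y `^ (- (s / 2)) * \sum_(j < k.+1) c j * q ^+ (k - j).
  apply: (@le_trans _ _ (y `^ (- (s / 2)) * \sum_(k < J) \sum_(j < k.+1) c j * q ^+ (k - j))).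
    by rewrite mulr_sumr; apply: ler_sum => k _; exact: step.
  have := ler_wpM2l (powR_ge0 y (- (s / 2))) (sum_convolution_le J q01 c0).
  move/le_trans; apply; rewrite mulrA ler_wpM2r ?invr_ge0 ?subr_ge0 ?(ltW q1)//.
  have := ler_wpM2l (powR_ge0 y (- (s / 2))) (@half_passage_weight a y J y0).
  move/le_trans; apply; rewrite -powRD; last by rewrite (gt_eqF y0) implybT.
  by rewrite -opprD -splitr.
have L (j : 'I_k.+1) :
    L1 P (stretch sg a (a + k)) (fun w => (passage sg a y j w * Pi sg a (a + j) w `^ (s / 2)) *
       Pi sg (a + j) (a + k) w `^ (s / 2)) /\
    E P (fun w => (passage sg a y j w * Pi sg a (a + j) w `^ (s / 2)) *
       Pi sg (a + j) (a + k) w `^ (s / 2)) = c j * q ^+ (k - j).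
  have jk : (j <= k)%N by rewrite -ltnS.
  have ajk : (a + j <= a + k)%N by rewrite leq_add2l.
  have dis := @stretch_disj sg a (a + j) (a + j) (a + k) inj (leqnn _).
  have Lj := L1_passage_pow (L1Ph (leq_addr j a)) y00.
  split; last by rewrite (EM iidP dis Lj (L1Ph ajk)) EPh// subnDl.
  apply: L1_sub (L1M iidP dis Lj (L1Ph ajk)) => i [|];
    by apply: stretch_sub; rewrite ?leq_addr.
under eq_bigr do rewrite -(proj2 (L _)).
have Lstep (j : 'I_k.+1) := proj1 (L j).
rewrite -(E_sum _ Lstep) -(EZ (powR_ge0 _ _) (L1_sum _ Lstep)).
have Ly : obs (stretch sg a (a + k)) (fun w => (y < Pi sg a (a + k) w)%R%:R).
  exact: (obs_lt (obs_cst _ y00) (obs_Pi sg a (a + k))).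
apply: (E_le Ly (L1Z (powR_ge0 _ _) (L1_sum _ Lstep))) => w.
case: ltP => yP; last first.
  apply: mulr_ge0; first exact: powR_ge0.
  apply: sumr_ge0 => j _; apply: mulr_ge0; last exact: powR_ge0.
  by apply: mulr_ge0; [exact: passage_ge0|exact: powR_ge0].
have -> : \sum_(j < k.+1) passage sg a y j w * Pi sg a (a + j) w `^ (s / 2) *
       Pi sg (a + j) (a + k) w `^ (s / 2) =
     \sum_(j < k.+1) passage sg a y j w * Pi sg a (a + k) w `^ (s / 2).
  apply: eq_bigr => j _; have jk : (j <= k)%N by rewrite -ltnS.
  rewrite (@PiM _ sg a (a + j) (a + k)) ?leq_addr ?leq_add2l//.
  by rewrite powRM ?Pi_ge0// mulrA.
rewrite -mulr_suml sum_passage_eq1// mul1r powRN -ler_pdivrMl ?invr_gt0 ?powR_gt0//.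
by rewrite invrK mulr1 ge0_ler_powR ?nnegrE ?(ltW h0) ?Pi_ge0// ltW.
Qed.

Lemma L1_passage a y k : 0 <= y -> L1 P (stretch sg a (a + k)) (passage sg a y k).
Proof.
by move=> y0; apply: L1_bounded (obs_passage sg a k y0) _ => w; exact: passage_le1.
Qed.

Lemma L1_above a y k : 0 <= y ->
  L1 P (stretch sg a (a + k)) (fun w => (y < Pi sg a (a + k) w)%R%:R).
Proof.
move=> y0; have o := obs_lt (obs_cst (stretch sg a (a + k)) y0) (obs_Pi sg a (a + k)).
by apply: (@L1_bounded _ P _ _ 1 o) => w; rewrite lern1 leq_b1.
Qed.

Let y_ x i : R := x * 2^-1 ^+ i.

Let y_gt0 x i : 0 < x -> 0 < y_ x i.
Proof. by move=> x0; rewrite mulr_gt0// exprn_gt0// invr_gt0. Qed.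

Let y_S x i : y_ x i = 2 * y_ x i.+1.
Proof. by rewrite /y_ exprS; field. Qed.

Let min_dyadic x u I : 0 < x ->
  Num.min u x <= \sum_(i < I) y_ x i * (y_ x i.+1 < u)%R%:R + y_ x I.
Proof.
move=> x0; apply: (@le_trans _ _ (\sum_(i < I) y_ x i * (y_ x i.+1 < u)%R%:R +
    Num.min u (y_ x I))); last by rewrite lerD2l ge_min lexx orbT.
elim: I => [|I IH]; first by rewrite big_ord0 add0r /y_ expr0 mulr1.
apply: (le_trans IH); rewrite big_ord_recr/= -addrA lerD2l.
case: ltP => yu; last by rewrite mulr0 add0r ge_min lexx.
rewrite mulr1; apply: (@le_trans _ _ (y_ x I)).
  by rewrite ge_min lexx orbT.
by rewrite lerDl ltW// y_gt0.
Qed.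

Let half_pow_small (c e : R) : 0 < e -> exists I, c * 2^-1 ^+ I <= e.
Proof.
move=> e0; exists (Num.truncn (`|c| / e)).+1; set I := (Num.truncn _).+1.
have cI : `|c| / e <= I%:R by apply: ltW; exact: truncnS_gt.
have I2 : (I%:R : R) <= 2 ^+ I.
  by rewrite -natrX ler_nat ltnW// ltn_expl.
rewrite exprVn ler_pdivrMr ?exprn_gt0// (le_trans (ler_norm c))//.
by rewrite -ler_pdivrMl// mulrC (le_trans cI).
Qed.

Definition min_const := 2 / (1 - q) / (1 - 2^-1 `^ (1 - s)) + 1.

(** Sum [tail_count] over the dyadic levels below x: the contribution of the
    level x / 2^i is at most of order (x / 2^i)^(1 - s), a geometric sequence
    because s < 1. *)
Lemma sum_min_le a x J : s < 1 -> 0 < x ->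
  \sum_(k < J) E P (fun w => Num.min (Pi sg a (a + k) w) x) <=
  min_const * x `^ (1 - s).
Proof.
move=> s1 x0; have s1' : 0 < 1 - s by rewrite subr_gt0.
have [I xI] := half_pow_small (J%:R * x) (powR_gt0 (1 - s) x0).
have step (k : 'I_J) : E P (fun w => Num.min (Pi sg a (a + k) w) x) <=
    \sum_(i < I) y_ x i * E P (fun w => (y_ x i.+1 < Pi sg a (a + k) w)%R%:R) + y_ x I.
  have Li (i : 'I_I) :=
    L1Z (ltW (y_gt0 i x0)) (L1_above a k (ltW (y_gt0 i.+1 x0))).
  have LyI := L1_cst P (stretch sg a (a + k)) (ltW (y_gt0 I x0)).
  rewrite -[X in _ + X](E_cst P); under eq_bigr => i _.
    rewrite -(EZ (ltW (y_gt0 i x0)) (L1_above a k (ltW (y_gt0 i.+1 x0)))). over.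
  rewrite -(E_sum _ Li) -(ED (L1_sum _ Li) LyI).
  apply: (E_le _ (L1D (L1_sum _ Li) LyI)).
    exact: (obs_min (obs_Pi sg a (a + k)) (obs_cst _ (ltW x0))).
  by move=> w; exact: min_dyadic.
apply: le_trans (ler_sum _ (fun k _ => step k)) _.
rewrite big_split/= sumr_const card_ord -mulr_natl mulrA.
rewrite mulrDl mul1r lerD// exchange_big/=.
pose g : R := 2^-1 `^ (1 - s).
have g01 : 0 <= g < 1.
  rewrite powR_ge0/=; apply: (@lt_le_trans _ _ (1 `^ (1 - s))); last by rewrite powR1.
  by apply: gt0_ltr_powR; rewrite ?nnegrE ?invr_ge0// invf_lt1 ?ltr1n.
have term (i : 'I_I) : \sum_(k < J) y_ x i * E P (fun w => (y_ x i.+1 < Pi sg a (a + k) w)%R%:R)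
    <= (2 / (1 - q) * x `^ (1 - s)) * g ^+ i.
  rewrite -mulr_sumr.
  apply: le_trans (ler_wpM2l (ltW (y_gt0 i x0)) (tail_count a J (y_gt0 i.+1 x0))) _.
  have -> : y_ x i * (y_ x i.+1 `^ (- s) / (1 - q)) =
      2 / (1 - q) * (y_ x i.+1 `^ (1 - s)).
    rewrite powRD ?powRr1 ?(ltW (y_gt0 _ _))//; last first.
      by rewrite (gt_eqF (y_gt0 _ x0)) implybT.
    by rewrite y_S; ring.
  rewrite -[leRHS]mulrA ler_wpM2l ?divr_ge0// ?subr_ge0 ?(ltW q1)//.
  rewrite /y_ powRM ?(ltW x0)// ?exprn_ge0// ?invr_ge0// ler_wpM2l ?powR_ge0//.
  have /andP[g0 /ltW g1] := g01.
  by rewrite powR_exprn ?invr_ge0// -/g exprS ler_piMl ?exprn_ge0.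
apply: le_trans (ler_sum _ (fun i _ => term i)) _.
rewrite -mulr_sumr; have /andP[g0 g1] := g01.
apply: (@le_trans _ _ ((2 / (1 - q) * x `^ (1 - s)) * (1 - g)^-1)).
  rewrite ler_wpM2l ?sum_geometric_le// mulr_ge0 ?powR_ge0// divr_ge0//.
  by rewrite subr_ge0 ltW.
by rewrite le_eqVlt; apply/orP; left; apply/eqP; rewrite -/g; ring.
Qed.

(** The part of the moment of order s that is due to odds above 2^i, which
    controls how far a product can jump over a level. *)
Definition big_odds i w (j : int) : R := odds w j `^ s * (2 ^+ i < odds w j)%R%:R.

Lemma L1_big_odds i j : L1 P [set j] (fun w => big_odds i w j).
Proof.
apply: (@L1_le _ P [set j] [set j] _ (fun w => odds w j `^ s)).
- have oj : obs [set j] (fun w : env R => odds w j) by exact: obs_odds.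
  by apply: obsM; [exact: obs_pow|apply: obs_lt => //; exact: obs_cst].
- exact: (L1_odds_pow iidP L1s j).
- by move=> w; rewrite /big_odds ler_piMr ?powR_ge0// lern1 leq_b1.
Qed.

Lemma E_big_odds i j : E P (fun w => big_odds i w j) = E P (fun w => big_odds i w 0).
Proof.
apply: (@E_site _ P iidP (fun u => u `^ s * (2 ^+ i < u)%R%:R)).
  by move=> u; rewrite mulr_ge0 ?powR_ge0.
apply: measurable_funM => //.
rewrite (_ : (fun _ => _) = fun u : R => if 2 ^+ i < u then 1 else 0).
  by apply: measurable_fun_ifT => //; exact: measurable_fun_ltr.
by apply/funext => u; case: ifP.
Qed.

(* A jump from u <= x over 2^l x by a factor r: if u is near the level x / 2^i,
   then r exceeds 2^(l + i). *)
Let dyadic_overshoot x l u r I : 0 < x -> 0 <= u -> 0 <= r -> u <= x ->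
  2 ^+ l * x < u * r ->
  (u * r) `^ s <=
    \sum_(i < I) (y_ x i) `^ s * (y_ x i.+1 < u)%R%:R * (r `^ s * (2 ^+ (l + i) < r)%R%:R)
    + u `^ s * (r `^ s * (2 ^+ (l + I) < r)%R%:R).
Proof.
move=> x0 u0 r0 ux xur.
have big i : u <= y_ x i -> 2 ^+ (l + i) < r.
  move=> uy; have up : 0 < u.
    rewrite lt_def u0 andbT; apply: contraTneq xur => ->.
    by rewrite mul0r -leNgt mulr_ge0 ?exprn_ge0// ltW.
  rewrite -(ltr_pM2l up); apply: le_lt_trans xur.
  apply: le_trans (ler_wpM2r _ uy) _; first exact: exprn_ge0.
  rewrite /y_ exprD exprVn le_eqVlt; apply/orP; left; apply/eqP; field.
  by rewrite expf_neq0.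
rewrite powRM//.
have {xur} : u `^ s * r `^ s <= \sum_(i < I) (y_ x i) `^ s * (y_ x i.+1 < u)%R%:R *
    (r `^ s * (2 ^+ (l + i) < r)%R%:R) + u `^ s * r `^ s * (u <= y_ x I)%R%:R.
  elim: I => [|I IH]; first by rewrite big_ord0 add0r /y_ expr0 mulr1 ux mulr1.
  apply: (le_trans IH); rewrite big_ord_recr/= -addrA lerD2l.
  case: (leP u (y_ x I)) => uI; last first.
    by rewrite mulr0 addr_ge0// !mulr_ge0// powR_ge0.
  case: (ltP (y_ x I.+1) u) => uI1.
    rewrite big//= !mulr1 mulr0 addr0 ler_wpM2r ?powR_ge0//.
    by rewrite ge0_ler_powR ?nnegrE// ltW// y_gt0.
  by rewrite !(mulr0, mul0r) add0r mulr1.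
move/le_trans; apply; rewrite lerD2l -mulrA ler_wpM2l ?powR_ge0// ler_wpM2l ?powR_ge0//.
by case: (leP u (y_ x I)) => [uI|_]; [rewrite (big _ uI)|exact: ler0n].
Qed.

(** The weights of order s of the first passages above x up to the horizon J
    add up to 1, up to the weight of the stretches that stay below x, which is
    at most x^(s/2) q^J. The passages above 2^l x weigh at most 1/2 because of
    the hypothesis on the overshoot, and each of the others weighs at most
    (2^l x)^s. *)
Lemma passage_lower a x l J : 1 <= x ->
  (forall I, \sum_(i < I) E P (fun w => big_odds (l + i) w 0) <= (1 - q) / (4 * 2 `^ s)) ->
  x `^ (s / 2) * q ^+ J <= 4^-1 ->
  (2 ^+ l * x) `^ (- s) / 4 <= \sum_(k < J.+1) E P (passage sg a x k).
Proof.
move=> x1 tail xq; have x0 : 0 < x := lt_le_trans ltr01 x1.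
have x00 := ltW x0.
set Lx := 2 ^+ l * x; have Lx0 : 0 < Lx by rewrite mulr_gt0// exprn_gt0.
pose b i := E P (fun w => big_odds i w 0).
have b_ge0 i : 0 <= b i.
  by apply: E_ge0 => w; rewrite /big_odds mulr_ge0 ?powR_ge0.
(* b is nonincreasing and its partial sums are bounded, so b (l + 2^I) is of order
   2^-I: the remainder left after I dyadic levels is harmless. *)
have [I bI] : exists I, J%:R * b (l + I)%N <= 4^-1.
  have e0 : (0 : R) < 4 * J.+1%:R by rewrite mulr_gt0.
  have [I hI] := half_pow_small ((1 - q) / (4 * 2 `^ s)) (divr_gt0 (@ltr01 R) e0).
  exists (2 ^ I)%N.
  have bmono i j : (i <= j)%N -> b j <= b i.
    move=> ij; apply: (E_le (L1_obs (L1_big_odds j 0)) (L1_big_odds i 0)) => w.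
    rewrite /big_odds ler_wpM2l ?powR_ge0// ler_nat.
    case: ltP => // hj; case: ltP => // hi.
    by have := lt_le_trans hj hi; rewrite ltNge ler_weXn2l// ler1n.
  have : (2 ^ I)%:R * b (l + 2 ^ I)%N <= (1 - q) / (4 * 2 `^ s).
    apply: le_trans (tail (2 ^ I)%N).
    rewrite mulr_natl -[X in _ *+ X]card_ord -sumr_const; apply: ler_sum => i _.
    by apply: bmono; rewrite leq_add2l ltnW.
  rewrite natrX -ler_pdivlMl ?exprn_gt0// -exprVn => hb.
  have {hb} : b (l + 2 ^ I)%N <= 1 / (4 * J.+1%:R).
    by apply: le_trans hI; rewrite mulrC.
  rewrite div1r invfM => hb.
  apply: (@le_trans _ _ (J.+1%:R * (4^-1 * J.+1%:R^-1))).
    by apply: ler_pM => //; rewrite ler_nat.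
  by rewrite mulrCA divff ?mulr1.
have Lp (k : 'I_J.+1) :=
  proj1 (passage_martingale a x00 (leq_ord k)).
have Lall := L1_sum (index_enum _) Lp.
have LJ := L1Ps (leq_addr J a).
have oB := obs_below sg a (leqnn J.+1) x00.
have LB : L1 P (stretch sg a (a + J)) (fun w => below sg a x J.+1 w * Pi sg a (a + J) w `^ s).
  apply: (L1_le _ LJ); first by apply: obsM => //; exact: (L1_obs LJ).
  by move=> w; rewrite ler_piMl ?powR_ge0// below_le1.
have half : E P (fun w => below sg a x J.+1 w * Pi sg a (a + J) w `^ s) <= 4^-1.
  apply: le_trans xq; rewrite -[X in _ * q ^+ X](addKn a J) -EPh ?leq_addr//.
  have Lh := L1Ph (leq_addr J a).
  rewrite -(EZ (powR_ge0 x (s / 2)) Lh).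
  apply: (E_le (L1_obs LB) (L1Z (powR_ge0 x (s / 2)) Lh)) => w.
  rewrite /below big_ord_recr/=; case: (leP (Pi sg a (a + J) w) x) => hx; last first.
    by rewrite mulr0 mul0r mulr_ge0// powR_ge0.
  rewrite mulr1; apply: le_trans (ler_piMl (powR_ge0 _ _) (below_le1 sg a x J w)) _.
  have [->|P0] := eqVneq (Pi sg a (a + J) w) 0.
    by rewrite !powR0 ?mulr0// gt_eqF.
  rewrite [in leLHS](splitr s) powRD ?P0 ?implybT// ler_wpM2r ?powR_ge0//.
  by rewrite ge0_ler_powR ?nnegrE ?(ltW h0) ?Pi_ge0.
have one : 1 <= \sum_(k < J.+1) E P (fun w => passage sg a x k w * Pi sg a (a + k) w `^ s) + 4^-1.
  rewrite -[leLHS](EPs (leq_addr J a)).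
  under eq_bigr => k _ do rewrite (proj2 (passage_martingale a x00 (leq_ord k))).
  rewrite -(E_sum _ Lp); move: half; rewrite -(lerD2l (E P (fun w =>
    \sum_(k < J.+1) passage sg a x k w * Pi sg a (a + J) w `^ s))).
  apply: le_trans; rewrite -(ED Lall LB); apply: (E_le (L1_obs LJ) (L1D Lall LB)) => w.
  by rewrite -mulr_suml -mulrDl sum_passage subrK mul1r.
have L1p k : L1 P (stretch sg a (a + k)) (passage sg a x k) := L1_passage a k x00.
have step (j : 'I_J) :
   E P (fun w => passage sg a x j.+1 w * Pi sg a (a + j.+1) w `^ s) <=
   Lx `^ s * E P (passage sg a x j.+1) +
   (\sum_(i < I) (y_ x i) `^ s * E P (fun w => (y_ x i.+1 < Pi sg a (a + j) w)%R%:R) * b (l + i)%N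
    + b (l + I)%N).
  pose S1 := stretch sg a (a + j.+1).
  have dis : stretch sg a (a + j) `&` [set sg (a + j)%N] = set0.
    apply/seteqP; split => // z [[k /andP[_ kj] ->]] /= /inj kE.
    by rewrite kE ltnn in kj.
  have sub : stretch sg a (a + j) `|` [set sg (a + j)%N] `<=` S1.
    move=> z [|->]; first by apply: stretch_sub => //; rewrite leq_add2l leqnSn.
    by exists (a + j)%N => //; rewrite leq_addr addnS ltnS leqnn.
  have Li (i : 'I_I) : L1 P S1 (fun w => (y_ x i) `^ s * ((y_ x i.+1 < Pi sg a (a + j) w)%R%:R
       * big_odds (l + i) w (sg (a + j)%N))) /\
     E P (fun w => (y_ x i) `^ s * ((y_ x i.+1 < Pi sg a (a + j) w)%R%:R
       * big_odds (l + i) w (sg (a + j)%N))) =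
     (y_ x i) `^ s * E P (fun w => (y_ x i.+1 < Pi sg a (a + j) w)%R%:R) * b (l + i)%N.
    have La := L1_above a j (ltW (y_gt0 i.+1 x0)).
    have Lb := L1_big_odds (l + i) (sg (a + j)%N).
    have LM := L1M iidP dis La Lb.
    split; first exact: L1_sub sub (L1Z (powR_ge0 _ _) LM).
    by rewrite (EZ (powR_ge0 _ _) LM) (EM iidP dis La Lb) E_big_odds mulrA.
  have Lr : L1 P S1 (fun w => Pi sg a (a + j) w `^ s * big_odds (l + I) w (sg (a + j)%N)) /\
     E P (fun w => Pi sg a (a + j) w `^ s * big_odds (l + I) w (sg (a + j)%N)) = b (l + I)%N.
    have La := L1Ps (leq_addr j a).
    have Lb := L1_big_odds (l + I) (sg (a + j)%N).
    split; first exact: L1_sub sub (L1M iidP dis La Lb).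
    by rewrite (EM iidP dis La Lb) E_big_odds EPs ?leq_addr// mul1r.
  have Ls (i : 'I_I) := proj1 (Li i).
  under eq_bigr do rewrite -(proj2 (Li _)).
  rewrite -(proj2 Lr) -(E_sum _ Ls) -(ED (L1_sum _ Ls) (proj1 Lr)).
  have Lpz := L1Z (powR_ge0 Lx s) (L1p j.+1).
  rewrite -(EZ (powR_ge0 Lx s) (L1p j.+1)) -(ED Lpz (L1D (L1_sum _ Ls) (proj1 Lr))).
  apply: (E_le _ (L1D Lpz (L1D (L1_sum _ Ls) (proj1 Lr)))) => [|w].
    exact: L1_obs (L1_passage_pow (L1Ps (leq_addr j.+1 a)) x00).
  rewrite mulrC.
  set rest := (X in _ <= _ + X); have rest_ge0 : 0 <= rest.
    apply: addr_ge0; first apply: sumr_ge0 => i _.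
      by rewrite mulr_ge0 ?powR_ge0// mulr_ge0// mulr_ge0 ?powR_ge0.
    by rewrite mulr_ge0 ?powR_ge0// mulr_ge0 ?powR_ge0.
  case: (leP (Pi sg a (a + j.+1) w) Lx) => PL.
    apply: (@le_trans _ _ (Lx `^ s * passage sg a x j.+1 w)); last by rewrite lerDl.
    rewrite ler_wpM2r ?passage_ge0//.
    by rewrite ge0_ler_powR ?nnegrE ?Pi_ge0 ?(ltW s0) ?(ltW Lx0).
  apply: (@le_trans _ _ (0 + rest)); last first.
    by rewrite lerD2r mulr_ge0 ?powR_ge0// passage_ge0.
  rewrite add0r; have [Pj|Pj] := leP (Pi sg a (a + j) w) x; last first.
    have -> : passage sg a x j.+1 w = 0; last by rewrite mulr0.
    by rewrite /passage /below big_ord_recr/= leNgt Pj/= mulr0 mul0r.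
  apply: le_trans (ler_piMr (powR_ge0 _ _) (passage_le1 sg a x _ w)) _.
  move: PL; rewrite addnS Pi_recr ?leq_addr// => PL.
  apply: le_trans (@dyadic_overshoot x l _ _ I x0 (Pi_ge0 _ _ _ _) (odds_ge0 _ _) Pj PL) _.
  by rewrite lerD2r; apply: ler_sum => i _; rewrite -mulrA.
(* The empty product is 1 <= x, so that no passage occurs at length 0. *)
have zero : E P (fun w => passage sg a x 0 w * Pi sg a (a + 0) w `^ s) = 0.
  rewrite -[RHS](E_cst P 0); congr E; apply/funext => w.
  by rewrite /passage addn0 Pi_nil ltNge x1 mulr0 mul0r.
move: one; rewrite big_ord_recl/= zero add0r => one.
have {}one := le_trans one (lerD (ler_sum _ (fun j _ => step j)) (lexx _)).
move: one; rewrite !big_split/= -mulr_sumr sumr_const card_ord.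
rewrite exchange_big/=.
have dy : \sum_(i < I) \sum_(j < J) y_ x i `^ s *
    E P (fun w => (y_ x i.+1 < Pi sg a (a + j) w)%R%:R) * b (l + i)%N <= 4^-1.
  apply: (@le_trans _ _ (\sum_(i < I) (2 `^ s / (1 - q)) * b (l + i)%N)).
    apply: ler_sum => i _; rewrite -mulr_suml -mulr_sumr ler_wpM2r//.
    apply: le_trans (ler_wpM2l (powR_ge0 _ _) (tail_count a J (y_gt0 i.+1 x0))) _.
    rewrite mulrA ler_wpM2r ?invr_ge0 ?subr_ge0 ?(ltW q1)//.
    rewrite y_S powRM ?(ltW (y_gt0 _ x0))// powRN mulfK//.
    by rewrite gt_eqF// powR_gt0// y_gt0.
  rewrite -mulr_sumr; apply: le_trans (ler_wpM2l _ (tail I)) _.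
    by rewrite divr_ge0 ?powR_ge0// subr_ge0 ltW.
  have q1' : 1 - q != 0 by rewrite subr_eq0 gt_eqF.
  have s2 : 2 `^ s != 0 :> R by rewrite gt_eqF// powR_gt0.
  rewrite le_eqVlt; apply/orP; left; apply/eqP; field.
  by rewrite q1' s2.
move: bI; rewrite mulr_natl => bI one.
have {}one := quarter_le one dy bI.
rewrite big_ord_recl/= powRN ler_pdivrMl ?powR_gt0//; apply: (le_trans one).
rewrite ler_wpM2l ?powR_ge0// lerDr.
by apply: E_ge0 => w; exact: passage_ge0.
Qed.

Lemma below0P a y k w : 0 <= y -> below sg a y k w = 1 /\
    (forall j, (j < k)%N -> Pi sg a (a + j) w <= y) \/
  below sg a y k w = 0 /\ exists2 j, (j < k)%N & y < Pi sg a (a + j) w.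
Proof.
move=> y0; elim: k => [|k [[b1 IH]|[b0 [j jk IH]]]].
- by left; rewrite /below big_ord0.
- rewrite /below big_ord_recr/= -/(below sg a y k w) b1 mul1r.
  case: (leP (Pi sg a (a + k) w) y) => hk; last by right; split => //; exists k.
  by left; split=> // j; rewrite ltnS leq_eqVlt => /predU1P[->//|]; exact: IH.
- right; rewrite /below big_ord_recr/= -/(below sg a y k w) b0 mul0r.
  by split=> //; exists j => //; rewrite ltnS ltnW.
Qed.

Lemma passage_neq0 a y k w : 0 <= y -> passage sg a y k w != 0 ->
  y < Pi sg a (a + k) w /\ forall j, (j < k)%N -> Pi sg a (a + j) w <= y.
Proof.
move=> y0; rewrite /passage; case: ltP => yk; last by rewrite mulr0 eqxx.
by rewrite mulr1; have [[_ h] //|[-> _]] := below0P a k w y0; rewrite eqxx.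
Qed.

(** The indicator that some product started at a exceeds x within J steps. *)
Definition hit a x J w := \sum_(k < J.+1) passage sg a x k w.

Lemma hit_ge0 a x J w : 0 <= hit a x J w.
Proof. by apply: sumr_ge0 => k _; exact: passage_ge0. Qed.

Lemma hit_le1 a x J w : hit a x J w <= 1.
Proof. exact: sum_passage_le1. Qed.

Lemma hitP a x J w : 0 <= x ->
  hit a x J w = 0 /\ (forall k, (k <= J)%N -> Pi sg a (a + k) w <= x) \/
  hit a x J w = 1 /\ exists2 k, (k <= J)%N & x < Pi sg a (a + k) w.
Proof.
move=> x0; rewrite /hit sum_passage.
by have [[-> h]|[-> h]] := below0P a J.+1 w x0; [left|right]; rewrite ?subrr ?subr0.
Qed.

Lemma L1_passage_sub a x k J : 0 <= x -> (k <= J)%N ->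
  L1 P (stretch sg a (a + J)) (passage sg a x k).
Proof.
move=> x0 kJ; apply: L1_sub (L1_passage a k x0).
by apply: stretch_sub => //; rewrite leq_add2l.
Qed.

Let L1_hit_summand a x J (x0 : 0 <= x) (k : 'I_J.+1)
  := L1_passage_sub a x0 (leq_ord k).

Lemma L1_hit a x J : 0 <= x -> L1 P (stretch sg a (a + J)) (hit a x J).
Proof. by move=> x0; exact: (L1_sum _ (L1_hit_summand a x0)). Qed.

Lemma E_hit a x J : 0 <= x -> E P (hit a x J) = \sum_(k < J.+1) E P (passage sg a x k).
Proof. by move=> x0; exact: (E_sum _ (L1_hit_summand a x0)). Qed.

Lemma E_hit_le a x J : 0 < x -> E P (hit a x J) <= x `^ (- s).
Proof.
move=> x0; have x00 := ltW x0; rewrite (E_hit _ _ x00).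
rewrite -[leRHS]mulr1; apply: le_trans (ler_wpM2l (powR_ge0 _ _) (passage_weight a J.+1 x00)).
rewrite mulr_sumr; apply: ler_sum => k _.
have L := L1_passage_pow (L1Ps (leq_addr k a)) x00.
rewrite -(EZ (powR_ge0 _ _) L).
apply: (E_le (L1_obs (L1_passage a k x00)) (L1Z (powR_ge0 _ _) L)) => w.
have [->|/(passage_neq0 x00)[xk _]] := eqVneq (passage sg a x k w) 0.
  by rewrite mul0r mulr0.
rewrite mulrCA ler_peMr ?passage_ge0// powRN ler_pdivlMl ?powR_gt0// mulr1.
by rewrite ge0_ler_powR ?nnegrE ?Pi_ge0 ?(ltW s0)// ltW.
Qed.

Let pair_term a m x j l w := x `^ (- (s / 2)) * (Pi sg a (a + m) w `^ (s / 2) *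
  (passage sg (a + m) x j w * Pi sg (a + m) (a + m + j) w `^ (s / 2) *
   Pi sg (a + m + j) (a + m + j + l) w `^ (s / 2))).

Let pair_termE a m x j l : 0 <= x ->
  L1 P setT (pair_term a m x j l) /\
  E P (pair_term a m x j l) = x `^ (- (s / 2)) * (q ^+ m *
    (E P (fun w => passage sg (a + m) x j w * Pi sg (a + m) (a + m + j) w `^ (s / 2)) * q ^+ l)).
Proof.
move=> x0.
have La := L1Ph (leq_addr m a).
have Lj := L1_passage_pow (L1Ph (leq_addr j (a + m))) x0.
have Ll := L1Ph (leq_addr l (a + m + j)).
have d1 := @stretch_disj sg (a + m) (a + m + j) (a + m + j) (a + m + j + l) inj (leqnn _).
have LM := L1M iidP d1 Lj Ll.
have {}LM : L1 P (stretch sg (a + m) (a + m + j + l)) (fun w =>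
   passage sg (a + m) x j w * Pi sg (a + m) (a + m + j) w `^ (s / 2) *
   Pi sg (a + m + j) (a + m + j + l) w `^ (s / 2)).
  apply: (L1_sub _ LM) => i [|]; apply: stretch_sub => //; exact: leq_addr.
have d2 := @stretch_disj sg a (a + m) (a + m) (a + m + j + l) inj (leqnn _).
split; first exact: L1_sub (@subsetT _ _) (L1Z (powR_ge0 _ _) (L1M iidP d2 La LM)).
rewrite (EZ (powR_ge0 _ _) (L1M iidP d2 La LM)) (EM iidP d2 La LM) (EM iidP d1 Lj Ll).
by rewrite !EPh ?leq_addr// !addKn.
Qed.

Let pair_term_ge a m x j l w : 0 < x ->
  x <= Pi sg a (a + m) w * Pi sg (a + m) (a + m + j) w *
       Pi sg (a + m + j) (a + m + j + l) w ->
  passage sg (a + m) x j w <= pair_term a m x j l w.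
Proof.
move=> x0 xP.
have -> : pair_term a m x j l w = passage sg (a + m) x j w * (x `^ (- (s / 2)) *
   (Pi sg a (a + m) w * Pi sg (a + m) (a + m + j) w *
       Pi sg (a + m + j) (a + m + j + l) w) `^ (s / 2)).
  by rewrite /pair_term !powRM ?mulr_ge0 ?Pi_ge0//; ring.
rewrite ler_peMr ?passage_ge0// powRN ler_pdivlMl ?powR_gt0// mulr1.
by rewrite ge0_ler_powR ?nnegrE ?mulr_ge0 ?Pi_ge0 ?(ltW h0)// ltW.
Qed.

(* Either the stretch started at a already exceeds x within the first m steps,
   which is independent of what happens from a + m on, or its exceedance
   contains the m first steps and a passage of the stretch started at a + m,
   up to a final piece of length l. *)
Let pair_pointwise a m x J w : 0 < x ->
  hit a x J w * hit (a + m) x J w <= hit a x m w * hit (a + m) x J w +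
    \sum_(j < J.+1) \sum_(l < J.+1) pair_term a m x j l w.
Proof.
move=> x0; have x00 := ltW x0.
have term_ge0 j l : 0 <= pair_term a m x j l w.
  apply: mulr_ge0; first exact: powR_ge0.
  apply: mulr_ge0; first exact: powR_ge0.
  apply: mulr_ge0; last exact: powR_ge0.
  by apply: mulr_ge0; [exact: passage_ge0|exact: powR_ge0].
have sum_ge0 : 0 <= \sum_(j < J.+1) \sum_(l < J.+1) pair_term a m x j l w.
  by apply: sumr_ge0 => j _; apply: sumr_ge0.
have [[-> small]|[-> _]] := hitP a m w x00; last first.
  by apply: ler_wpDr => //; rewrite ler_wpM2r ?hit_ge0 ?hit_le1.
rewrite mul0r add0r.
have [[-> _]|[-> [k kJ xk]]] := hitP a J w x00; first by rewrite mul0r.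
rewrite mul1r; apply: ler_sum => j _.
have [->|/(passage_neq0 x00)[xj before]] := eqVneq (passage sg (a + m) x j w) 0.
  exact: sumr_ge0.
have mk : (m < k)%N by rewrite ltnNge; apply/negP => /small; rewrite leNgt xk.
have kE : (m + (k - m))%N = k by rewrite subnKC// ltnW.
have PE : Pi sg a (a + k) w = Pi sg a (a + m) w * Pi sg (a + m) (a + m + (k - m)) w.
  by rewrite -addnA kE -PiM// leq_addr leq_add2l ltnW.
have lJ : ((k - m - j) < J.+1)%N by rewrite ltnS (leq_trans _ kJ)// -subnDA leq_subr.
rewrite (bigD1 (Ordinal lJ))//= ler_wpDr ?sumr_ge0//.
apply: pair_term_ge => //; apply/ltW; apply: (lt_le_trans xk); rewrite PE.
have [jk|kj] := leqP j (k - m).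
  have -> : (a + m + (k - m) = a + m + j + (k - m - j))%N by rewrite -[RHS]addnA subnKC.
  by rewrite -[leRHS]mulrA -(@PiM _ sg (a + m) (a + m + j)) ?leq_addr.
have -> : (k - m - j = 0)%N by apply/eqP; rewrite subn_eq0 ltnW.
rewrite addn0 Pi_nil mulr1 ler_wpM2l ?Pi_ge0//.
by apply: le_trans (before _ kj) _; exact: ltW.
Qed.

(** The first term is the independent case; in the second one, the two
    exceedances share a trap, at the price q^m for the m steps in between. *)
Lemma E_hit_pair a m x J : 0 < x ->
  L1 P setT (fun w => hit a x J w * hit (a + m) x J w) /\
  E P (fun w => hit a x J w * hit (a + m) x J w) <=
    x `^ (- s) * x `^ (- s) + q ^+ m / (1 - q) * x `^ (- s).
Proof.
move=> x0; have x00 := ltW x0.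
have L2 : L1 P setT (fun w => hit a x J w * hit (a + m) x J w).
  apply: (@L1_le _ P setT setT _ (fun=> 1)); last 2 first.
    exact: L1_cst.
    by move=> w; rewrite mulr_ile1 ?hit_ge0 ?hit_le1.
  by apply: obsM; apply: obsT; apply: L1_obs; exact: L1_hit.
split=> //.
have d := @stretch_disj sg a (a + m) (a + m) (a + m + J) inj (leqnn _).
have LM := L1_sub (@subsetT _ _) (L1M iidP d (L1_hit a m x00) (L1_hit (a + m) J x00)).
have Lin (j : 'I_J.+1) (l : 'I_J.+1) :=
  proj1 (pair_termE a m j l x00).
have Lout (j : 'I_J.+1) := L1_sum (index_enum _) (Lin j).
apply: le_trans (E_le (L1_obs L2) (L1D LM (L1_sum _ Lout)) _) _.
  by move=> w; exact: pair_pointwise.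
rewrite (ED LM (L1_sum _ Lout)) (E_sum _ Lout) lerD//.
  rewrite (EM iidP d (L1_hit a m x00) (L1_hit (a + m) J x00)).
  by apply: ler_pM; rewrite ?E_hit_le// E_ge0// => w; exact: hit_ge0.
pose c j := E P (fun w => passage sg (a + m) x j w * Pi sg (a + m) (a + m + j) w `^ (s / 2)).
have -> : \sum_(j < J.+1) E P (fun w => \sum_(l < J.+1) pair_term a m x j l w) =
    x `^ (- (s / 2)) * (q ^+ m * ((\sum_(j < J.+1) c j) * \sum_(l < J.+1) q ^+ l)).
  rewrite mulr_suml !mulr_sumr; apply: eq_bigr => j _; rewrite (E_sum _ (Lin j)).
  rewrite !mulr_sumr; apply: eq_bigr => l _.
  by rewrite (proj2 (pair_termE _ _ _ _ x00)).
have -> : x `^ (- s) = x `^ (- (s / 2)) * x `^ (- (s / 2)).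
  by rewrite -powRD ?(gt_eqF x0) ?implybT// -opprD -splitr.
have /andP[q0 _] := q01.
have cg : (\sum_(j < J.+1) c j) * (\sum_(l < J.+1) q ^+ l) <= x `^ (- (s / 2)) * (1 - q)^-1.
  apply: ler_pM.
  - apply: sumr_ge0 => j _; apply: E_ge0 => w.
    by apply: mulr_ge0; [exact: passage_ge0|exact: powR_ge0].
  - by apply: sumr_ge0 => j _; rewrite exprn_ge0.
  - exact: half_passage_weight.
  - exact: sum_geometric_le.
have -> : q ^+ m / (1 - q) * (x `^ (- (s / 2)) * x `^ (- (s / 2))) =
    x `^ (- (s / 2)) * (q ^+ m * (x `^ (- (s / 2)) * (1 - q)^-1)) by ring.
by rewrite ler_wpM2l ?powR_ge0// ler_wpM2l ?exprn_ge0.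
Qed.

End tails.

(** * The probability of a trap *)

Section second_moment.
Context {R : realType}.

Lemma sqr_sum_le_pairs (h : nat -> R) N : (forall i, 0 <= h i) ->
  (\sum_(i < N) h i) ^+ 2 <= 2 * \sum_(i < N) \sum_(m < N - i) h i * h (i + m)%N.
Proof.
move=> h0; elim: N => [|N IH]; first by rewrite !big_ord0 expr2 mul0r mulr0.
have -> : \sum_(i < N.+1) \sum_(m < N.+1 - i) h i * h (i + m)%N =
    \sum_(i < N) \sum_(m < N - i) h i * h (i + m)%N +
    (\sum_(i < N) h i) * h N + h N * h N.
  rewrite big_ord_recr/= subSn// subnn big_ord1 addn0; congr (_ + _).
  rewrite mulr_suml -big_split/=; apply: eq_bigr => i _.
  by rewrite subSn ?(ltnW (ltn_ord i))// big_ord_recr/= subnKC// ltnW.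
rewrite big_ord_recr/= sqrrD.
have := h0 N; move: IH; set S := \sum_(i < N) h i; set T := \sum_(i < N) _.
move=> IH hN; have : 0 <= h N * h N by rewrite mulr_ge0.
rewrite (expr2 (h N)) -mulr_natl; move: IH; set u := h N * h N; lra.
Qed.

(** The second-moment method in a form linear in the indicator, so that it can be
    integrated for every t; the best t is chosen in [quadratic_optimum]. *)
Lemma paley_zygmund_pointwise (Z t : R) : 0 <= Z ->
  2 * t * Z <= (0 < Z)%R%:R + t ^+ 2 * Z ^+ 2.
Proof.
move=> Z0; case: ltP => hZ.
  have := sqr_ge0 (t * Z - 1); have -> : (true%:R : R) = 1 by [].
  by rewrite !expr2; lra.
have -> : Z = 0 by apply/le_anti/andP.
by rewrite expr0n !mulr0 addr0.
Qed.

Lemma quadratic_optimum (c u b p : R) : 0 < c -> 0 < u -> 0 <= b ->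
  (forall t, 0 <= t -> 2 * t * (c * u) <= p + t ^+ 2 * (2 * (u ^+ 2 + b * u))) ->
  c ^+ 2 * u / (2 * (u + b)) <= p.
Proof.
move=> c0 u0 b0 h.
have ub : 0 < u + b by rewrite ltr_wpDr.
have t0 : 0 <= c / (2 * (u + b)) by rewrite divr_ge0 ?mulr_ge0 ?ltW.
have := h _ t0.
have -> : 2 * (c / (2 * (u + b))) * (c * u) = 2 * (c ^+ 2 * u / (2 * (u + b))).
  by field; rewrite gt_eqF.
have -> : (c / (2 * (u + b))) ^+ 2 * (2 * (u ^+ 2 + b * u)) =
   c ^+ 2 * u / (2 * (u + b)).
  by field; rewrite gt_eqF.
lra.
Qed.

End second_moment.

Section trap.
Context {R : realType} (P : probability (env R) R).
Hypothesis iidP : iid_product P.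
Variables (s q : R).
Hypotheses (s0 : 0 < s).
Hypothesis L1s : L1 P [set 0] (fun w => odds w 0 `^ s).
Hypothesis E1s : E P (fun w => odds w 0 `^ s) = 1.
Hypothesis L1h : L1 P [set 0] (fun w => odds w 0 `^ (s / 2)).
Hypothesis Eqh : E P (fun w => odds w 0 `^ (s / 2)) = q.
Hypothesis q1 : q < 1.
Implicit Types (w : env R) (x y : R).

Let q0 : 0 <= q.
Proof. by rewrite -Eqh; apply: E_ge0 => w; exact: powR_ge0. Qed.

Variables (sg : nat -> int).
Hypothesis inj : injective sg.

Definition trap x J N w : R := (0 < \sum_(i < N) hit sg i x J w)%R%:R.

Lemma trapP x J N w : 0 <= x -> trap x J N w != 0 ->
  exists i k, [/\ (i < N)%N, (k <= J)%N & x < Pi sg i (i + k) w].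
Proof.
move=> x0; rewrite /trap; case: ltP => [|_]; last by rewrite eqxx.
move=> Z0 _; apply: contrapT => no; move: Z0; rewrite big1 ?ltxx// => i _.
have [[]//|[_ [k kJ xk]]] := hitP sg i J w x0.
by exfalso; apply: no; exists i, k.
Qed.

Lemma trap_le1 x J N w : trap x J N w <= 1.
Proof. by rewrite lern1 leq_b1. Qed.

Let L1_hit_N x J N (x0 : 0 <= x) (i : 'I_N) :
  L1 P (stretch sg 0 (N + J)) (hit sg i x J).
Proof.
apply: L1_sub (L1_hit P sg i J x0); apply: stretch_sub => //.
by rewrite leq_add2r ltnW.
Qed.

Lemma obs_trap x J N : 0 <= x -> obs (stretch sg 0 (N + J)) (trap x J N).
Proof.
move=> x0; apply: obs_lt; first exact: obs_cst.
exact: L1_obs (L1_sum _ (L1_hit_N J x0)).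
Qed.

(** The second-moment method for the number of starting points: pairs at
    distance m contribute x^(-2s) + q^m x^(-s), whose sum over the pairs is of
    the order of the square of the mean plus the mean. *)
Lemma trap_probability_ge x J N c : 0 < x -> 0 < c -> (0 < N)%N ->
  (forall i, (i < N)%N -> c * x `^ (- s) <= E P (hit sg i x J)) ->
  c ^+ 2 * (N%:R * x `^ (- s)) / (2 * (N%:R * x `^ (- s) + (1 - q)^-1 ^+ 2))
    <= E P (trap x J N).
Proof.
move=> x0 c0 N0 hit_ge; have x00 := ltW x0.
have x0s : 0 < x `^ (- s) by rewrite powR_gt0.
apply: quadratic_optimum => //.
- by rewrite mulr_gt0 ?ltr0n.
- by rewrite exprn_ge0// invr_ge0 subr_ge0 ltW.
move=> t t0.
pose Z w := \sum_(i < N) hit sg i x J w.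
have LZ : L1 P setT Z.
  exact: L1_sub (@subsetT _ _) (L1_sum _ (L1_hit_N J x00)).
pose pairs w := \sum_(i < N) \sum_(m < N - i) hit sg i x J w * hit sg (i + m) x J w.
have Lp (i : 'I_N) (m : 'I_(N - i)) :=
  proj1 (E_hit_pair iidP s0 L1s E1s L1h Eqh q1 inj i m J x0).
have Lpp (i : 'I_N) := L1_sum (index_enum _) (Lp i).
have Lpairs : L1 P setT pairs := L1_sum (index_enum _) Lpp.
have Epairs : E P pairs <= (N%:R * x `^ (- s)) ^+ 2 + (1 - q)^-1 ^+ 2 * (N%:R * x `^ (- s)).
  rewrite /pairs (E_sum _ Lpp).
  apply: (@le_trans _ _ (\sum_(i < N) (N%:R * (x `^ (- s) * x `^ (- s)) + (1 - q)^-1 ^+ 2 * x `^ (- s)))).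
    apply: ler_sum => i _; rewrite (E_sum _ (Lp i)).
    apply: (@le_trans _ _ (\sum_(m < N - i) (x `^ (- s) * x `^ (- s) + q ^+ m / (1 - q) * x `^ (- s)))).
      by apply: ler_sum => m _; have [_] := E_hit_pair iidP s0 L1s E1s L1h Eqh q1 inj i m J x0.
    rewrite big_split/= sumr_const card_ord lerD//.
      by rewrite -[leLHS]mulr_natl ler_wpM2r ?mulr_ge0 ?powR_ge0// ler_nat leq_subr.
    rewrite -mulr_suml ler_wpM2r ?powR_ge0// -mulr_suml expr2.
    rewrite ler_wpM2r ?invr_ge0 ?subr_ge0 ?(ltW q1)//.
    by rewrite sum_geometric_le// q0.
  rewrite sumr_const card_ord -mulr_natl.
  by rewrite le_eqVlt; apply/orP; left; apply/eqP; ring.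
have LT : L1 P setT (trap x J N).
  apply: (@L1_bounded _ P _ _ 1); last exact: trap_le1.
  exact: obsT (obs_trap J N x00).
have t20 : 0 <= 2 * t by rewrite mulr_ge0.
have t2 : 0 <= 2 * t ^+ 2 by rewrite mulr_ge0// exprn_ge0.
apply: (@le_trans _ _ (E P (trap x J N) + 2 * t ^+ 2 * E P pairs)); last first.
  by rewrite lerD2l [leRHS](_ : _ = 2 * t ^+ 2 * ((N%:R * x `^ (- s)) ^+ 2 +
    (1 - q)^-1 ^+ 2 * (N%:R * x `^ (- s)))) ?ler_wpM2l//; ring.
rewrite -(EZ t2 Lpairs) -(ED LT (L1Z t2 Lpairs)).
apply: (@le_trans _ _ (2 * t * E P Z)).
  rewrite ler_wpM2l// /Z (E_sum _ (L1_hit_N J x00)) mulrCA mulr_natl.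
  rewrite -[X in _ *+ X]card_ord -sumr_const; apply: ler_sum => i _.
  exact: hit_ge.
rewrite -(EZ t20 LZ); apply: (E_le (L1_obs (L1Z t20 LZ)) (L1D LT (L1Z t2 Lpairs))) => w.
have Zw0 : 0 <= Z w by apply: sumr_ge0 => i _; exact: hit_ge0.
apply: (le_trans (paley_zygmund_pointwise t Zw0)).
rewrite lerD2l [leRHS]mulrAC mulrC ler_wpM2r ?exprn_ge0//.
exact: (@sqr_sum_le_pairs _ (fun i => hit sg i x J w) N (fun i => hit_ge0 sg i x J w)).
Qed.

End trap.

(** * Crossing times in a random environment *)

Section events.
Context {R : realType} (P : probability (env R) R).
Implicit Types (w : env R) (I J : set int) (f g : env R -> R) (x y : R).

Lemma obs_complement I f : obs I f -> (forall w, f w <= 1) -> obs I (fun w => 1 - f w).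
Proof.
move=> [df f0] f1; split; last by move=> w; rewrite subr_ge0.
by apply: measurable_funB => //; exact: measurable_cst.
Qed.

Lemma E_complement I f : obs I f -> (forall w, f w <= 1) ->
  E P (fun w => 1 - f w) = 1 - E P f.
Proof.
move=> of_ f1.
have Lf := L1_bounded P of_ f1.
have Lc : L1 P I (fun w => 1 - f w).
  apply: (@L1_bounded _ P I _ 1); first exact: obs_complement.
  by move=> w; rewrite gerBl; exact: obs_ge0 of_ w.
apply: (addIr (E P f)); rewrite -(ED Lc Lf) subrK -[RHS](E_cst P).
by congr E; apply/funext => w; rewrite subrK.
Qed.

Lemma event_probability I (b : env R -> bool) : obs I (fun w => (b w)%:R) ->
  measurable [set w | b w] /\
  P [set w | b w] = (E P (fun w => (b w)%:R))%:E.
Proof.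
move=> ob; have mb : measurable [set w | b w].
  have := obs_measurable ob measurableT (measurable_itv `]0, +oo[).
  rewrite setTI; congr measurable; apply/seteqP; split => w /=;
    by rewrite in_itv/= andbT ltr0n lt0b.
split => //.
have L : L1 P I (fun w => (b w)%:R).
  by apply: (@L1_bounded _ P I _ 1 ob) => w; rewrite lern1 leq_b1.
rewrite -(L1E L) /mean -[X in P X]setIT -integral_indic//.
apply: eq_integral => w _; rewrite indicE.
by have -> : (w \in [set w | b w]) = b w by apply/idP/idP; rewrite inE.
Qed.

Lemma markov_power I f (p c : R) : obs I f -> 0 < p -> 0 < c ->
  L1 P I (fun w => f w `^ p) ->
  E P (fun w => (c < f w)%R%:R) <= c `^ (- p) * E P (fun w => f w `^ p).
Proof.
move=> of_ p0 c0 Lp.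
rewrite -(EZ (powR_ge0 c (- p)) Lp).
apply: (E_le (obs_lt (obs_cst I (ltW c0)) of_) (L1Z (powR_ge0 c (- p)) Lp)) => w.
case: ltP => cf; last by rewrite mulr_ge0 ?powR_ge0.
rewrite powRN ler_pdivlMl ?powR_gt0// mulr1.
by rewrite ge0_ler_powR ?nnegrE ?(obs_ge0 of_) ?(ltW p0)// ltW.
Qed.

End events.

Section crossing_time.
Context {R : realType}.
Implicit Types (w : env R) (z : int).

(** 1 + 2 W w z k is the mean time to go from z + k to z + k + 1 for the walk
    that is reflected at z. *)
Fixpoint W w z (k : nat) : R :=
  if k is k'.+1 then odds w (z + k'.+1%:Z) * (1 + W w z k') else 0.

Lemma W_ge0 w z k : 0 <= W w z k.
Proof. by elim: k => //= k IH; rewrite mulr_ge0 ?odds_ge0 ?addr_ge0. Qed.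

Definition leftward z (k : nat) : nat -> int := fun j => z + k%:Z - j%:Z.

Lemma leftward_inj z k : injective (leftward z k).
Proof. by move=> i j; rewrite /leftward => /addrI/oppr_inj[]. Qed.

Lemma W_sum w z k : W w z k = \sum_(j < k) Pi (leftward z k) 0 j.+1 w.
Proof.
elim: k => [|k IH]; first by rewrite big_ord0.
rewrite big_ord_recl/= IH mulrDr mulr1 mulr_sumr.
have first : leftward z k.+1 0 = z + k.+1%:Z by rewrite /leftward subr0.
congr (_ + _); first by rewrite /Pi big_nat1 first.
apply: eq_bigr => j _; rewrite /Pi [RHS]big_nat_recl//= first; congr (_ * _).
apply: eq_bigr => i _; congr odds; rewrite /leftward; lia.
Qed.

(** The mean time to go from z + k to z + k + m for the walk reflected at z. *)
Definition crossing_mean w z (k m : nat) : R := \sum_(l < m) (1 + 2 * W w z (k + l)).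

Definition sites (a b : int) : set int := [set i | a < i <= b].

Lemma obs_W z k : obs (sites z (z + k%:Z)) (fun w => W w z k).
Proof.
elim: k => [|k IH] /=; first exact: obs_cst.
apply: obsM; first by apply: obs_odds; rewrite /sites/=; lia.
apply: obsD; first exact: obs_cst.
by apply: (obs_sub _ IH) => i; rewrite /sites/=; lia.
Qed.

Lemma obs_crossing_mean z k m :
  obs (sites z (z + (k + m)%:Z)) (fun w => crossing_mean w z k m).
Proof.
apply: obs_sum => l; apply: obsD; first exact: obs_cst.
apply: obsZ => //; apply: (obs_sub _ (obs_W z (k + l))) => i.
by rewrite /sites/=; have := ltn_ord l; lia.
Qed.

Lemma crossing_mean_ge0 w z k m : 0 <= crossing_mean w z k m.
Proof. by apply: sumr_ge0 => l _; rewrite addr_ge0// mulr_ge0// W_ge0. Qed.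

Lemma min_sum_le (T : Type) (r : seq T) (F : T -> R) (x : R) : 0 <= x ->
  (forall i, 0 <= F i) ->
  Num.min (\sum_(i <- r) F i) x <= \sum_(i <- r) Num.min (F i) x.
Proof.
move=> x0 F0; elim: r => [|i r IH]; first by rewrite !big_nil ge_min lexx.
rewrite !big_cons.
have S0 : 0 <= \sum_(j <- r) Num.min (F j) x.
  by apply: sumr_ge0 => j _; rewrite le_min F0 x0.
case: (leP (F i) x) => Fx; last first.
  by rewrite ge_min; apply/orP; right; rewrite lerDl.
have [Sx|Sx] := leP (\sum_(j <- r) F j) x.
  by rewrite ge_min lerD2l; move: IH; rewrite (min_idPl Sx) => ->.
move: IH; rewrite (min_idPr (ltW Sx)) => IH.
by rewrite ge_min; apply/orP; right; apply: (le_trans IH); rewrite lerDr.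
Qed.

Variable (P : probability (env R) R).
Hypothesis iidP : iid_product P.
Variables (s q : R).
Hypotheses (s0 : 0 < s) (s1 : s < 1).
Hypothesis L1s : L1 P [set 0] (fun w => odds w 0 `^ s).
Hypothesis E1s : E P (fun w => odds w 0 `^ s) = 1.
Hypothesis L1h : L1 P [set 0] (fun w => odds w 0 `^ (s / 2)).
Hypothesis Eqh : E P (fun w => odds w 0 `^ (s / 2)) = q.
Hypothesis q1 : q < 1.

Lemma E_min_W_le z k x : 0 < x ->
  E P (fun w => Num.min (W w z k) x) <= min_const s q * x `^ (1 - s).
Proof.
move=> x0; have x00 := ltW x0.
have inj := @leftward_inj z k.
apply: le_trans (@sum_min_le _ P iidP s q s0 L1s E1s L1h Eqh q1 _ inj 0 x k.+1 s1 x0).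
have Lm (j : 'I_k) :
    L1 P setT (fun w => Num.min (Pi (leftward z k) 0 (0 + j.+1) w) x).
  apply: (@L1_bounded _ P _ _ x); last by move=> w; rewrite ge_min lexx orbT.
  by apply: obs_min; [exact: obsT (obs_Pi _ _ _)|exact: obs_cst].
rewrite big_ord_recl/= ler_wpDl//; first by
  apply: E_ge0 => w; rewrite le_min x00 Pi_ge0.
rewrite -(E_sum _ Lm).
apply: (E_le _ (L1_sum _ Lm)) => [|w].
  apply: (@obs_min _ setT); [exact: obsT (obs_W _ _)|exact: obs_cst].
rewrite W_sum; apply: min_sum_le => // j; exact: Pi_ge0.
Qed.

(** Truncating at x makes the first moment finite and of the order given by
    the tail index s, so that Markov's inequality is sharp up to a constant. *)
Lemma crossing_mean_tail z k m x : 0 < x -> m%:R <= x / 2 ->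
  E P (fun w => (x < crossing_mean w z k m)%R%:R) <=
  m%:R * (min_const s q * (x / 4) `^ (- s)).
Proof.
move=> x0 mx; pose y := x / 4; have y0 : 0 < y by rewrite divr_gt0.
have Lm (l : 'I_m) :
    L1 P setT (fun w => Num.min (W w z (k + l)) y).
  apply: (@L1_bounded _ P _ _ y); last by move=> w; rewrite ge_min lexx orbT.
  by apply: obs_min; [exact: obsT (obs_W _ _)|exact: obs_cst (ltW y0)].
have iy0 : 0 <= y^-1 by rewrite invr_ge0 ltW.
apply: (@le_trans _ _ (E P (fun w => y^-1 * \sum_(l < m) Num.min (W w z (k + l)) y))).
  have o := obs_lt (obs_cst _ (ltW x0)) (obs_crossing_mean z k m).
  apply: (E_le o (L1Z iy0 (L1_sum _ Lm))) => w.
  have S0 : 0 <= \sum_(l < m) Num.min (W w z (k + l)) y.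
    by apply: sumr_ge0 => l _; rewrite le_min W_ge0 ltW.
  case: ltP => hx; last by rewrite mulr_ge0.
  rewrite ler_pdivlMl// mulr1.
  apply: (@le_trans _ _ (Num.min (\sum_(l < m) W w z (k + l)) y)); last first.
    by apply: min_sum_le (ltW y0) _ => l; exact: W_ge0.
  rewrite le_min lexx andbT.
  move: hx; rewrite /crossing_mean big_split/= sumr_const card_ord -mulr_sumr.
  rewrite /y; move: mx; set S := \sum_(l < m) _; set c : R := m%:R; lra.
rewrite (EZ iy0 (L1_sum _ Lm)) (E_sum _ Lm).
have -> : m%:R * (min_const s q * (x / 4) `^ (- s)) =
   y^-1 * (m%:R * (min_const s q * y `^ (1 - s))).
  rewrite powRD ?(gt_eqF y0) ?implybT// powRr1 ?(ltW y0)// -/y.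
  by field; rewrite gt_eqF.
rewrite ler_wpM2l// mulr_natl -[X in _ *+ X]card_ord -sumr_const.
by apply: ler_sum => l _; exact: E_min_W_le.
Qed.

End crossing_time.

(** * Exponential decay of the products *)

Section steep.
Context {R : realType} (P : probability (env R) R).
Hypothesis iidP : iid_product P.
Variables (s q : R).
Hypotheses (s0 : 0 < s).
Hypothesis L1h : L1 P [set 0] (fun w => odds w 0 `^ (s / 2)).
Hypothesis Eqh : E P (fun w => odds w 0 `^ (s / 2)) = q.
Hypothesis q1 : q < 1.
Implicit Types (w : env R) (z : int).

Let q0 : 0 <= q.
Proof. by rewrite -Eqh; apply: E_ge0 => w; exact: powR_ge0. Qed.

Let h0 : 0 < s / 2. Proof. exact: divr_gt0. Qed.

Definition rightward z : nat -> int := fun j => z + j.+1%:Z.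

Lemma rightward_inj z : injective (rightward z).
Proof. by move=> i j; rewrite /rightward => /addrI[]. Qed.

(** For the exponential Markov inequality to give a summable bound, any rate
    strictly between q^(2/s) and 1 would do. *)
Definition rate : R := ((1 + q) / 2) `^ (2 / s).

Lemma rate01 : 0 < rate < 1.
Proof.
have m0 : 0 < (1 + q) / 2 by rewrite divr_gt0// ltr_wpDr.
rewrite powR_gt0//=; apply: (@lt_le_trans _ _ (1 `^ (2 / s))); last by rewrite powR1.
apply: gt0_ltr_powR; rewrite ?divr_gt0// ?nnegrE ?(ltW m0)//.
by rewrite ltr_pdivrMr// mul1r -[ltRHS]/(1 + 1) ltrD2l.
Qed.

(** Outside this event the products decay exponentially from length k on, so that
    the walk hardly ever goes back from z + k to z. *)
Definition steep z (k : nat) : set (env R) :=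
  [set w | exists2 l, (k <= l)%N & rate ^+ l < Pi (rightward z) 0 l w].

Let steep_at z l := [set w : env R | rate ^+ l < Pi (rightward z) 0 l w].

Let q' := q / ((1 + q) / 2).

Let q'01 : 0 <= q' < 1.
Proof.
have m0 : 0 < (1 + q) / 2 by rewrite divr_gt0// ltr_wpDr.
rewrite /q' divr_ge0 ?(ltW m0)//= ltr_pdivrMr// mul1r ltr_pdivlMr//.
by rewrite mulrDr mulr1 ltrD2r.
Qed.

Let steep_atP z l : measurable (steep_at z l) /\ (P (steep_at z l) <= (q' ^+ l)%:E)%E.
Proof.
have /andP[r0 _] := rate01; have rl : 0 < rate ^+ l by rewrite exprn_gt0.
have o : obs setT (fun w => (rate ^+ l < Pi (rightward z) 0 l w)%R%:R).
  by apply: obs_lt; [exact: obs_cst (ltW rl)|exact: obsT (obs_Pi _ _ _)].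
have [mS PS] := event_probability P o; split; first exact: mS.
rewrite PS lee_fin.
have LP := L1_Pi_pow iidP L1h Eqh (@rightward_inj z) (leq0n l).
apply: le_trans (markov_power (obsT (obs_Pi _ _ _)) h0 rl (L1_sub (@subsetT _ _) LP)) _.
rewrite (E_Pi_pow iidP L1h Eqh (@rightward_inj z) (leq0n l)) subn0.
rewrite powRN powR_exprn ?(ltW r0)// /rate -powRrM.
have -> : 2 / s * (s / 2) = 1 by field; rewrite gt_eqF.
rewrite powRr1 ?divr_ge0 ?addr_ge0// -exprVn -exprMn mulrC.
exact: lexx.
Qed.

Lemma steepE z k : steep z k = \bigcup_l steep_at z (k + l).
Proof.
apply/seteqP; split => w /=.
  by move=> [l kl h]; exists (l - k)%N => //=; rewrite /steep_at/= subnKC.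
by move=> [l _ h]; exists (k + l)%N => //; exact: leq_addr.
Qed.

Lemma measurable_steep z k : measurable (steep z k).
Proof. by rewrite steepE; apply: bigcup_measurable => l _; have [] := steep_atP z (k + l). Qed.

Lemma steep_probability z k : (P (steep z k) <= (q' ^+ k / (1 - q'))%:E)%E.
Proof.
have /andP[q'0 q'1] := q'01.
apply: (@le_trans _ _ (\sum_(l <oo) P (steep_at z (k + l)))%E).
  apply: measure_sigma_subadditive.
  - by move=> l; have [] := steep_atP z (k + l).
  - exact: measurable_steep.
  - by rewrite steepE.
apply: lime_le; first exact: is_cvg_nneseries.
apply: nearW => n; apply: (@le_trans _ _ (\sum_(0 <= l < n) (q' ^+ (k + l))%:E)%E).
  by apply: lee_sum => l _; have [] := steep_atP z (k + l).
rewrite sumEFin lee_fin big_mkord.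
under eq_bigr do rewrite exprD.
by rewrite -mulr_sumr ler_wpM2l ?exprn_ge0// sum_geometric_le.
Qed.

Lemma steep_small (e : R) : 0 < e ->
  exists K, forall z k, (K <= k)%N -> (P (steep z k) <= e%:E)%E.
Proof.
move=> e0; have /andP[q'0 q'1] := q'01.
have e1 : 0 < e * (1 - q') by rewrite mulr_gt0// subr_gt0.
have : q' ^+ n @[n --> \oo] --> 0 by apply: cvg_expr; rewrite ger0_norm.
move=> /cvgrPdist_le /(_ _ e1)[K _ hK]; exists K => z k Kk.
apply: le_trans (steep_probability z k) _; rewrite lee_fin ler_pdivrMr ?subr_gt0//.
by have := hK k Kk; rewrite sub0r normrN ger0_norm ?exprn_ge0.
Qed.

Lemma not_steep_sum z k w : ~ steep z k w -> forall L,
  \sum_(i < L) Pi (rightward z) 0 (k + i) w <= rate ^+ k / (1 - rate).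
Proof.
move=> ns L; have /andP[r0 r1] := rate01.
apply: (@le_trans _ _ (\sum_(i < L) rate ^+ (k + i))).
  apply: ler_sum => i _; rewrite leNgt; apply/negP => h; apply: ns.
  by exists (k + i)%N => //; exact: leq_addr.
under eq_bigr do rewrite exprD.
by rewrite -mulr_sumr ler_wpM2l ?exprn_ge0 ?(ltW r0)// sum_geometric_le// (ltW r0).
Qed.

End steep.

(** * Recurrence of independent events, up to rare exceptions *)

Section rare_events.
Context {R : realType} (P : probability (env R) R).

Definition rare (B : nat -> set (env R)) := (forall k, measurable (B k)) /\
  forall e : R, 0 < e -> exists K, forall k, (K <= k)%N -> (P (B k) <= e%:E)%E.

Lemma rareU (A B : nat -> set (env R)) : rare A -> rare B -> rare (fun k => A k `|` B k).
Proof.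
move=> [mA hA] [mB hB]; split; first by move=> k; exact: measurableU.
move=> e e0; have e2 : 0 < e / 2 by rewrite divr_gt0.
have [K1 h1] := hA _ e2; have [K2 h2] := hB _ e2.
exists (maxn K1 K2) => k; rewrite geq_max => /andP[k1 k2].
apply: le_trans (measureU2 P (mA k) (mB k)) _.
by rewrite [e]splitr EFinD leeD ?h1 ?h2.
Qed.

End rare_events.

Section infinitely_often.
Context {R : realType} (P : probability (env R) R).
Hypothesis iidP : iid_product P.
Implicit Types (w : env R).

Lemma E_prod_sites (g : nat -> env R -> R) (b : nat -> int) K N (c : R) :
  {homo b : i j / (i <= j)%N >-> i <= j} ->
  (forall k, (K <= k)%N -> obs (sites (b k) (b k.+1)) (g k)) ->
  (forall k w, (K <= k)%N -> g k w <= 1) ->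
  (forall k, (K <= k)%N -> E P (g k) <= c) ->
  L1 P (sites (b K) (b (K + N)%N)) (fun w => \prod_(j < N) g (K + j)%N w) /\
  E P (fun w => \prod_(j < N) g (K + j)%N w) <= c ^+ N.
Proof.
move=> bmono og g1 Eg; elim: N => [|N [L IH]].
  have -> : (fun w => \prod_(j < 0) g (K + j)%N w) = fun=> 1.
    by apply/funext => w; rewrite big_ord0.
  by rewrite expr0 E_cst; split; [exact: L1_cst|].
have -> : (fun w => \prod_(j < N.+1) g (K + j)%N w) =
    fun w => (\prod_(j < N) g (K + j)%N w) * g (K + N)%N w.
  by apply/funext => w; rewrite big_ord_recr.
have KN : (K <= K + N)%N by rewrite leq_addr.
have LN := L1_bounded P (og _ KN) (fun w => g1 _ w KN).
have d : sites (b K) (b (K + N)%N) `&` sites (b (K + N)%N) (b (K + N).+1) = set0.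
  by apply/seteqP; split => // i; rewrite /sites/=; lia.
split.
  apply: (L1_sub _ (L1M iidP d L LN)) => i; rewrite /sites/= addnS.
  have := bmono _ _ KN; have := bmono _ _ (leqnSn (K + N)%N).
  by move=> h1 h2 [|]; lia.
rewrite (EM iidP d L LN) exprSr; apply: ler_pM => //.
- by apply: E_ge0 => w; exact: obs_ge0 (L1_obs L) w.
- by apply: E_ge0 => w; exact: obs_ge0 (L1_obs LN) w.
- exact: Eg.
Qed.

(** The f k are independent, so that N consecutive ones vanish together with
    probability at most (1 - c)^N. Once N is chosen, a late start makes the N
    exceptional events of that block unlikely together. *)
Lemma infinitely_often (f : nat -> env R -> R) (B : nat -> set (env R))
    (b : nat -> int) (c : R) (K0 : nat) :
  {homo b : i j / (i <= j)%N >-> i <= j} ->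
  (forall k, (K0 <= k)%N -> obs (sites (b k) (b k.+1)) (f k)) ->
  (forall k w, f k w <= 1) -> 0 < c -> (forall k, (K0 <= k)%N -> c <= E P (f k)) ->
  rare P B -> forall m, P.-negligible [set w | forall k, (m <= k)%N -> f k w = 0 \/ B k w].
Proof.
move=> bmono of_ f1 c0 Ef [mB PB] m.
pose m' := maxn m K0.
pose Bad := [set w | forall k, (m' <= k)%N -> f k w = 0 \/ B k w].
apply: (@negligibleS _ _ _ P Bad) => [w h k mk|].
  by apply: h; rewrite (leq_trans _ mk)// leq_maxl.
have K0m' : (K0 <= m')%N by rewrite leq_maxr.
have mBad : measurable Bad.
  have -> : Bad = \bigcap_(k in [set k | (m' <= k)%N]) ([set w | f k w <= 0] `|` B k).
    apply/seteqP; split => w h k mk.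
      by have [fk|] := h k mk; [left; rewrite /= fk|right].
    have [/= hf|] := h k mk; last by right.
    left; apply/le_anti; rewrite hf/=.
    by apply: (obs_ge0 (of_ k _)); rewrite (leq_trans K0m').
  apply: bigcap_measurableType => k mk; apply: measurableU => //.
  have o := of_ k (leq_trans K0m' mk).
  by have [] := event_probability P (obs_le o (obs_cst _ (lexx 0))).
apply/negligibleP => //.
have c1 : c <= 1.
  by apply: le_trans (Ef K0 (leqnn _)) _; apply: (E_cst_le P (of_ K0 (leqnn _))).
have small e : 0 < e -> (P Bad <= e%:E)%E.
  move=> e0; have e2 : 0 < e / 2 by rewrite divr_gt0.
  have [N hN] : exists N, (1 - c) ^+ N <= e / 2.
    have : (1 - c) ^+ n @[n --> \oo] --> 0.
      by apply: cvg_expr; rewrite ger0_norm ?subr_ge0// gtrBl.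
    move=> /cvgrPdist_le /(_ _ e2)[N _ hN]; exists N.
    by have := hN N (leqnn _); rewrite sub0r normrN ger0_norm ?exprn_ge0 ?subr_ge0.
  have eN : 0 < e / 2 / N.+1%:R by rewrite divr_gt0.
  have [K1 hK1] := PB _ eN.
  pose K := maxn K1 m'.
  have K0K : (K0 <= K)%N by rewrite (leq_trans K0m')// leq_maxr.
  pose g k w := 1 - f k w.
  have [L EL] : L1 P (sites (b K) (b (K + N)%N)) (fun w => \prod_(j < N) g (K + j)%N w) /\
      E P (fun w => \prod_(j < N) g (K + j)%N w) <= (1 - c) ^+ N.
    have K0k k : (K <= k)%N -> (K0 <= k)%N by exact: leq_trans K0K.
    apply: E_prod_sites => // [k /K0k Kk|k w /K0k Kk|k /K0k Kk].
    - by apply: obs_complement => //; exact: of_.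
    - by rewrite gerBl; exact: (obs_ge0 (of_ k Kk) w).
    - by rewrite (E_complement P (of_ k Kk))// lerD2l lerN2 Ef.
  have oI := obs_le (obs_cst (sites (b K) (b (K + N)%N)) ler01) (L1_obs L).
  have [mI PI] := event_probability P oI.
  set I1 := [set w | _] in mI PI.
  apply: (@le_trans _ _ (P (I1 `|` \big[setU/set0]_(j < N) B (K + j)%N))).
    apply: le_measure; rewrite ?inE//.
      by apply: measurableU => //; apply: bigsetU_measurable.
    move=> w h; have [[j Bj]|nB] := pselect (exists j : 'I_N, B (K + j)%N w).
      by right; rewrite -(bigcup_mkord N (fun j => B (K + j)%N)); exists j => /=.
    left; rewrite /I1/= big1// => j _; rewrite /g.
    have [||Bw] := h (K + j)%N; last by exfalso; apply: nB; exists j.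
      by rewrite (leq_trans (leq_maxr K1 m'))// leq_addr.
    by move=> ->; rewrite subr0.
  apply: (@le_trans _ _ (P I1 + P (\big[setU/set0]_(j < N) B (K + j)%N))%E).
    by apply: measureU2 => //; apply: bigsetU_measurable.
  rewrite [e]splitr EFinD; apply: leeD.
    rewrite PI lee_fin; apply: le_trans hN; apply: le_trans EL.
    apply: (E_le oI L) => w; case: (leP 1 (\prod_(j < N) g (K + j)%N w)) => // _.
    exact: (obs_ge0 (L1_obs L) w).
  apply: (@le_trans _ _ (\sum_(j < N) P (B (K + j)%N))%E).
    exact: (@Boole_inequality _ _ _ P (fun j => B (K + j)%N)).
  apply: (@le_trans _ _ (\sum_(j < N) (e / 2 / N.+1%:R)%:E)%E).
    apply: lee_sum => j _; apply: hK1.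
    by rewrite (leq_trans (leq_maxl K1 m'))// leq_addr.
  rewrite sumEFin lee_fin sumr_const card_ord -[leLHS]mulr_natl mulrCA.
  by rewrite ler_piMr ?(ltW e2)// ler_pdivrMr// mul1r ler_nat.
apply/eqP; rewrite eq_le measure_ge0 andbT; apply/lee_addgt0Pr => e e0.
by rewrite add0e; exact: small.
Qed.

End infinitely_often.

(** * The walk in a fixed environment *)

Section quenched_chain.
Context {R : realType} (w : env R) (Q : probability walk R).
Hypothesis HQ : quenched_law w Q.
Implicit Types (A B C : set walk) (X : walk) (n m : nat) (i z : int).

Definition at_time n i : set walk := [set X | X n = i].

Lemma measurable_at_time n i : measurable (at_time n i).
Proof. by apply: sub_sigma_algebra; exists n, i. Qed.

Definition determined n A := forall X Y, (forall j, (j <= n)%N -> X j = Y j) -> A X -> A Y.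

Let cell n (b : seq int) : set walk := [set X | mkseq X n.+1 = b].

Let cell_history n b X : cell n b X -> cell n b = history n X.
Proof.
move=> <-; apply/seteqP; split => Y /=.
  move=> e j jn; have /(congr1 (fun s => nth 0 s j)) := e.
  by rewrite !nth_mkseq.
move=> h; apply/eq_in_map => j; rewrite mem_iota add0n ltnS => /andP[_ jn].
exact: h.
Qed.

Let measurable_history n (x : nat -> int) : measurable (history n x : set walk).
Proof.
rewrite (_ : history n x = \bigcap_(j in [set j | (j <= n)%N]) at_time j (x j))//.
by apply: bigcap_measurableType => j _; exact: measurable_at_time.
Qed.

Let measurable_cell n b : measurable (cell n b).
Proof.
have [->|/set0P[X cX]] := eqVneq (cell n b) set0; first exact: measurable0.
by rewrite (cell_history cX); exact: measurable_history.
Qed.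

(* The countably many possible pasts up to time n, indexed by nat. *)
Let past n m : set walk :=
  if @pickle_inv (seq int) m is Some b then cell n b else set0.

Let measurable_past n m : measurable (past n m).
Proof.
by rewrite /past; case: pickle_inv => [b|]; [exact: measurable_cell|exact: measurable0].
Qed.

Let past_cover n : \bigcup_m past n m = setT.
Proof.
rewrite -subTset => X _; exists (pickle (mkseq X n.+1)); first exact: I.
by rewrite /past pickleK_inv.
Qed.

Let trivIset_past n : trivIset setT (past n).
Proof.
move=> m1 m2 _ _ [X []]; rewrite /past.
have := @pickle_invK (seq int) m1; have := @pickle_invK (seq int) m2.
case: pickle_inv => [b2|//]; case: pickle_inv => [b1|//] /= <- <- /= <- <- //.
Qed.

Let past_determined n m A : determined n A ->
  A `&` past n m = set0 \/ exists2 X, A X & A `&` past n m = history n X.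
Proof.
move=> dA; have [->|/set0P[X [AX]]] := eqVneq (A `&` past n m) set0; first by left.
rewrite /past; case: pickle_inv => // b cX; right; exists X => //.
rewrite -(cell_history cX); apply/seteqP; split => Y /= [] //.
rewrite (cell_history cX) => h; split => //.
by apply: dA AX => j jn; rewrite h.
Qed.

Let sum_past n A : measurable A -> Q A = (\sum_(m <oo) Q (A `&` past n m))%E.
Proof.
move=> mA; rewrite -[in LHS](setIT A) -(past_cover n) setI_bigcupr measure_bigcup//=.
- by apply: eq_eseriesl => m; rewrite in_setT.
- by move=> m _; exact: measurableI.
- exact: trivIset_setIl.
Qed.

Lemma measurable_determined n A : determined n A -> measurable A.
Proof.
move=> dA; rewrite -(setIT A) -(past_cover n) setI_bigcupr.
apply: bigcup_measurable => m _.
by have [->|[X _ ->]] := past_determined m dA; [exact: measurable0|exact: measurable_history].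
Qed.

(** The law of the walk specifies the step after a complete history; an event
    determined by the past is a countable disjoint union of histories. *)
Lemma step_law n A i : determined n A -> A `<=` at_time n i ->
  Q (A `&` at_time n.+1 (i + 1)) = (Q A * (env_at w i)%:E)%E /\
  Q (A `&` at_time n.+1 (i - 1)) = (Q A * (1 - env_at w i)%:E)%E.
Proof.
move=> dA Ai; have mA := measurable_determined dA.
have /andP[w0 w1] := env_at01 w i.
have key c S : measurable S -> 0 <= c ->
    (forall X, X n = i -> Q (history n X `&` S) = (Q (history n X) * c%:E)%E) ->
    Q (A `&` S) = (Q A * c%:E)%E.
  move=> mS c0 h; rewrite (sum_past n mA) (sum_past n (measurableI _ _ mA mS)).
  rewrite muleC -nneseriesZl//.
  apply: eq_eseriesr => m _; rewrite muleC setIAC.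
  have [->|[X AX ->]] := past_determined m dA; last by rewrite h// (Ai X AX).
  by rewrite set0I measure0 mul0e.
have [_ step] := HQ.
split; apply: key; rewrite ?subr_ge0//; try exact: measurable_at_time.
  by move=> X <-; have [] := step n X.
by move=> X <-; have [] := step n X.
Qed.

Definition pr A : R := fine (Q A).

Lemma prE A : measurable A -> Q A = (pr A)%:E.
Proof. by move=> mA; rewrite /pr fineK// fin_num_measure. Qed.

Lemma pr_ge0 A : 0 <= pr A. Proof. exact: fine_ge0. Qed.

Lemma pr_le1 A : measurable A -> pr A <= 1.
Proof. by move=> mA; rewrite -lee_fin -prE//; exact: probability_le1. Qed.

Lemma pr_setT : pr setT = 1.
Proof. by rewrite /pr probability_setT. Qed.

Lemma pr_set0 : pr set0 = 0.
Proof. by rewrite /pr measure0. Qed.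

Lemma pr_split A B : measurable A -> measurable B ->
  pr A = pr (A `&` B) + pr (A `&` ~` B).
Proof.
move=> mA mB; apply: EFin_inj; have mC := measurableC mB.
rewrite EFinD -!prE//; try exact: measurableI.
rewrite -measureU//; try exact: measurableI.
  by rewrite -setIUr setUv setIT.
by rewrite setIACA setICr setI0.
Qed.

(** Nearest-neighbour paths started at 0: they have full probability, so that
    inclusions between events need only be checked on them. *)
Definition proper : set walk :=
  [set X | X 0%N = 0 /\ forall n, X n.+1 = X n + 1 \/ X n.+1 = X n - 1].

Let bad_step n i : set walk :=
  at_time n i `&` ~` (at_time n.+1 (i + 1) `|` at_time n.+1 (i - 1)).

Let measurable_bad_step n i : measurable (bad_step n i).
Proof.
apply: measurableI; first exact: measurable_at_time.
by apply: measurableC; apply: measurableU; exact: measurable_at_time.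
Qed.

Let pm1 i : i + 1 <> i - 1. Proof. lia. Qed.

Let bad_step0 n i : Q (bad_step n i) = 0%E.
Proof.
have dA : determined n (at_time n i) by move=> X Y h /= <-; rewrite h.
have [sr sl] := step_law dA (@subset_refl _ _).
have mi := measurable_at_time n i.
have mr := measurable_at_time n.+1 (i + 1); have ml := measurable_at_time n.+1 (i - 1).
have mU : measurable (at_time n.+1 (i + 1) `|` at_time n.+1 (i - 1)) by exact: measurableU.
have : pr (at_time n i) = pr (at_time n i) + pr (bad_step n i).
  rewrite [LHS](pr_split mi mU); congr (_ + _).
  apply: EFin_inj; rewrite -prE; last exact: measurableI.
  rewrite setIUr measureU; try exact: measurableI; last first.
    apply/seteqP; split => // X [[_ h1] [_ h2]]; apply: (@pm1 i).
    by rewrite -h1 -h2.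
  rewrite [X in (X + _)%E]sr [X in (_ + X)%E]sl prE// -!EFinM -EFinD; congr EFin; ring.
move/eqP; rewrite -subr_eq0 opprD addrA subrr add0r oppr_eq0 => /eqP h.
by rewrite prE// h.
Qed.

Lemma proper_full : Q.-negligible (~` proper).
Proof.
have [Q0 _] := HQ.
have neg n i : Q.-negligible (bad_step n i).
  by apply/negligibleP; [exact: measurable_bad_step|exact: bad_step0].
have neg0 : Q.-negligible (~` at_time 0 0).
  apply/negligibleP; first by apply: measurableC; exact: measurable_at_time.
  have h := probability_setC Q (measurable_at_time 0 0).
  by rewrite [LHS]h Q0 subee.
pose F m := if @pickle_inv (nat * int)%type m is Some ni then bad_step ni.1 ni.2 else set0.
have negF : Q.-negligible (\bigcup_m F m).
  apply: negligible_bigcup => m; rewrite /F; case: pickle_inv => [[n i]|].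
    exact: neg.
  exact: negligible_set0.
apply: (negligibleS _ (negligibleU neg0 negF)) => X nX.
apply: contrapT => h; apply: nX; split; first by apply: contrapT => h0; apply: h; left.
move=> n; apply: contrapT => hn; apply: h; right.
exists (pickle (n, X n)) => //; rewrite /F pickleK_inv/=.
by split => // hh; apply: hn.
Qed.

Lemma pr_le A B : measurable A -> measurable B ->
  (forall X, proper X -> A X -> B X) -> pr A <= pr B.
Proof.
move=> mA mB AB; have [N [mN N0 hN]] := proper_full.
rewrite -lee_fin -!prE//.
apply: (@le_trans _ _ (Q (B `|` N))).
  apply: le_measure; rewrite ?inE//; first exact: measurableU.
  move=> X AX; have [pX|npX] := pselect (proper X); first by left; exact: AB.
  by right; exact: hN.
apply: le_trans (measureU2 _ mB mN) _.
by rewrite [X in (_ + X)%E]N0 adde0.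
Qed.

Lemma pr_leU A B C : measurable A -> measurable B -> measurable C ->
  (forall X, proper X -> A X -> B X \/ C X) -> pr A <= pr B + pr C.
Proof.
move=> mA mB mC ABC; apply: (@le_trans _ _ (pr (B `|` C))).
  by apply: pr_le => //; exact: measurableU.
have mBC : measurable (B `|` C) by exact: measurableU.
rewrite -lee_fin EFinD -(prE mBC) -(prE mB) -(prE mC).
exact: measureU2.
Qed.

Lemma pr_step n A i : determined n A -> A `<=` at_time n i ->
  pr (A `&` at_time n.+1 (i + 1)) = pr A * env_at w i /\
  pr (A `&` at_time n.+1 (i - 1)) = pr A * (1 - env_at w i).
Proof.
move=> dA Ai; have [sr sl] := step_law dA Ai; have mA := measurable_determined dA.
split; apply: EFin_inj; rewrite EFinM -!prE//; apply: measurableI => //;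
  exact: measurable_at_time.
Qed.

End quenched_chain.

(** * Hitting times in a fixed environment *)

Section hitting.
Context {R : realType} (w : env R) (Q : probability walk R).
Hypothesis HQ : quenched_law w Q.
Hypothesis w_gt0 : forall i, 0 < env_at w i.
Implicit Types (A B C : set walk) (X : walk) (n m k t : nat) (i z y : int).

Let w_le1 i : env_at w i <= 1. Proof. by have /andP[] := env_at01 w i. Qed.

Let w_odds i : env_at w i * odds w i = 1 - env_at w i.
Proof. by rewrite /odds mulrC divfK// gt_eqF. Qed.

Local Notation pr := (pr Q).

Definition before t y : set walk := [set X | forall j, (j <= t)%N -> X j < y].

Lemma determined_before t y : determined t (before t y).
Proof. by move=> X Y h bX j jt; rewrite -h// bX. Qed.

Lemma measurable_before t y : measurable (before t y).
Proof. exact: measurable_determined (@determined_before t y). Qed.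

Lemma determinedI n A B : determined n A -> determined n B -> determined n (A `&` B).
Proof. by move=> dA dB X Y h [AX BX]; split; [exact: dA AX|exact: dB BX]. Qed.

Lemma determined_at n i : determined n (at_time n i).
Proof. by move=> X Y h /= <-; rewrite h. Qed.

Lemma determined_before_at t y i : determined t (before t y `&` at_time t i).
Proof. by apply: determinedI; [exact: determined_before|exact: determined_at]. Qed.

Lemma measurable_before_at t y i : measurable (before t y `&` at_time t i).
Proof. exact: measurable_determined (@determined_before_at t y i). Qed.
Lemma measurable_event A : (exists n, determined n A) -> measurable A.
Proof. by move=> [n]; exact: measurable_determined. Qed.

Lemma measurable_at_most t z : measurable [set X : walk | X t <= z].
Proof. by apply: measurable_event; exists t => X Y h /=; rewrite h. Qed.

(** A stationary supersolution of the flow equation with absorption at y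
    dominates the occupation probabilities. *)
Lemma occupation_le (M : int -> R) (a y : int) t i : 0 <= a ->
  (forall j, 0 <= M j) -> 1 <= M a ->
  (forall j, a < j < y -> env_at w (j - 1) * M (j - 1) +
      (1 - env_at w (j + 1)) * (if j + 1 < y then M (j + 1) else 0) <= M j) ->
  a <= i < y -> pr (before t y `&` at_time t i) <= M i.
Proof.
move=> a0 M0 Ma superM; elim: t i => [|t IH] i /andP[ai iy].
  have [->|ia] := eqVneq i a.
    apply: le_trans Ma; apply: pr_le1; exact: measurable_before_at.
  rewrite (_ : pr _ = 0) ?M0//; apply/le_anti; rewrite pr_ge0 andbT -(pr_set0 Q).
  apply: (pr_le HQ) => //.
    exact: measurable_before_at.
  move=> X [X0 _] [_]; rewrite /at_time/= X0 => i0.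
  by move/eqP: ia; move: ai; rewrite -i0; lia.
have [->|ia] := eqVneq i a.
  apply: le_trans Ma; apply: pr_le1; exact: measurable_before_at.
have dA j : determined t (before t y `&` at_time t j).
  exact: determined_before_at.
have mS j j' : measurable ((before t y `&` at_time t j) `&` at_time t.+1 j').
  apply: measurableI; last exact: measurable_at_time.
  exact: measurable_determined (dA j).
have sub j : before t y `&` at_time t j `<=` at_time t j by move=> X [].
have := superM i; move=> /(_ _); have -> : a < i < y by lia.
move=> /(_ isT); apply: le_trans.
apply: (@le_trans _ _ (pr ((before t y `&` at_time t (i - 1)) `&` at_time t.+1 i) +
   pr ((before t y `&` at_time t (i + 1)) `&` at_time t.+1 i))).
  apply: (pr_leU HQ) => //.
    exact: measurable_before_at.
  move=> X [_ /(_ t) nn] [bX Xi].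
  have bt : before t y X by move=> j jt; apply: bX; exact: leqW.
  move: (Xi); rewrite /at_time/= => Xi'.
  case: nn; rewrite Xi' => iE; [left|right]; split => //; split => //.
    by rewrite /at_time/= iE addrK.
  by rewrite /at_time/= iE subrK.
apply: lerD.
  have [+ _] := pr_step HQ (dA (i - 1)) (@sub _); rewrite subrK => ->.
  by rewrite mulrC ler_wpM2l ?(ltW (w_gt0 _))// IH//; lia.
have [_] := pr_step HQ (dA (i + 1)) (@sub _); rewrite addrK => ->.
rewrite mulrC ler_wpM2l ?subr_ge0//; case: ifPn => iy'; first by rewrite IH//; lia.
rewrite (_ : _ `&` _ = set0) ?pr_set0//.
apply/seteqP; split => // X [/(_ t (leqnn _)) Xy]; rewrite /at_time/= => Xi.
by move: Xy; rewrite Xi (negbTE iy').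
Qed.

Lemma hitting_density_occupation t y : 0 < y ->
  pr (before t y) - pr (before t.+1 y) <=
  pr (before t y `&` at_time t (y - 1)) * env_at w (y - 1).
Proof.
move=> y0.
have dA : determined t (before t y `&` at_time t (y - 1)).
  exact: determined_before_at.
have [<- _] := pr_step HQ dA (fun X h => proj2 h).
rewrite lerBlDl subrK; apply: (pr_leU HQ).
- exact: measurable_before.
- exact: measurable_before.
- by apply: measurableI; [exact: measurable_determined dA|exact: measurable_at_time].
move=> X [_ /(_ t) nn] bX.
have [Xy|Xy] := boolP (X t.+1 < y).
  by left => j; rewrite leq_eqVlt => /predU1P[->//|]; exact: bX.
right; have Xt := bX t (leqnn _).
have e : X t.+1 = y /\ X t = y - 1.
  by move: Xt Xy nn; move: (X t) (X t.+1) => u v; lia.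
by split; [split => //|]; rewrite /at_time/= ?subrK; case: e.
Qed.

(** The resistance between z + k and z + K in the network associated with the
    walk, normalised so that the edge from z + k to z + k + 1 has resistance 1. *)
Definition resistance z (K k : nat) : R := \sum_(k <= l < K) Pi (rightward z) k l w.

Lemma resistance_rec z K k : (k < K)%N ->
  resistance z K k = 1 + odds w (z + k.+1%:Z) * resistance z K k.+1.
Proof.
move=> kK; rewrite /resistance big_ltn// Pi_nil mulr_sumr; congr (_ + _).
apply: eq_big_nat => l /andP[kl _].
by rewrite /Pi big_ltn.
Qed.

Lemma resistance_ge0 z K k : 0 <= resistance z K k.
Proof. by apply: sumr_ge0 => l _; exact: Pi_ge0. Qed.

(** The occupation probabilities before the hitting time of y = a + K are at most
    those of the stationary flow that enters at a, where its density is
    1 / w_a, and is absorbed at y. That flow carries the inverse of the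
    resistance through y per unit of time. *)
Lemma hitting_density (a K : nat) t : (0 < K)%N ->
  pr (before t (a + K)%:Z) - pr (before t.+1 (a + K)%:Z) <= (resistance a K 0)^-1.
Proof.
move=> K0; set y : int := (a + K)%:Z.
pose Ra := resistance a K 0.
have Ra1 : 1 <= Ra.
  rewrite /Ra resistance_rec// lerDl mulr_ge0 ?odds_ge0//; exact: resistance_ge0.
have Ra0 : 0 < Ra := lt_le_trans ltr01 Ra1.
pose M (j : int) := resistance a K `|j - a%:Z|%N / (env_at w j * Ra).
have M0 j : 0 <= M j.
  by rewrite divr_ge0 ?resistance_ge0// mulr_ge0 ?(ltW (w_gt0 _)) ?ltW.
have Mk k : env_at w (a%:Z + k%:Z) * M (a%:Z + k%:Z) = resistance a K k / Ra.
  rewrite /M (_ : `|_|%N = k); last by lia.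
  by field; rewrite gt_eqF ?w_gt0// gt_eqF.
apply: (le_trans (@hitting_density_occupation t y _)); first by lia.
(* M solves the stationary equation strictly between a and y. *)
have step : pr (before t y `&` at_time t (y - 1)) <= M (y - 1).
  apply: (@occupation_le M a y) => //; last by rewrite /y; lia.
    have e : env_at w a * M a = 1 by have := Mk 0%N; rewrite addr0 divff ?gt_eqF.
    by rewrite -e ler_piMl ?M0.
  move=> j /andP[aj jy].
  have [k kE] : exists k : nat, j = a%:Z + k.+1%:Z.
    by exists `|j - a%:Z|.-1%N; lia.
  have k1K : (k.+1 < K)%N by move: jy; rewrite kE /y; lia.
  have -> : j - 1 = a%:Z + k%:Z by rewrite kE; lia.
  have -> : j + 1 = a%:Z + k.+2%:Z by rewrite kE; lia.
  have -> : (1 - env_at w (a%:Z + k.+2%:Z)) *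
      (if a%:Z + k.+2%:Z < y then M (a%:Z + k.+2%:Z) else 0) =
      odds w (a%:Z + k.+2%:Z) * resistance a K k.+2 / Ra.
    rewrite -w_odds; case: ifPn => hk.
      by rewrite mulrAC Mk; ring.
    rewrite (_ : resistance _ _ _ = 0) ?mulr0 ?mul0r// /resistance big_geq//.
    by move: hk; rewrite /y; lia.
  rewrite Mk resistance_rec; last exact: ltnW.
  have wj := w_gt0 j; have wj0 : env_at w j != 0 by rewrite gt_eqF.
  have e : M j = (1 + odds w j) * resistance a K k.+1 / Ra.
    have := Mk k.+1; rewrite -kE => h; apply: (mulfI wj0); rewrite h.
    by rewrite !mulrA mulrDr w_odds mulr1 subrKC mul1r.
  rewrite e kE (resistance_rec a k1K) le_eqVlt; apply/orP; left; apply/eqP; ring.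
apply: (le_trans (ler_wpM2r (ltW (w_gt0 _)) step)).
have -> : y - 1 = a%:Z + K.-1%:Z by rewrite /y; lia.
rewrite mulrC Mk resistance_rec ?prednK//.
by rewrite {1}/resistance big_geq// mulr0 addr0 mul1r.
Qed.

Lemma pr_mul_step n A i (c : R) : determined n A -> A `<=` at_time n i ->
  forall B (cr cl : R), measurable B ->
  pr ((A `&` at_time n.+1 (i + 1)) `&` B) <= pr (A `&` at_time n.+1 (i + 1)) * cr ->
  pr ((A `&` at_time n.+1 (i - 1)) `&` B) <= pr (A `&` at_time n.+1 (i - 1)) * cl ->
  pr (A `&` B) <= pr A * (env_at w i * cr + (1 - env_at w i) * cl).
Proof.
move=> dA Ai B cr cl mB hr hl; have mA := measurable_determined dA.
have [er el] := pr_step HQ dA Ai.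
have -> : pr A * (env_at w i * cr + (1 - env_at w i) * cl) =
   pr (A `&` at_time n.+1 (i + 1)) * cr + pr (A `&` at_time n.+1 (i - 1)) * cl.
  by rewrite er el; ring.
apply: le_trans (lerD hr hl); apply: (pr_leU HQ).
- exact: measurableI.
- by apply: measurableI => //; apply: measurableI => //; exact: measurable_at_time.
- by apply: measurableI => //; apply: measurableI => //; exact: measurable_at_time.
move=> X [_ /(_ n) nn] [AX BX]; have Xn : X n = i := Ai X AX.
by case: nn; rewrite Xn => h; [left|right].
Qed.

(** Backward induction on the number m of remaining steps. At each site either
    the bound psi is trivial, or the event cannot happen, or psi is
    superharmonic for one step of the walk. *)
Lemma backward_bound (B : nat -> nat -> set walk) (psi : nat -> int -> R) :
  (forall m n, measurable (B m n)) -> (forall m i, 0 <= psi m i) ->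
  (forall m i, [\/ 1 <= psi m i, forall n X, X n = i -> ~ B m n X |
     exists m', [/\ m = m'.+1, forall n X, X n = i -> B m n X -> B m' n.+1 X &
       env_at w i * psi m' (i + 1) + (1 - env_at w i) * psi m' (i - 1) <= psi m i]]) ->
  forall m n A i, determined n A -> A `<=` at_time n i ->
  pr (A `&` B m n) <= pr A * psi m i.
Proof.
move=> mB psi0 step; elim => [|m IH] n A i dA Ai; have mA := measurable_determined dA.
  have [p1|no|[m' []//]] := step 0%N i.
    apply: (@le_trans _ _ (pr A)); last by rewrite ler_peMr ?pr_ge0.
    by apply: (pr_le HQ) => //; [exact: measurableI|move=> X _ []].
  rewrite (_ : A `&` _ = set0) ?pr_set0 ?mulr_ge0 ?pr_ge0//.
  by apply/seteqP; split => // X [/Ai Xi BX]; exact: no Xi BX.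
have [p1|no|[m' [[<-] BB superm]]] := step m.+1 i.
- apply: (@le_trans _ _ (pr A)); last by rewrite ler_peMr ?pr_ge0.
  by apply: (pr_le HQ) => //; [exact: measurableI|move=> X _ []].
- rewrite (_ : A `&` _ = set0) ?pr_set0 ?mulr_ge0 ?pr_ge0//.
  by apply/seteqP; split => // X [/Ai Xi BX]; exact: no Xi BX.
apply: le_trans (ler_wpM2l (pr_ge0 Q A) superm).
apply: (@le_trans _ _ (pr (A `&` B m n.+1))).
  apply: (pr_le HQ); try exact: measurableI.
  by move=> X _ [AX BX]; split => //; apply: BB BX; exact: Ai.
have dS j : determined n.+1 (A `&` at_time n.+1 j).
  apply: determinedI; last exact: determined_at.
  by move=> X Y h; apply: dA => k kn; apply: h; exact: leqW.
by apply: (pr_mul_step 0 dA Ai) => //; apply: IH => // X [].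
Qed.

(** The summands are the increments of the scale function of the walk to the right
    of z, so that e bounds the chance to go back from z + k to z. *)
Definition small_return z k (e : R) :=
  forall L, \sum_(i < L) Pi (rightward z) 0 (k + i) w <= e.

Definition backtracks z m n : set walk := [set X | exists2 j, (j <= m)%N & X (n + j)%N <= z].

Lemma measurable_backtracks z m n : measurable (backtracks z m n).
Proof.
apply: measurable_event; exists (n + m)%N => X Y h [j jm Xj].
by exists j => //; rewrite -h// leq_add2l.
Qed.

(** The harmonic function G with the increments of the scale function to the
    right of z is at least 1 at z, nonnegative everywhere, and equal to e at
    z + k0. *)
Lemma backtrack_le z (k0 : nat) (e : R) n m A : (0 < k0)%N ->
  small_return z k0 e ->
  determined n A -> A `<=` at_time n (z + k0%:Z) ->
  pr (A `&` backtracks z m n) <= pr A * e.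
Proof.
move=> k00 He dA Ai.
have e0 : 0 <= e by have := He 0%N; rewrite big_ord0.
pose d l := Pi (rightward z) 0 l w.
pose G k := e + \sum_(k <= l < k0) d l - \sum_(k0 <= l < k) d l.
have GS k : G k - G k.+1 = d k.
  have [kk0|kk0] := ltnP k k0.
    rewrite /G big_ltn// [in X in _ - X - _]big_geq ?(ltnW kk0)//.
    by rewrite [in X in _ - (_ - X)]big_geq//; ring.
  rewrite /G [X in e + X - _]big_geq// [X in _ - (e + X - _)]big_geq ?leqW//.
  by rewrite [in X in _ - (_ - X)]big_nat_recr//=; ring.
have G0 k : 0 <= G k.
  have := He (k - k0)%N; have -> : \sum_(i < k - k0) Pi (rightward z) 0 (k0 + i) w =
      \sum_(k0 <= l < k) d l.
    rewrite -[X in \sum_(X <= _ < _) _]add0n big_addn big_mkord.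
    by apply: eq_bigr => i _; rewrite /d addnC.
  move=> h; rewrite /G -addrA addrCA addr_ge0 ?subr_ge0//.
  by apply: sumr_ge0 => l _; exact: Pi_ge0.
have Gk0 : G k0 = e by rewrite /G !big_geq// addr0 subr0.
have G01 : 1 <= G 0%N.
  rewrite -[leRHS](subrK (G 1%N)) GS /d Pi_nil lerDl; exact: G0.
pose g (i : int) := if i <= z then 1 else G `|i - z|%N.
have gG k : g (z + k%:Z) <= G k.
  rewrite /g; case: ifPn => h; last by rewrite (_ : `|_|%N = k)//; lia.
  by have -> : k = 0%N by lia.
have g0 i : 0 <= g i by rewrite /g; case: ifP.
rewrite -Gk0; have -> : G k0 = g (z + k0%:Z).
  by rewrite /g ifF; [congr G; lia|lia].
apply: (backward_bound (psi := fun=> g)) => //.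
  exact: measurable_backtracks.
move=> m' i; have [iz|zi] := leP i z; first by constructor 1; rewrite /g iz.
have [k kE] : exists k : nat, i = z + k.+1%:Z by exists `|i - z|.-1%N; lia.
case: m' => [|m'].
  constructor 2 => n' X Xi [j]; rewrite leqn0 => /eqP ->; rewrite addn0 Xi.
  by rewrite leNgt zi.
constructor 3; exists m'; split => //.
  move=> n' X Xi [[|j] jm Xj]; first by move: Xj; rewrite addn0 Xi leNgt zi.
  by exists j => //; rewrite addSnnS.
have -> : g i = G k.+1 by rewrite /g ifF; [congr G; lia|lia].
have -> : i + 1 = z + k.+2%:Z by lia.
have -> : i - 1 = z + k%:Z by lia.
have wi := w_gt0 i.
apply: (@le_trans _ _ (env_at w i * G k.+2 + (1 - env_at w i) * G k)).
  by apply: lerD; rewrite ler_wpM2l ?subr_ge0 ?(ltW wi).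
have dk : d k.+1 = d k * odds w i by rewrite /d Pi_recr// /rightward kE.
have h1 := GS k; have h2 := GS k.+1; rewrite dk in h2.
have -> : G k = G k.+1 + d k by rewrite -h1; ring.
have -> : G k.+2 = G k.+1 - d k * odds w i by rewrite -h2; ring.
have := w_odds i; move: (odds w i) (env_at w i) (d k) (G k.+1) => r o dd gg h.
have -> : o * (gg - dd * r) + (1 - o) * (gg + dd) = gg - (o * r) * dd + (1 - o) * dd by ring.
by rewrite h subrK.
Qed.

(** The probability that the walk started at i spends the times 0, ..., m strictly
    between z and y. *)
Fixpoint stay z y (m : nat) (i : int) : R :=
  if z < i < y then
    if m is m'.+1 then env_at w i * stay z y m' (i + 1) + (1 - env_at w i) * stay z y m' (i - 1)
    else 1
  else 0.

Lemma stay_out z y m i : ~~ (z < i < y) -> stay z y m i = 0.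
Proof. by case: m => [|m] /= /negbTE ->. Qed.

Lemma stay_ge0 z y m i : 0 <= stay z y m i.
Proof.
elim: m i => [|m IH] i /=; case: ifP => // _.
by rewrite addr_ge0// mulr_ge0 ?subr_ge0 ?(ltW (w_gt0 _)).
Qed.

Lemma stay_antitone z y m i : stay z y m.+1 i <= stay z y m i.
Proof.
elim: m i => [|m IH] i /=; case: ifP => // _.
  apply: (@le_trans _ _ (env_at w i * 1 + (1 - env_at w i) * 1)).
    2: by rewrite !mulr1 subrKC.
  by apply: lerD; rewrite ler_wpM2l ?subr_ge0 ?(ltW (w_gt0 _))//; case: ifP.
apply: lerD; rewrite ler_wpM2l ?subr_ge0 ?(ltW (w_gt0 _))//; exact: IH.
Qed.

(** The mean time to reach z + N when reflected at z dominates the mean time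
    spent strictly between z and z + N before leaving. *)
Lemma sum_stay_le z (N k m : nat) : (k <= N)%N ->
  \sum_(l < m) stay z (z + N%:Z) l (z + k%:Z) <= crossing_mean w z k (N - k).
Proof.
elim: m k => [|m IH] k kN; first by rewrite big_ord0 crossing_mean_ge0.
have [inside|outside] := boolP (z < z + k%:Z < z + N%:Z); last first.
  by rewrite big1 ?crossing_mean_ge0// => l _; exact: stay_out.
have [j kE] : exists j : nat, k = j.+1 by exists k.-1%N; lia.
have jN : (j.+1 < N)%N by lia.
pose i := z + k%:Z; have wi := w_gt0 i.
have D l : (l < N)%N -> crossing_mean w z l (N - l) =
    (1 + 2 * W w z l) + crossing_mean w z l.+1 (N - l.+1).
  move=> lN; rewrite /crossing_mean subnS -[in LHS](prednK (_ : 0 < N - l)%N) ?subn_gt0//.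
  rewrite big_ord_recl addn0; congr (_ + _); apply: eq_bigr => a _.
  by rewrite /= addnS.
have s0 : stay z (z + N%:Z) 0 (z + k%:Z) = 1 by rewrite /= inside.
have sS l : stay z (z + N%:Z) l.+1 (z + k%:Z) =
    env_at w i * stay z (z + N%:Z) l (z + k.+1%:Z) +
    (1 - env_at w i) * stay z (z + N%:Z) l (z + j%:Z).
  rewrite /= inside; congr (_ * stay _ _ _ _ + _ * stay _ _ _ _); lia.
rewrite big_ord_recl s0.
have -> : \sum_(l < m) stay z (z + N%:Z) (lift ord0 l) (z + k%:Z) =
  env_at w i * (\sum_(l < m) stay z (z + N%:Z) l (z + k.+1%:Z)) +
  (1 - env_at w i) * (\sum_(l < m) stay z (z + N%:Z) l (z + j%:Z)).
  rewrite !mulr_sumr -big_split; apply: eq_bigr => l _.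
  by rewrite lift0 sS.
have h1 : \sum_(l < m) stay z (z + N%:Z) l (z + k.+1%:Z) <= crossing_mean w z k.+1 (N - k.+1).
  by apply: IH; lia.
have h2 : \sum_(l < m) stay z (z + N%:Z) l (z + j%:Z) <= crossing_mean w z j (N - j).
  by apply: IH; lia.
have h3 := ler_wpM2l (ltW wi) h1.
have wi1 : 0 <= 1 - env_at w i by rewrite subr_ge0.
have h4 := ler_wpM2l wi1 h2.
apply: (@le_trans _ _ (1 + (env_at w i * crossing_mean w z k.+1 (N - k.+1) +
    (1 - env_at w i) * crossing_mean w z j (N - j)))); first by rewrite lerD2l lerD.
have Ej := D j (ltnW jN); have Ek : crossing_mean w z k (N - k) = _ := D k _.
rewrite Ej -kE Ek ?kE//= -kE -/i.
rewrite le_eqVlt; apply/orP; left; apply/eqP.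
have e1 : env_at w i * (odds w i * (1 + W w z j)) = (1 - env_at w i) * (1 + W w z j).
  by rewrite mulrA w_odds.
move: e1; move: (env_at w i) (odds w i) (W w z j) (crossing_mean _ _ _ _) => o r V c e1.
have -> : 1 + (o * c + (1 - o) * (1 + 2 * V + (1 + 2 * (r * (1 + V)) + c))) =
  1 + 2 * (r * (1 + V)) + c + (2 * (1 - o) * (1 + V) - 2 * (o * (r * (1 + V)))) by ring.
by rewrite e1; ring.
Qed.

Definition stays z y m n : set walk := [set X | forall j, (j <= m)%N -> z < X (n + j)%N < y].

Lemma measurable_stays z y m n : measurable (stays z y m n).
Proof.
apply: measurable_event; exists (n + m)%N => X Y h sX j jm.
by rewrite -h ?leq_add2l// sX.
Qed.

Lemma stays_le z y n m A i : determined n A -> A `<=` at_time n i ->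
  pr (A `&` stays z y m n) <= pr A * stay z y m i.
Proof.
apply: backward_bound; [exact: measurable_stays|exact: stay_ge0|].
move=> {}m {}i; have [inside|outside] := boolP (z < i < y); last first.
  constructor 2 => {}n X Xi /(_ 0%N isT); rewrite addn0 Xi.
  by rewrite (negbTE outside).
case: m => [|m]; first by constructor 1; rewrite /= inside.
constructor 3; exists m; split => //; last by rewrite /= inside.
by move=> n' X Xi sX j jm; rewrite addSnnS; apply: sX.
Qed.

Definition below_during y m n : set walk := [set X | forall j, (j <= m)%N -> X (n + j)%N < y].

Lemma measurable_below_during y m n : measurable (below_during y m n).
Proof.
apply: measurable_event; exists (n + m)%N => X Y h sX j jm.
by rewrite -h ?leq_add2l// sX.
Qed.

(** A walk that stays below z + N either goes back to z or stays strictly between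
    z and z + N. As staying for l steps is less likely for larger l, its
    probability for m steps is at most the mean over l < m. *)
Lemma below_during_le z (N k : nat) (e : R) n m A : (0 < k <= N)%N -> (0 < m)%N ->
  small_return z k e ->
  determined n A -> A `<=` at_time n (z + k%:Z) ->
  pr (A `&` below_during (z + N%:Z) m n) <=
  pr A * (crossing_mean w z k (N - k) / m%:R + e).
Proof.
move=> /andP[k0 kN] m0 He dA Ai; have mA := measurable_determined dA.
rewrite mulrDr; apply: (@le_trans _ _ (pr (A `&` stays z (z + N%:Z) m n) +
  pr (A `&` backtracks z m n))).
  apply: (pr_leU HQ).
  - by apply: measurableI => //; exact: measurable_below_during.
  - by apply: measurableI => //; exact: measurable_stays.
  - by apply: measurableI => //; exact: measurable_backtracks.
  move=> X _ [AX bX]; have [back|nback] := pselect (backtracks z m n X); first by right.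
  left; split => // j jm; rewrite bX// andbT ltNge; apply/negP => h.
  by apply: nback; exists j.
apply: lerD; last exact: backtrack_le He dA Ai.
apply: le_trans (stays_le z (z + N%:Z) m dA Ai) _.
rewrite ler_wpM2l ?pr_ge0// ler_pdivlMr ?ltr0n//.
apply: le_trans (sum_stay_le z m kN).
rewrite mulr_natr -[X in _ *+ X]card_ord -sumr_const; apply: ler_sum => l _.
have : forall a b, (a <= b)%N -> stay z (z + N%:Z) b (z + k%:Z) <= stay z (z + N%:Z) a (z + k%:Z).
  move=> a; elim=> [|b IH]; first by rewrite leqn0 => /eqP ->.
  rewrite leq_eqVlt => /predU1P[->//|]; rewrite ltnS => /IH.
  exact/le_trans/stay_antitone.
by apply; exact: ltnW.
Qed.

Definition first_hit y n : set walk :=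
  [set X | (forall j, (j < n)%N -> X j < y) /\ X n = y].

Lemma determined_first_hit y n : determined n (first_hit y n).
Proof.
move=> X Y h [bX Xn]; split; last by rewrite -h.
by move=> j jn; rewrite -h ?bX// ltnW.
Qed.

Lemma sum_first_hit_le1 y t : \sum_(n < t) pr (first_hit y n) <= 1.
Proof.
have mh n := measurable_determined (@determined_first_hit y n).
suff : forall t, \sum_(n < t.+1) pr (first_hit y n) + pr (before t y) <= 1.
  case: t => [|t] h; first by rewrite big_ord0.
  by apply: le_trans (h t); rewrite lerDl pr_ge0.
have dis A B C : measurable A -> measurable B -> measurable C ->
    A `<=` C -> B `<=` C `&` ~` A -> pr A + pr B <= pr C.
  move=> mA mB mC AC BC; rewrite (pr_split Q mC mA); apply: lerD.
    by apply: (pr_le HQ) => //; [exact: measurableI|move=> X _ AX; split => //; exact: AC].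
  apply: (pr_le HQ) => //; last by move=> X _; exact: BC.
  by apply: measurableI => //; exact: measurableC.
elim=> [|{}t IH].
  rewrite big_ord1 -[leRHS](pr_setT Q); apply: dis => //; first exact: measurable_before.
  by move=> X bX; split => // -[_ X0]; have := bX 0%N isT; rewrite X0 ltxx.
apply: le_trans IH; rewrite big_ord_recr/= -addrA lerD2l.
apply: dis => //; try exact: measurable_before.
  by move=> X [bX _] j jt; exact: bX.
move=> X bX; split; first by move=> j jt; apply: bX; exact: leqW.
by move=> [_ Xt]; have := bX t.+1 (leqnn _); rewrite Xt ltxx.
Qed.

Lemma first_hit_exists X y t : proper X -> 0 < y -> ~ before t y X ->
  exists2 n, (n <= t)%N & first_hit y n X.
Proof.
move=> [X0 step] y0 nb.
have ex : exists n, (n <= t)%N && (y <= X n).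
  apply: contrapT => no; apply: nb => j jt; rewrite ltNge; apply/negP => yj.
  by apply: no; exists j; rewrite jt.
case: (ex_minnP ex) => n /andP[nt yn] minn.
have small j : (j < n)%N -> X j < y.
  move=> jn; rewrite ltNge; apply/negP => yj; have := minn j.
  by rewrite yj andbT (leq_trans (ltnW jn))// => /(_ isT); rewrite leqNgt jn.
exists n => //; split => //.
case: n nt yn small {minn} => [|n] nt yn small; first by move: yn; rewrite X0; lia.
have := small n (leqnn _); have := step n; move: yn.
by move: (X n) (X n.+1) => a b; lia.
Qed.

(** Decomposition according to the first hitting time of y. *)
Lemma after_first_hit y t (C : nat -> set walk) (D : set walk) (c : R) : 0 <= c ->
  measurable D -> (forall n, measurable (C n)) ->
  (forall n, pr (first_hit y n `&` C n) <= pr (first_hit y n) * c) ->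
  (forall X, proper X -> D X -> exists n, [/\ (n <= t)%N, first_hit y n X & C n X]) ->
  pr D <= c.
Proof.
move=> c0 mD mC hC DC.
have mh n := measurable_determined (@determined_first_hit y n).
have mU m : measurable (\big[setU/set0]_(n < m) (first_hit y n `&` C n)).
  by apply: bigsetU_measurable => n _; exact: measurableI.
apply: (@le_trans _ _ (pr (\big[setU/set0]_(n < t.+1) (first_hit y n `&` C n)))).
  apply: (pr_le HQ) => // X pX DX; have [n [nt fX cX]] := DC X pX DX.
  rewrite -(bigcup_mkord t.+1 (fun n => first_hit y n `&` C n)).
  by exists n => //=; rewrite ltnS.
apply: (@le_trans _ _ (\sum_(n < t.+1) pr (first_hit y n `&` C n))).
  elim: t.+1 => [|m IH]; first by rewrite !big_ord0 pr_set0.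
  rewrite !big_ord_recr/=; apply: le_trans (lerD IH (lexx _)).
  have mI : measurable (first_hit y m `&` C m) by exact: measurableI.
  by apply: (pr_leU HQ) => //; exact: measurableU (mU m) mI.
apply: (@le_trans _ _ (\sum_(n < t.+1) pr (first_hit y n) * c)).
  by apply: ler_sum => n _; exact: hC.
by rewrite -mulr_suml ler_piMl// sum_first_hit_le1.
Qed.

Lemma pr_before0 y : 0 < y -> pr (before 0 y) = 1.
Proof.
move=> y0; apply/le_anti/andP; split; first exact: pr_le1 (@measurable_before _ _).
rewrite -[leLHS](pr_setT Q).
apply: (pr_le HQ) => //; first exact: measurable_before.
by move=> X [X0 _] _ j; rewrite leqn0 => /eqP ->; rewrite X0.
Qed.

(** If z + N is not reached by time t + m, then either z + k0 is not reached by
    time t, or the walk stays below z + N for m steps after its first visit to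
    z + k0. *)
Lemma before_delay z (k0 N : nat) (e : R) t m : (0 < k0 <= N)%N -> (0 < m)%N ->
  0 < z + k0%:Z ->
  small_return z k0 e ->
  pr (before (t + m) (z + N%:Z)) <=
  pr (before t (z + k0%:Z)) + (crossing_mean w z k0 (N - k0) / m%:R + e).
Proof.
move=> k0N m0 zk He; have mb t' y := @measurable_before t' y.
have e0 : 0 <= e by have := He 0%N; rewrite big_ord0.
pose D := before (t + m) (z + N%:Z) `&` ~` before t (z + k0%:Z).
have mD : measurable D by apply: measurableI => //; exact: measurableC.
apply: (@le_trans _ _ (pr (before t (z + k0%:Z)) + pr D)).
  apply: (pr_leU HQ) => // X _ bX.
  by have [h|h] := pselect (before t (z + k0%:Z) X); [left|right; split].
rewrite lerD2l; apply: (@after_first_hit (z + k0%:Z) t (below_during (z + N%:Z) m)) => //.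
- by rewrite addr_ge0// divr_ge0 ?crossing_mean_ge0.
- by move=> n; exact: measurable_below_during.
- move=> n; apply: below_during_le => //; first exact: determined_first_hit.
  by move=> X [].
- move=> X pX [bX nb]; have [n nt fX] := first_hit_exists pX zk nb.
  by exists n; split => // j jm; apply: bX; rewrite leq_add.
Qed.

(** To be left of z at time t after a visit to z + k0, the walk must go back. *)
Lemma position_le z (k0 : nat) (e : R) t : (0 < k0)%N -> 0 < z + k0%:Z ->
  small_return z k0 e ->
  pr [set X | X t <= z] <= pr (before t (z + k0%:Z)) + e.
Proof.
move=> k00 zk He; have mb t' y := @measurable_before t' y.
have e0 : 0 <= e by have := He 0%N; rewrite big_ord0.
have mX := measurable_at_most t z.
pose D := [set X : walk | X t <= z] `&` ~` before t (z + k0%:Z).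
have mD : measurable D by apply: measurableI => //; exact: measurableC.
apply: (@le_trans _ _ (pr (before t (z + k0%:Z)) + pr D)).
  apply: (pr_leU HQ) => // X _ bX.
  by have [h|h] := pselect (before t (z + k0%:Z) X); [left|right; split].
rewrite lerD2l; apply: (@after_first_hit (z + k0%:Z) t (backtracks z t)) => //.
- by move=> n; exact: measurable_backtracks.
- move=> n; apply: (@backtrack_le z k0 e n t _ k00 He (@determined_first_hit _ n)).
  by move=> X [].
- move=> X pX [Xt nb]; have [n nt fX] := first_hit_exists pX zk nb.
  by exists n; split => //; exists (t - n)%N; rewrite ?leq_subr// subnKC.
Qed.

Lemma before_tail (k N : nat) (e : R) m : (0 < k)%N -> (0 < N)%N -> (0 < m)%N ->
  small_return (- k%:Z) k e ->
  pr (before m N%:Z) <= crossing_mean w (- k%:Z) k N / m%:R + e.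
Proof.
move=> k0 N0 m0 He.
have := @before_delay (- k%:Z) k (k + N) e 0 m.
have dA : determined 0 (at_time 0 0) by exact: determined_at.
have := @below_during_le (- k%:Z) (k + N) k e 0 m (at_time 0 0).
rewrite k0 leq_addr addKn addNr => /(_ isT m0 He dA (@subset_refl _ _)) h _.
have -> : N%:Z = - k%:Z + (k + N)%:Z by lia.
have c0 : 0 <= crossing_mean w (- k%:Z) k N / m%:R + e.
  rewrite addr_ge0 ?divr_ge0 ?crossing_mean_ge0//.
  by have := He 0%N; rewrite big_ord0.
have {}h := le_trans h (ler_piMl c0 (pr_le1 Q (@measurable_at_time 0 0))).
apply: le_trans h; apply: (pr_le HQ); first exact: measurable_before.
  by apply: measurableI; [exact: measurable_at_time|exact: measurable_below_during].
by move=> X [X0 _] bX; split => // j; exact: bX.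
Qed.

End hitting.

(** * The walk at the median crossing time of a trap *)

Section median_arithmetic.
Variable R : realFieldType.
Implicit Types b c d h p : R.

Fact half_sum h d : h <= 4^-1 -> d <= 8^-1 -> h + d <= 2^-1. Proof. lra. Qed.
Fact half_below p b c d : p - b <= c -> 2^-1 < p -> c <= d -> 2^-1 - d <= b.
Proof. lra. Qed.
Fact half_complement b c : 1 - b <= c -> b <= 2^-1 -> 2^-1 <= c. Proof. lra. Qed.
Fact half_remainder b h d : b <= h + d -> 2^-1 < b -> d <= 8^-1 -> 4^-1 <= h.
Proof. lra. Qed.
Fact half_lower b p d : b <= p -> 2^-1 - d <= b -> 0 < d -> - (4 * d) <= p - 2^-1.
Proof. lra. Qed.
Fact half_upper p b1 b2 b h c d : p <= b1 + d -> b1 <= b2 + (h + d) ->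
  b2 - b <= c -> h <= d -> c <= d -> b <= 2^-1 -> p - 2^-1 <= 4 * d.
Proof. lra. Qed.
Fact three_parts p b h d : p <= b + d -> b <= h + d -> h <= d -> p <= 3 * d.
Proof. lra. Qed.
Fact eighth_half d : d <= 8^-1 -> d <= 2^-1. Proof. lra. Qed.
Fact half_lt1 : (1 <= 2^-1 :> R) = false. Proof. apply/negbTE; lra. Qed.

End median_arithmetic.

Section half.
Context {R : realType} (w : env R) (Q : probability walk R).
Hypothesis HQ : quenched_law w Q.
Hypothesis w_gt0 : forall i, 0 < env_at w i.
Local Notation pr := (pr Q).

(** The distribution function of a hitting time beyond a trap of depth r neither
    jumps at its median nor changes much within a time short compared with r. *)
Lemma before_lipschitz (a K : nat) (r : R) t m : (0 < K)%N -> 0 < r ->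
  r <= resistance w a K 0 ->
  pr (before t (a + K)%:Z) - pr (before (t + m) (a + K)%:Z) <= m%:R / r.
Proof.
move=> K0 r0 rR; elim: m => [|m IH]; first by rewrite addn0 subrr mul0r.
have h := hitting_density HQ w_gt0 a (t + m) K0.
have rV : (resistance w a K 0)^-1 <= r^-1.
  by rewrite lef_pV2 ?posrE// (lt_le_trans r0).
rewrite addnS -natr1 mulrDl mul1r.
have := lerD IH (le_trans h rV); rewrite addrA subrK; exact.
Qed.

(** The time t is the median of the hitting time of y0 = a + K, whose distribution
    function has slope at most 1 / r. Once at y0, the walk needs a time of
    order H, hence at most eta, to reach y1, unless it goes back to u; and from
    y1 it hardly goes back to x1. So at time t it is left of y0 or right of x1
    up to small errors. The bounds around 0 on the scale L serve to show
    that the walk has left a neighbourhood of 0 at time t, and those on the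
    scale n to bound t from above by the crossing mean H0. *)
Lemma quenched_median (a K u y1 x1 n L eta : nat) (r H H0 H1 d : R) :
  (0 < K)%N -> (0 < u < a + K)%N -> (a + K <= y1)%N -> (0 < x1 < y1)%N ->
  (0 < n)%N -> (0 < L)%N -> (0 < eta)%N ->
  0 < d <= 8^-1 -> 0 < r ->
  r <= resistance w a K 0 ->
  small_return w u (a + K - u) d ->
  crossing_mean w u (a + K - u) (y1 - (a + K)) <= H ->
  small_return w (- n%:Z) n d -> crossing_mean w (- n%:Z) n (a + K) <= H0 ->
  small_return w x1 (y1 - x1) d ->
  small_return w (- L%:Z) L d -> crossing_mean w (- L%:Z) L L <= H1 ->
  small_return w 0 L d ->
  H <= d * eta%:R -> eta%:R <= d * r -> H1 <= d * (r / 2) -> 1 <= d * r ->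
  exists t : nat, [/\ (0 < t)%N, r / 2 <= t%:R, t%:R <= 4 * H0 + 1,
    forall x : int, (a + K)%:Z <= x <= x1%:Z ->
      `| pr [set X | X t <= x] - 2^-1 | <= 4 * d &
    forall x : int, x <= 0 -> pr [set X | X t <= x] <= 3 * d].
Proof.
move=> K0 /andP[u0 uK] Ky1 /andP[x10 x1y1] n0 L0 eta0 /andP[d0 d8] r0 rR
  ret_u cross_u ret_n cross_n ret_x ret_L cross_L ret_0 Hd etad H1d rd.
pose y0 := (a + K)%:Z.
have y0p : 0 < y0 by rewrite /y0; clear -K0; lia.
have lip := before_lipschitz _ _ K0 r0 rR.
have H0_ge0 : 0 <= H0 := le_trans (crossing_mean_ge0 _ _ _ _) cross_n.
have tail_n m : (0 < m)%N -> pr (before m y0) <= H0 / m%:R + d.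
  move=> m0; apply: le_trans (before_tail HQ w_gt0 n0 _ m0 ret_n) _; first by rewrite addn_gt0 K0 orbT.
  by rewrite lerD2r ler_wpM2r ?invr_ge0.
have ex : exists t, pr (before t y0) <= 2^-1.
  pose m := (Num.truncn (4 * H0)).+1; exists m; apply: le_trans (tail_n m isT) _.
  have m0 : (0 : R) < m%:R by rewrite ltr0n.
  have : H0 / m%:R <= 4^-1.
    rewrite ler_pdivrMr// -ler_pdivrMl ?invr_gt0// invrK ltW//.
    exact: truncnS_gt.
  by move=> h; exact: half_sum h d8.
case: (ex_minnP ex) => t t_half t_min {ex}.
have t0 : (0 < t)%N.
  rewrite lt0n; apply/negP => /eqP te; move: t_half; rewrite te (pr_before0 HQ)//.
  by rewrite half_lt1.
have before_t : 2^-1 - d <= pr (before t y0).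
  have := lip t.-1 1%N; rewrite addn1 prednK// => h1.
  have h2 : 2^-1 < pr (before t.-1 y0).
    by rewrite ltNge; apply/negP => /t_min; rewrite leqNgt prednK ?leqnn.
  have h3 : 1%:R / r <= d by rewrite ler_pdivrMr.
  exact: half_below h1 h2 h3.
have rt : r / 2 <= t%:R.
  have := lip 0%N t; rewrite add0n (pr_before0 HQ)// => h.
  have : 2^-1 <= t%:R / r := half_complement h t_half.
  by rewrite ler_pdivlMr// mulrC.
exists t; split => //.
- have [t1|t1] := leqP t 1.
    by apply: (@le_trans _ _ 1); rewrite ?ler1n ?lerDr ?mulr_ge0// -[leRHS]/(1%:R) ler_nat.
  have t10 : (0 < t.-1)%N by clear -t1; lia.
  have h := tail_n _ t10.
  have h2 : 2^-1 < pr (before t.-1 y0).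
    by rewrite ltNge; apply/negP => /t_min; rewrite leqNgt prednK ?leqnn.
  have : 4^-1 <= H0 / t.-1%:R := half_remainder h h2 d8.
  rewrite ler_pdivlMr ?ltr0n// => h3.
  have -> : t%:R = t.-1%:R + 1 :> R by rewrite natr1 prednK.
  rewrite lerD2r -ler_pdivrMl//; exact: h3.
- have mX := measurable_at_most t.
  move=> x /andP[x0 xx1].
  have lower : pr (before t y0) <= pr [set X | X t <= x].
    apply: (pr_le HQ) => //; first exact: measurable_before.
    by move=> X _ /(_ t (leqnn _)) /= h; move: h x0; move: (X t) => c; rewrite /y0; clear; lia.
  have upper : pr [set X | X t <= x] <= pr (before t y1) + d.
    apply: (@le_trans _ _ (pr [set X | X t <= x1%:Z])).
      by apply: (pr_le HQ) => // X _ /= h; exact: le_trans h xx1.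
    have := @position_le R w Q HQ w_gt0 x1%:Z (y1 - x1) d t.
    have -> : x1%:Z + (y1 - x1)%N%:Z = y1%:Z by clear -x1y1; lia.
    by apply => //; clear -x10 x1y1; lia.
  have etat : (eta <= t)%N.
    rewrite -(ler_nat R); apply: le_trans etad _; apply: le_trans rt.
    by rewrite mulrC ler_wpM2l ?(ltW r0)// eighth_half.
  have delay : pr (before t y1) <= pr (before (t - eta)%N y0) + (H / eta%:R + d).
    have := @before_delay R w Q HQ w_gt0 u%:Z (a + K - u) (y1 - u) d (t - eta) eta.
    have -> : u%:Z + (y1 - u)%N%:Z = y1%:Z by clear -uK Ky1; lia.
    have -> : u%:Z + (a + K - u)%N%:Z = y0 by rewrite /y0; clear -uK; lia.
    rewrite subnK// => h; apply: (le_trans (h _ _ _ _)) => //.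
      by clear -uK Ky1; lia.
    rewrite lerD2l lerD2r ler_wpM2r ?invr_ge0//.
    by rewrite subnBA ?(ltnW uK)// subnK// ?(leq_trans (ltnW uK)).
  have back := lip (t - eta)%N eta; rewrite subnK// -/y0 in back.
  have he : H / eta%:R <= d by rewrite ler_pdivrMr ?ltr0n.
  have hr : eta%:R / r <= d by rewrite ler_pdivrMr.
  rewrite ler_norml; apply/andP; split.
    exact: half_lower lower before_t d0.
  exact: half_upper upper delay back he hr t_half.
- move=> x x0.
  have mX := measurable_at_most t x.
  have mX0 := measurable_at_most t 0.
  apply: (@le_trans _ _ (pr [set X | X t <= 0])).
    by apply: (pr_le HQ) => // X _ /= h; exact: le_trans h x0.
  have := @position_le R w Q HQ w_gt0 0 L d t; rewrite add0r => h1.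
  have := before_tail HQ w_gt0 L0 L0 t0 ret_L => h2.
  have h3 : crossing_mean w (- L%:Z) L L / t%:R <= d.
    rewrite ler_pdivrMr ?ltr0n//; apply: (le_trans cross_L); apply: (le_trans H1d).
    by rewrite ler_wpM2l ?(ltW d0).
  have {}h1 := h1 L0 _ ret_0.
  have {}h1 : pr [set X | X t <= 0] <= pr (before t L) + d by apply: h1; clear -L0; lia.
  exact: three_parts h1 h2 h3.
Qed.

End half.

(** * Moments of the odds *)

Section standing_assumptions.
Context {R : realType} (P : probability (env R) R).
Hypothesis iidP : iid_product P.
Variable s : R.
Hypothesis s0 : 0 < s.
Hypothesis Hlog : (\int[P]_w lne (rho w 0) < 0)%E.
Hypothesis Hs : (\int[P]_w poweR (rho w 0) s = 1)%E.
Hypothesis Hslog : (\int[P]_w (poweR (rho w 0) s * lne (rho w 0)) < +oo)%E.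
Implicit Types (w : env R).

Let rhoE w : rho w 0 = if env_at w 0 == 0 then +oo%E else (odds w 0)%:E.
Proof.
rewrite /rho inver; case: ifPn => [/eqP ->|_]; last by rewrite -EFinM.
by rewrite subr0 mul1e.
Qed.

Let poweE w : poweR (rho w 0) s =
  if env_at w 0 == 0 then +oo%E else (odds w 0 `^ s)%:E.
Proof. by rewrite rhoE; case: ifP => _ //=; rewrite gt_eqF. Qed.

Let lneE w : lne (rho w 0) =
  if env_at w 0 == 0 then +oo%E else if odds w 0 == 0 then -oo%E else (ln (odds w 0))%:E.
Proof.
rewrite rhoE; case: ifP => _ //=; rewrite -[odds w 0 == 0]orbF.
by rewrite le_eqVlt ltNge odds_ge0.
Qed.

Let measurable_env0 : measurable_fun [set: env R] (fun w => env_at w 0 == 0).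
Proof. by apply: measurable_fun_eqr => //; exact: measurable_env_at. Qed.

Let measurable_odds0 : measurable_fun [set: env R] (fun w => odds w 0).
Proof. exact: obs_measurable (@obs_odds R setT 0 I). Qed.

Let measurable_powe : measurable_fun [set: env R] (fun w => poweR (rho w 0) s).
Proof.
under [X in measurable_fun _ X]eq_fun do rewrite poweE.
apply: measurable_fun_ifT => //; apply/measurable_EFinP.
exact: measurableT_comp (measurable_powR s) measurable_odds0.
Qed.

Let measurable_lne_rho : measurable_fun [set: env R] (fun w => lne (rho w 0)).
Proof.
under [X in measurable_fun _ X]eq_fun do rewrite lneE.
apply: measurable_fun_ifT => //; apply: measurable_fun_ifT => //.
  exact: measurable_fun_eqr.
apply/measurable_EFinP; exact: (measurableT_comp (@measurable_ln R) measurable_odds0).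
Qed.

Let env0 (i : int) : set (env R) := [set w | env_at w i = 0].

Let measurable_env0_set i : measurable (env0 i).
Proof.
have := measurable_env_at (R := R) i measurableT (measurable_set1 0).
by rewrite setTI.
Qed.

(* On this event rho is +oo, which the finite moment of order s excludes. *)
Let env00_null : P (env0 0) = 0%E.
Proof.
have mA := measurable_env0_set 0.
have le n : (n%:R%:E * P (env0 0) <= 1)%E.
  rewrite -Hs -integral_cst//; apply: (@le_trans _ _ (\int[P]_(w in env0 0) poweR (rho w 0) s)%E).
    apply: ge0_le_integral => //.
    - by move=> w _; rewrite lee_fin.
    - exact: measurable_funTS.
    - by move=> w h; rewrite poweE h eqxx leey.
  by apply: ge0_subset_integral => // w _; exact: poweR_ge0.
have PE : P (env0 0) = (fine (P (env0 0)))%:E by rewrite fineK// fin_num_measure.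
have p0 : 0 <= fine (P (env0 0)) by exact: fine_ge0.
rewrite PE; congr EFin; apply/le_anti; rewrite p0 andbT leNgt; apply/negP => pos.
have := le (Num.truncn (fine (P (env0 0)))^-1).+1; rewrite PE -EFinM lee_fin.
by rewrite -ler_pdivlMr// mul1r leNgt truncnS_gt.
Qed.

Lemma env_gt0_ae : P.-negligible (~` [set w | forall i, 0 < env_at w i]).
Proof.
have [mu muP] := iidP.
have null i : P (env0 i) = 0%E.
  rewrite -env00_null.
  have h j : P (env0 j) = mu [set 0].
    have := muP [:: j] (fun=> [set 0]) isT (fun=> measurable_set1 0).
    rewrite big_seq1 => <-; congr (P _); apply/seteqP; split => w /=.
      by move=> h k; rewrite inE => /eqP ->.
    by apply; rewrite inE.
  by rewrite !h.
pose F m := if @pickle_inv int m is Some i then env0 i else set0.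
have negF : P.-negligible (\bigcup_m F m).
  apply: negligible_bigcup => m; rewrite /F; case: pickle_inv => [i|].
    by apply/negligibleP; [exact: measurable_env0_set|exact: null].
  exact: negligible_set0.
apply: (negligibleS _ negF) => w nw; apply: contrapT => h; apply: nw => i.
have /andP[w0 _] := env_at01 w i; rewrite lt_def w0 andbT; apply/negP => /eqP wi.
by apply: h; exists (pickle i); [exact: I|rewrite /F pickleK_inv].
Qed.

Let ae_env0 (T : Type) (f g : env R -> T) : (forall w, env_at w 0 != 0 -> f w = g w) ->
  ae_eq P setT f g.
Proof.
move=> fg; exists (env0 0); split => // w; apply: contra_notP => /eqP h _.
exact: fg.
Qed.

Lemma odds_moment_s : L1 P [set 0] (fun w => odds w 0 `^ s) /\
  E P (fun w => odds w 0 `^ s) = 1.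
Proof.
have o : obs [set 0] (fun w => odds w 0 `^ s) by apply: obs_pow; exact: obs_odds.
have m1 : mean P (fun w => odds w 0 `^ s) = 1%E.
  rewrite -Hs; apply: ge0_ae_eq_integral => //.
  - by apply/measurable_EFinP; exact: obs_measurable o.
  - by move=> w _; rewrite lee_fin powR_ge0.
  - by move=> w _; exact: poweR_ge0.
  - by apply: ae_env0 => w w0; rewrite poweE (negbTE w0).
by split; [split; rewrite ?m1 ?ltry|rewrite /E m1].
Qed.

Let L1s := proj1 odds_moment_s.
Let E1s := proj2 odds_moment_s.

Let powR_half (u : R) : u `^ s = u `^ (s / 2) * u `^ (s / 2).
Proof.
by rewrite -{1}(mulr1 s) -{1}(@mulVf _ 2)// mulrA powRrM powR_mulrn ?powR_ge0// expr2.
Qed.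

Let half_le (u : R) : 0 <= u -> u `^ (s / 2) <= 1 + u `^ s.
Proof.
move=> u0; rewrite powR_half; have := sqr_ge0 (u `^ (s / 2) - 1); rewrite expr2; have := powR_ge0 u (s / 2).
move: (u `^ (s / 2)) => v; nra.
Qed.

Lemma odds_moment_half : L1 P [set 0] (fun w => odds w 0 `^ (s / 2)).
Proof.
have o : obs [set 0] (fun w => odds w 0 `^ (s / 2)) by apply: obs_pow; exact: obs_odds.
apply: (L1_le o (L1D (L1_cst P [set 0] ler01) L1s)) => w.
by apply: half_le; exact: odds_ge0.
Qed.

(** By the inequality between the geometric and arithmetic means the moment of
    order s/2 is at most 1; equality would force rho = 1 almost surely, and the
    mean of its logarithm to vanish. *)
Lemma odds_moment_half_lt1 : E P (fun w => odds w 0 `^ (s / 2)) < 1.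
Proof.
have Lh := odds_moment_half.
rewrite ltNge; apply/negP => Eh.
pose f w := (odds w 0 `^ (s / 2) - 1) ^+ 2.
have o : obs [set 0] f.
  split; last by move=> w; exact: sqr_ge0.
  apply: measurable_funX; apply: measurable_funB; last exact: measurable_cst.
  by have [[]] := Lh.
have Lsum := L1D (L1_cst P [set 0] ler01) L1s.
have f_eq w : f w + 2 * odds w 0 `^ (s / 2) = 1 + odds w 0 `^ s.
  by rewrite powR_half /f expr2; ring.
have Lf : L1 P [set 0] f.
  apply: (L1_le o Lsum) => w; rewrite -f_eq lerDl mulr_ge0 ?powR_ge0//.
have Ef : E P f = 0.
  have := ED Lf (L1Z (ler0n R 2) Lh); rewrite (EZ (ler0n R 2) Lh).
  rewrite (_ : (fun w => f w + 2 * odds w 0 `^ (s / 2)) = fun w => 1 + odds w 0 `^ s); last first.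
    by apply/funext => w; exact: f_eq.
  rewrite (ED (L1_cst P [set 0] ler01) L1s) E_cst E1s => h.
  have f0 : 0 <= E P f by apply: E_ge0 => w; exact: sqr_ge0.
  apply/le_anti; rewrite f0 andbT; move: h Eh; lra.
have ae1 : ae_eq P setT (fun w => (f w)%:E) (cst 0%E).
  apply/ae_eq_integral_abs => //.
    by apply/measurable_EFinP; exact: obs_measurable o.
  rewrite -[RHS]/(0%:E) -Ef -(L1E Lf); apply: eq_integral => w _.
  by rewrite gee0_abs// lee_fin sqr_ge0.
have lne0 : (\int[P]_w lne (rho w 0) = 0)%E.
  rewrite (@ae_eq_integral _ _ _ P setT (cst 0%E))//; first by rewrite integral0.
  have [N1 [mN1 N10 h1]] := ae1.
  exists (N1 `|` env0 0); split; first exact: measurableU.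
    by rewrite measureU0.
  move=> w; apply: contra_notP => /not_orP[nN1 nw0] _.
  have {nN1} fw : f w = 0.
    by apply: contrapT => fw; apply: nN1; apply: h1 => /(_ I) [].
  have /eqP w0 : env_at w 0 != 0 by apply/eqP.
  have o1 : odds w 0 = 1.
    move: fw; rewrite /f => /eqP; rewrite sqrf_eq0 subr_eq0 => /eqP hp.
    apply: (@powR_injective R (s / 2)); rewrite ?divr_gt0// ?nnegrE ?odds_ge0//.
    by rewrite hp powR1.
  rewrite lneE o1 oner_eq0 ln1 ifF//; exact/eqP.
by move: Hlog; rewrite lne0 ltxx.
Qed.

(* The negative part of rho^s log rho is bounded, so that the hypothesis bounds
   its positive part. *)
Let plog (u : R) := u `^ s * Num.max (ln u) 0.

Let obs_plog : obs [set 0] (fun w => plog (odds w 0)).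
Proof.
split; last by move=> w; rewrite mulr_ge0 ?powR_ge0// le_max lexx orbT.
apply: measurable_funM; first by have [[]] := L1s.
apply: measurable_maxr; last exact: measurable_cst.
have [d0 _] := @obs_odds R [set 0] 0 erefl.
exact: (measurableT_comp (@measurable_ln R) d0).
Qed.

Let L1_plog : L1 P [set 0] (fun w => plog (odds w 0)).
Proof.
split; first exact: obs_plog.
pose F w := (poweR (rho w 0) s * lne (rho w 0))%E.
have mF : measurable_fun setT F by exact: emeasurable_funM.
have FE w : env_at w 0 != 0 -> F w = (odds w 0 `^ s * ln (odds w 0))%:E.
  move=> w0; rewrite /F poweE lneE (negbTE w0); case: ifPn => [/eqP ->|_].
    by rewrite powR0 ?gt_eqF// mul0e mul0r.
  by rewrite -EFinM.
have neg_le (u : R) : 0 <= u -> - (u `^ s * ln u) <= s^-1.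
  rewrite le_eqVlt => /predU1P[<-|u0]; first by rewrite powR0 ?gt_eqF// mul0r oppr0 invr_ge0 ltW.
  have us : 0 < u `^ s by rewrite powR_gt0.
  have : ln (u `^ (- s)) <= u `^ (- s) by apply/ltW/ln_sublinear; rewrite powR_gt0.
  rewrite ln_powR powRN => h.
  have c0 : 0 <= u `^ s * s^-1 by rewrite mulr_ge0 ?(ltW us)// invr_ge0 ltW.
  have := ler_wpM2l c0 h; congr (_ <= _); field.
    by rewrite gt_eqF.
  by rewrite !gt_eqF.
have mneg : measurable_fun setT
    (fun w => Num.max (- (odds w 0 `^ s * ln (odds w 0))) 0).
  apply: measurable_maxr => //; apply: measurableT_comp => //.
  apply: measurable_funM; first exact: obs_measurable (L1_obs L1s).
  exact: (measurableT_comp (@measurable_ln R) measurable_odds0).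
have neg : (\int[P]_w F^\- w <= (s^-1)%:E)%E.
  rewrite (@ge0_ae_eq_integral _ _ _ P setT _ (fun w => (Num.max (- (odds w 0 `^ s * ln (odds w 0))) 0)%:E))//.
  - apply: (@le_trans _ _ (\int[P]_w (s^-1)%:E)%E); last first.
      by rewrite -/(mean P (fun=> s^-1)) mean_cst.
    apply: ge0_le_integral => //.
    + by move=> w _; rewrite lee_fin le_max lexx orbT.
    + by apply/measurable_EFinP.
    + by move=> w _; rewrite lee_fin ge_max neg_le ?odds_ge0//= invr_ge0 ltW.
  - exact: measurable_funeneg.
  - by apply/measurable_EFinP.
  - by move=> w _; rewrite lee_fin le_max lexx orbT.
  - by apply: ae_env0 => w w0; rewrite funenegE FE// -EFinN EFin_max.
have pos : (\int[P]_w F^\+ w < +oo)%E.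
  move: Hslog; rewrite -/F integralE -/F => h.
  have negfin : (\int[P]_w F^\- w)%E \is a fin_num.
    rewrite ge0_fin_numE; first exact: le_lt_trans neg (ltry _).
    by apply: integral_ge0 => w _; exact: funeneg_ge0.
  by move: h; rewrite lteBlDr// => /lt_le_trans; apply; exact: leey.
rewrite /mean (@ge0_ae_eq_integral _ _ _ P setT _ (F^\+)%E)//.
- by apply/measurable_EFinP; exact: obs_measurable obs_plog.
- exact: measurable_funepos.
- by move=> w _; rewrite lee_fin; exact: (obs_ge0 obs_plog).
- apply: ae_env0 => w w0; rewrite funeposE FE// -[0%E]/(0%:E) -EFin_max /plog.
  by rewrite maxr_pMr ?powR_ge0// mulr0.
Qed.

(* The number of dyadic levels below u is logarithmic in u; this is how the moment
   with the logarithm controls the overshoot. *)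
Let count_dyadic (u : R) n :
  \sum_(i < n) ((2 ^+ i < u)%R%:R : R) <= 1 + Num.max (ln u) 0 / ln 2.
Proof.
have ln2 : 0 < ln (2 : R) by rewrite ln_gt0 ?ltr1n.
elim: n => [|n IH].
  by rewrite big_ord0 addr_ge0// divr_ge0 ?(ltW ln2)// le_max lexx orbT.
have [nu|nu] := boolP (2 ^+ n < u); last first.
  by rewrite big_ord_recr/= (negbTE nu) addr0.
apply: (@le_trans _ _ (n.+1%:R)).
  rewrite -[X in _ <= X%:R]card_ord -sumr_const; apply: ler_sum => i _.
  by rewrite lern1 leq_b1.
rewrite -natr1 addrC lerD2l ler_pdivlMr//.
have u0 : 0 < u by apply: lt_trans nu; rewrite exprn_gt0.
rewrite le_max mulr_natl -lnXn// ler_ln ?posrE ?exprn_gt0//.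
by rewrite (ltW nu).
Qed.

Lemma bounded_series_tail (b : nat -> R) (c e : R) : (forall i, 0 <= b i) ->
  (forall n, \sum_(i < n) b i <= c) -> 0 < e ->
  exists l, forall n, \sum_(i < n) b (l + i)%N <= e.
Proof.
move=> b0 bc e0.
pose S := [set \sum_(i < n) b i | n in setT].
have supS : has_sup S.
  split; first by exists (\sum_(i < 0) b i), 0%N.
  by exists c => _ [n _ <-]; exact: bc.
have [_ [l _ <-] hl] := sup_adherent e0 supS.
exists l => n; have : \sum_(i < l + n) b i <= sup S.
  by apply: ub_le_sup; [case: supS|exists (l + n)%N].
rewrite big_split_ord/=; move: hl.
set x := \sum_(i < l) b i; set y := \sum_(i < n) _; set z := sup S.
lra.
Qed.

(** Summing over i the part of the moment due to odds above 2^i gives at most the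
    mean of rho^s (1 + log_2^+ rho), which is finite; so the tails of the series
    vanish. *)
Lemma overshoot_tail (e : R) : 0 < e ->
  exists l, forall n, \sum_(i < n) E P (fun w => big_odds s (l + i) w 0) <= e.
Proof.
move=> e0; have ln2 : 0 < ln (2 : R) by rewrite ln_gt0 ?ltr1n.
have il : 0 <= (ln 2)^-1 :> R by rewrite invr_ge0 ltW.
have Lsum := L1D L1s (L1Z il L1_plog).
apply: (@bounded_series_tail (fun i => E P (fun w => big_odds s i w 0)) (E P (fun w => odds w 0 `^ s + (ln 2)^-1 * plog (odds w 0))) e _ _ e0) => [i|n].
  by apply: E_ge0 => w; rewrite /big_odds mulr_ge0 ?powR_ge0.
have Lbs (i : 'I_n) := L1_big_odds iidP L1s i 0.
rewrite -(E_sum _ Lbs); apply: (E_le (L1_obs (L1_sum _ Lbs)) Lsum) => w.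
rewrite /big_odds -mulr_sumr /plog.
apply: le_trans (ler_wpM2l (powR_ge0 _ _) (count_dyadic (odds w 0) n)) _.
by rewrite le_eqVlt; apply/orP; left; apply/eqP; ring.
Qed.

End standing_assumptions.

(** * Favourable scales *)

Section scales.

Lemma scaleS k : scale k.+1 = (scale k * scale k)%N.
Proof. by rewrite /scale expnS mul2n -addnn expnD. Qed.

Lemma scale_gt k : (k < scale k)%N.
Proof. by rewrite /scale (ltn_trans (ltn_expl k (leqnn 2)))// ltn_expl. Qed.

Lemma scale_gt0 k : (0 < scale k)%N. Proof. exact: leq_ltn_trans (scale_gt k). Qed.

Lemma leq_scale : {homo scale : i j / (i <= j)%N}.
Proof. by move=> i j ij; rewrite /scale !leq_exp2l. Qed.

Lemma sqr_le_scale k : (k * k <= scale k)%N.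
Proof. by case: k => [//|k]; rewrite scaleS leq_mul// scale_gt. Qed.

Lemma rightward_stretch z m : stretch (rightward z) 0 m `<=` sites z (z + m%:Z).
Proof. by move=> _ [j /andP[_ jm] ->]; rewrite /rightward /sites/=; lia. Qed.

Lemma Pi_rightward {R : realType} (z : int) (i l : nat) (w : env R) :
  Pi (rightward (z + i%:Z)) 0 l w = Pi (rightward z) i (i + l) w.
Proof.
rewrite /Pi -{2}[i]add0n big_addn addKn; apply: eq_bigr => j _.
by congr (odds w _); rewrite /rightward; lia.
Qed.

Variable D : nat.

(** Scale k uses the sites from block k to block k + 1, that is to 2Dn, with the
    trap region up to bottom, about n / (2D). *)
Definition block (k : nat) : int := (2 * D * scale k.-1)%N%:Z.
Definition bottom (k : nat) : nat := (scale k %/ (2 * D))%N.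
Definition width (k : nat) : nat := (scale k %/ (8 * D))%N.

Lemma block_mono : {homo block : i j / (i <= j)%N >-> i <= j}.
Proof.
move=> i j ij; rewrite /block lez_nat leq_mul2l; apply/orP; right.
by apply: leq_scale; rewrite -!subn1 leq_sub2r.
Qed.

(** The traps of scale k start to the right of the sites used by the earlier
    scales, at a distance at most width, and end before bottom, since the
    previous scale is the square root of the present one. *)
Lemma window_fits : (0 < D)%N -> exists K, forall k, (K <= k)%N ->
  [/\ (0 < k)%N, (8 * D <= scale k)%N &
      (2 * D * scale k.-1 + 2 * width k < bottom k)%N].
Proof.
move=> D0; exists (16 * D * D).+1 => -[//|k]; rewrite ltnS => Kk.
have kn : (16 * D * D <= scale k)%N by rewrite (leq_trans Kk)// ltnW// scale_gt.
have n8 : (8 * D <= scale k.+1)%N.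
  rewrite scaleS; apply: (@leq_trans (scale k)); last by rewrite leq_pmulr// scale_gt0.
  by apply: leq_trans kn; rewrite -mulnA leq_mul// leq_pmulr.
split => //=.
have h1 : (2 * D * scale k <= width k.+1)%N.
  rewrite /width leq_divRL ?muln_gt0//= scaleS mulnAC leq_mul//.
  by apply: leq_trans kn; lia.
have h2 : (4 * width k.+1 <= bottom k.+1)%N.
  rewrite /bottom leq_divRL ?muln_gt0//=.
  have -> : (4 * width k.+1 * (2 * D) = width k.+1 * (8 * D))%N by lia.
  exact: leq_trunc_div.
have h3 : (0 < width k.+1)%N by rewrite divn_gt0 ?muln_gt0.
by move: h1 h2 h3; lia.
Qed.

Lemma width_large (N : nat) : (0 < D)%N ->
  exists K, forall k, (K <= k)%N -> (N <= width k)%N.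
Proof.
move=> D0; exists (N * (8 * D))%N => k Kk; rewrite leq_divRL ?muln_gt0//.
by rewrite (leq_trans Kk)// ltnW// scale_gt.
Qed.

Lemma bottom_large (N : nat) : (0 < D)%N ->
  exists K, forall k, (K <= k)%N -> (N <= bottom k)%N.
Proof.
move=> D0; have [K hK] := width_large N D0; exists K => k /hK Nw.
by rewrite (leq_trans Nw)// leq_div2l ?muln_gt0// leq_mul2r orbT.
Qed.

Lemma scale_lt_width k : (0 < D)%N -> (scale k < 8 * D * (width k).+1)%N.
Proof. by move=> D0; rewrite mulnC -ltn_divLR ?muln_gt0. Qed.

Lemma bottom_le k : (2 * bottom k * D <= scale k)%N.
Proof.
have := leq_trunc_div (scale k) (2 * D); rewrite -/(bottom k).
by apply: leq_trans; lia.
Qed.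

End scales.

Fact saturating_mono {R : realFieldType} (c a b B : R) :
  0 < c -> 0 <= B -> 0 < a -> a <= b -> c * a / (2 * (a + B)) <= c * b / (2 * (b + B)).
Proof.
move=> c0 B0 a0 ab; have b0 := lt_le_trans a0 ab.
rewrite ler_pdivrMr ?mulr_gt0 ?ltr_pwDl// [leRHS]mulrAC ler_pdivlMr ?mulr_gt0 ?ltr_pwDl//.
have h : c * (a * B) <= c * (b * B) by rewrite ler_wpM2l ?(ltW c0)// ler_wpM2r.
by lra.
Qed.

Fact scale_half {R : realFieldType} (D x y : R) :
  8 <= D -> 0 < x -> 4 * D * x <= y -> x <= y / 2.
Proof. nra. Qed.

Fact scale_unit {R : realFieldType} (D x : R) :
  0 <= x -> 8 <= D -> 4 * D * x <= 1 -> x <= 1.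
Proof. nra. Qed.

Section scale_arithmetic.
Variable R : realFieldType.
Implicit Types D n x y e : R.

Fact mild_ge1 D n x : 8 <= D -> 1 <= n -> 4 * D * n <= x -> 1 <= x. Proof. nra. Qed.
Fact eta_small D e x : x * D <= e <= x * D + 1 -> 8 * x <= D * x -> 1 <= x ->
  e <= 2 * D * x.
Proof. by move=> /andP[_ h]; lra. Qed.
Fact half_deep D x : 8 * x <= D * x -> 0 < x -> x <= 2 * D * x / 2. Proof. lra. Qed.
Fact double_deep D x : 8 * x <= D * x -> 1 <= x -> 1 <= 2 * D * x. Proof. lra. Qed.
Fact twice_scaled D x : 8 <= D -> 0 < x -> x <= D * (D * x).
Proof. by move=> h1 h2; have : x <= D * x; nra. Qed.

End scale_arithmetic.

Section trap_scale.
Context {R : realType} (P : probability (env R) R).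
Hypothesis iidP : iid_product P.
Variables (s q : R).
Hypotheses (s0 : 0 < s) (s1 : s < 1).
Hypothesis L1s : L1 P [set 0] (fun w => odds w 0 `^ s).
Hypothesis E1s : E P (fun w => odds w 0 `^ s) = 1.
Hypothesis L1h : L1 P [set 0] (fun w => odds w 0 `^ (s / 2)).
Hypothesis Eqh : E P (fun w => odds w 0 `^ (s / 2)) = q.
Hypothesis q1 : q < 1.
Hypothesis tails : forall e : R, 0 < e ->
  exists l, forall n, \sum_(i < n) E P (fun w => big_odds s (l + i) w 0) <= e.

Let q0 : 0 <= q.
Proof. by rewrite -Eqh; apply: E_ge0 => w; exact: powR_ge0. Qed.

(* The precision 1/D is fixed throughout; D goes to infinity at the end. *)
Variable D : nat.
Hypothesis D8 : (8 <= D)%N.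

Let D0 : (0 < D)%N. Proof. exact: leq_trans D8. Qed.

Let C := min_const s q.
(** The constant makes the crossing from n/D to 2Dn take a mean time above mild
    with probability at most 1/2, by [crossing_mean_tail], and makes mild exceed
    the number of sites to cross. *)
Definition typical : R := 4 * D%:R + 4 * (4 * D%:R * C) `^ s^-1.
Definition mild (k : nat) : R := typical * (scale k)%:R `^ s^-1.
Definition deep (k : nat) : R := 2 * D%:R ^+ 2 * mild k.
Definition generous (k : nat) : R := (scale k)%:R `^ (s^-1 + D%:R^-1).

(** The trap is 2 D^2 times deeper than the bound that the crossing beyond it
    satisfies. *)
Definition favourable (k : nat) (w : env R) : R :=
  trap (rightward (block D k)) (deep k) (width D k) (width D k) w *
  (crossing_mean w (bottom D k)%:Z (bottom D k) (2 * D * scale k - 2 * bottom D k) <= mild k)%R%:R.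

(** The first event bounds the median from above, the second one shows that k
    sites around 0 are left quickly, and the others bound the backtracking
    at the places where the analysis of the walk needs it. *)
Definition atypical (k : nat) : set (env R) :=
  [set w | generous k < crossing_mean w (- (scale k)%:Z) (scale k) (2 * bottom D k)] `|`
  ([set w | mild k < crossing_mean w (- k%:Z) k k] `|`
  (steep s q (- (scale k)%:Z) (scale k) `|`
  (steep s q (bottom D k)%:Z (bottom D k) `|`
  (steep s q (D * scale k)%N%:Z (D * scale k) `|`
  (steep s q (- k%:Z) k `|` steep s q 0 k))))).

Let n_ k : R := (scale k)%:R.

Let n0 k : 0 < n_ k. Proof. by rewrite ltr0n scale_gt0. Qed.
Let n1 k : 1 <= n_ k. Proof. by rewrite ler1n scale_gt0. Qed.

Let Dr : (8 : R) <= D%:R. Proof. by rewrite ler_nat. Qed.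
Let Dr0 : (0 : R) < D%:R. Proof. by rewrite ltr0n. Qed.

Let C0 : 0 < C.
Proof.
apply: ltr_pwDr => //; apply: divr_ge0; last first.
  rewrite subr_ge0 -[leRHS](powRr0 2^-1); apply: ger_powR; last by rewrite subr_ge0 ltW.
  by rewrite invr_gt0 ltr0n invf_le1// ler1n.
by rewrite divr_ge0// subr_ge0 ltW.
Qed.

Let powns k : (n_ k `^ s^-1) `^ (- s) = (n_ k)^-1.
Proof. by rewrite -powRrM mulrN mulVf ?gt_eqF// powR_inv1// ltW. Qed.

Lemma scale_le_pow k : n_ k <= n_ k `^ s^-1.
Proof. by rewrite le1r_powR// invf_ge1// ltW. Qed.

Let typical_ge : 4 * D%:R <= typical. Proof. by rewrite lerDl mulr_ge0 ?powR_ge0. Qed.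
Let typical0 : 0 < typical.
Proof. by apply: lt_le_trans typical_ge; rewrite mulr_gt0. Qed.

Let typical4 : 4 * D%:R * C * (typical / 4) `^ (- s) <= 1.
Proof.
have DC : 0 < 4 * D%:R * C by apply: mulr_gt0; rewrite ?C0// mulr_gt0.
rewrite powRN ler_pdivrMr ?powR_gt0 ?divr_gt0// mul1r.
have : (4 * D%:R * C) `^ s^-1 <= typical / 4.
  rewrite ler_pdivlMr// mulrC lerDr mulr_ge0//.
move=> /(ge0_ler_powR (ltW s0)) -/(_ _ _)/=; rewrite !nnegrE powR_ge0 divr_ge0 ?(ltW typical0)//.
move=> /(_ isT isT); rewrite -powRrM mulVf ?gt_eqF// powRr1//.
exact: ltW.
Qed.

Let typical_ge1 : 1 <= typical.
Proof. by apply: le_trans typical_ge; move: Dr; move: (D%:R : R) => x; lra. Qed.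

Lemma mild_gt0 k : 0 < mild k.
Proof. by rewrite mulr_gt0// powR_gt0// n0. Qed.

Lemma mild_pow k : (mild k / 4) `^ (- s) = (typical / 4) `^ (- s) / n_ k.
Proof.
have t4 : 0 <= typical / 4 by rewrite divr_ge0// ltW.
by rewrite /mild mulrAC (powRM _ t4 (powR_ge0 _ _)) -/(n_ k) powns.
Qed.

Lemma scale_le_mild k : 4 * D%:R * n_ k <= mild k.
Proof. by apply: ler_pM; rewrite ?mulr_ge0 ?ler0n// scale_le_pow. Qed.

Lemma deep_ge1 k : 1 <= deep k.
Proof.
rewrite /deep; apply: (@le_trans _ _ (1 * (4 * D%:R * n_ k))).
  rewrite mul1r; apply: (@le_trans _ _ (4 * D%:R * 1)); last by rewrite ler_wpM2l// mulr_ge0.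
  by rewrite mulr1; move: Dr; move: (D%:R : R) => x; lra.
apply: ler_pM => //; rewrite ?mulr_ge0 ?ler0n//; last exact: scale_le_mild.
have := Dr; move: (D%:R : R) => x hx; nra.
Qed.

Lemma deep_pow k : deep k `^ (- s) = (2 * D%:R ^+ 2 * typical) `^ (- s) / n_ k.
Proof.
have t4 : 0 <= 2 * D%:R ^+ 2 * typical.
  by apply: mulr_ge0; [rewrite mulr_ge0// exprn_ge0|exact: ltW].
by rewrite /deep /mild mulrA (powRM _ t4 (powR_ge0 _ _)) -/(n_ k) powns.
Qed.

Lemma favourable_factors : exists K, forall k, (K <= k)%N ->
  let T := trap (rightward (block D k)) (deep k) (width D k) (width D k) in
  let S := fun w => (crossing_mean w (bottom D k)%:Z (bottom D k)
    (2 * D * scale k - 2 * bottom D k) <= mild k)%R%:R in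
  [/\ obs (sites (block D k) (bottom D k)%:Z) T,
      obs (sites (bottom D k)%:Z (block D k.+1)) S,
      (block D k <= (bottom D k)%:Z <= block D k.+1) & 2^-1 <= E P S].
Proof.
have [K hK] := window_fits D0; exists K => k Kk T S.
have [k0 n8 fit] := hK k Kk.
have bn : (2 * bottom D k <= 2 * D * scale k)%N.
  apply: (@leq_trans (scale k)); last by rewrite leq_pmull// muln_gt0.
  by apply: leq_trans (bottom_le D k); rewrite leq_pmulr.
have deep0 : 0 <= deep k by rewrite (le_trans _ (deep_ge1 k)).
have oT : obs (sites (block D k) (bottom D k)%:Z) T.
  apply: obs_sub (obs_trap P _ _ _ deep0) => i /rightward_stretch.
  by rewrite /sites /block/=; clear -fit; lia.
have oS : obs (sites (bottom D k)%:Z (block D k.+1)) S.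
  apply: obs_le; last exact: obs_cst (ltW (mild_gt0 k)).
  apply: obs_sub (obs_crossing_mean _ _ _) => i.
  by rewrite /sites /block/=; clear -bn; lia.
split => //.
  by rewrite /block/=; apply/andP; split; clear -fit bn; lia.
set m := (2 * D * scale k - 2 * bottom D k)%N.
have m_le : m%:R <= 2 * D%:R * n_ k.
  by rewrite -!natrM ler_nat leq_subr.
have mild_m : m%:R <= mild k / 2.
  by have := scale_le_mild k; move: m_le; rewrite -mulrA; lra.
have := crossing_mean_tail iidP s0 s1 L1s E1s L1h Eqh q1 (bottom D k)%:Z (bottom D k) (mild_gt0 k) mild_m.
rewrite mild_pow => tail.
have -> : S = fun w => 1 - (mild k < crossing_mean w (bottom D k)%:Z (bottom D k) m)%R%:R.
  by apply/funext => w; rewrite /S ltNge; case: (_ <= _); rewrite /= ?subr0 ?subrr.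
rewrite (E_complement P (obs_lt (obs_cst _ (ltW (mild_gt0 k))) (obs_crossing_mean _ _ _))); last first.
  by move=> w; rewrite lern1 leq_b1.
have : m%:R * (C * ((typical / 4) `^ (- s) / n_ k)) <= 2^-1.
  apply: (@le_trans _ _ (2 * D%:R * n_ k * (C * ((typical / 4) `^ (- s) / n_ k)))).
    by rewrite ler_wpM2r// mulr_ge0 ?(ltW C0)// divr_ge0 ?powR_ge0// ltW.
  have -> : 2 * D%:R * n_ k * (C * ((typical / 4) `^ (- s) / n_ k)) =
     (4 * D%:R * C * (typical / 4) `^ (- s)) / 2.
    by field; rewrite gt_eqF// n0.
  by rewrite -[leRHS]mul1r ler_wpM2r ?invr_ge0// typical4.
by move: tail; rewrite -/C; move: (E P _) (m%:R * _) => a b; lra.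
Qed.

(** The decay q^j splits into two halves, sqrt(q)^j each; the first one
    compensates j + 1. *)
Lemma geometric_beats_linear (c : R) : exists N, forall j, (N <= j)%N ->
  c * j.+1%:R * q ^+ j <= 4^-1.
Proof.
pose r := Num.sqrt q; have r0 : 0 <= r := sqrtr_ge0 q.
have r1 : r < 1 by rewrite -sqrtr1 ltr_sqrt.
have rr j : q ^+ j = r ^+ j * r ^+ j by rewrite -exprMn -expr2 sqr_sqrtr.
have jr j : j.+1%:R * r ^+ j <= (1 - r)^-1.
  apply: le_trans (@sum_geometric_le R r j.+1 _); last by rewrite r0.
  have -> : j.+1%:R * r ^+ j = \sum_(i < j.+1) r ^+ j by rewrite sumr_const card_ord mulr_natl.
  apply: ler_sum => i _.
  by rewrite ler_wiXn2l ?(ltW r1)// -ltnS.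
have c'0 : 0 < (4 * (`|c| * (1 - r)^-1 + 1))^-1.
  by rewrite invr_gt0 mulr_gt0// ltr_wpDl// mulr_ge0// invr_ge0 subr_ge0 ltW.
have : r ^+ n @[n --> \oo] --> 0 by apply: cvg_expr; rewrite ger0_norm.
move=> /cvgrPdist_le /(_ _ c'0)[N _ hN]; exists N => j /hN; rewrite sub0r normrN ger0_norm ?exprn_ge0//.
move=> rj; have rj0 : 0 <= r ^+ j by rewrite exprn_ge0.
have -> : c * j.+1%:R * q ^+ j = c * (j.+1%:R * r ^+ j) * r ^+ j by rewrite rr; ring.
apply: (@le_trans _ _ ((`|c| * (1 - r)^-1 + 1) * r ^+ j)).
  rewrite ler_wpM2r//; apply: (@le_trans _ _ (`|c| * (1 - r)^-1)); last by rewrite lerDl.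
  by apply: le_trans (ler_wpM2l (normr_ge0 c) (jr j)); rewrite ler_wpM2r ?ler_norm// mulr_ge0.
have d0 : 0 < `|c| * (1 - r)^-1 + 1.
  by rewrite ltr_wpDl// mulr_ge0// invr_ge0 subr_ge0 ltW.
by rewrite -ler_pdivlMl// -invfM [_ * 4]mulrC.
Qed.

(** The window has a length of order n and the depth is of order n^(1/s), so that
    the mean number of starting points is bounded below. *)
Lemma trap_likely : exists2 c0 : R, 0 < c0 & exists K, forall k, (K <= k)%N ->
  c0 <= E P (trap (rightward (block D k)) (deep k) (width D k) (width D k)).
Proof.
have e0 : 0 < (1 - q) / (4 * 2 `^ s) by rewrite divr_gt0 ?subr_gt0// mulr_gt0// powR_gt0.
have [l hl] := tails e0.
pose A := 2 * D%:R ^+ 2 * typical.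
have A0 : 0 < A by rewrite mulr_gt0// mulr_gt0// exprn_gt0.
have [N hN] := geometric_beats_linear (A `^ (s / 2) * (8 * D)%:R).
have [K1 hK1] := width_large N.+1 D0.
pose c := (2 ^+ l) `^ (- s) / 4 : R.
have c0 : 0 < c by rewrite divr_gt0// powR_gt0// exprn_gt0.
pose th := A `^ (- s) / (16 * D%:R).
have th0 : 0 < th by rewrite divr_gt0 ?powR_gt0// mulr_gt0.
pose B := (1 - q)^-1 ^+ 2.
have B0 : 0 <= B by rewrite exprn_ge0// invr_ge0 subr_ge0 ltW.
exists (c ^+ 2 * th / (2 * (th + B))).
  by apply: divr_gt0; apply: mulr_gt0 => //; [exact: exprn_gt0|exact: ltr_pwDl].
exists K1 => k /hK1 Nw.
have x1 := deep_ge1 k; have x0 : 0 < deep k := lt_le_trans ltr01 x1.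
have w0 : (0 < width D k)%N := leq_ltn_trans (leq0n _) Nw.
have nw : n_ k <= (8 * D)%:R * (width D k).+1%:R.
  by rewrite -natrM ler_nat ltnW// scale_lt_width.
have decay : deep k `^ (s / 2) * q ^+ width D k <= 4^-1.
  apply: le_trans (hN _ (ltnW Nw)); rewrite ler_wpM2r ?exprn_ge0//.
  rewrite /deep mulrA -/A (powRM _ (ltW A0) (powR_ge0 _ _)) -mulrA ler_wpM2l ?powR_ge0//.
  apply: le_trans nw; rewrite -powRrM mulrA mulVf ?gt_eqF// mul1r.
  by apply: ler1_powR; [exact: n1|rewrite invf_le1 ?ltr0n// ler1n].
have hit_ge i : (i < width D k)%N ->
    c * deep k `^ (- s) <= E P (hit (rightward (block D k)) i (deep k) (width D k)).
  move=> _; rewrite (E_hit _ _ _ _ (ltW x0)).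
  have := passage_lower iidP s0 L1s E1s L1h Eqh q1 (@rightward_inj (block D k)) i x1 hl decay.
  apply: le_trans.
  by rewrite (powRM _ (exprn_ge0 l (ler0n R 2)) (ltW x0)) /c mulrAC.
have := trap_probability_ge iidP s0 L1s E1s L1h Eqh q1 (@rightward_inj _) x0 c0 w0 hit_ge.
apply: le_trans.
rewrite -/B; set y := _ * deep k `^ _.
have thy : th <= y.
  rewrite /y /th deep_pow -/A mulrCA ler_wpM2l ?powR_ge0//.
  rewrite ler_pdivlMr ?n0// mulrC ler_pdivrMr ?mulr_gt0//.
  apply: le_trans nw _; rewrite -!natrM ler_nat.
  by move: w0; move: (width D k) => v; clear; nia.
apply: saturating_mono => //; exact: exprn_gt0.
Qed.

(** The trap and the crossing concern sites on either side of bottom, hence are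
    independent. *)
Lemma favourable_likely : exists2 c0 : R, 0 < c0 & exists K, forall k, (K <= k)%N ->
  obs (sites (block D k) (block D k.+1)) (favourable k) /\ c0 <= E P (favourable k).
Proof.
have [c0 c00 [K1 hK1]] := trap_likely; have [K2 hK2] := favourable_factors.
exists (c0 / 2); first by rewrite divr_gt0.
exists (maxn K1 K2) => k; rewrite geq_max => /andP[k1 k2].
have [oT oS /andP[bu ub] S2] := hK2 k k2.
have T1 := hK1 k k1.
split.
  apply: obsM; [apply: obs_sub oT|apply: obs_sub oS] => i; rewrite /sites/=.
    by move=> /andP[-> /= h]; exact: le_trans h ub.
  by move=> /andP[h ->]; rewrite (le_lt_trans bu h).
rewrite /favourable (@EM R P iidP _ _ _ _ _ (L1_bounded P oT (trap_le1 _ _ _ _)) (L1_bounded P oS (c := 1) _)).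
- by apply: ler_pM => //; rewrite ?(ltW c00) ?invr_ge0.
- by apply/seteqP; split => // i [] /=; rewrite /sites/=; move=> /andP[_ h] /andP[h' _]; move: (lt_le_trans h' h); rewrite ltxx.
- by move=> w; rewrite lern1 leq_b1.
Qed.

Lemma rare_steep (z : nat -> int) (k : nat -> nat) :
  (forall N, exists K, forall j, (K <= j)%N -> (N <= k j)%N) ->
  rare P (fun j => steep s q (z j) (k j)).
Proof.
move=> jk; split; first by move=> j; exact: (measurable_steep iidP s0 L1h Eqh q1).
move=> e e0; have [K hK] := steep_small iidP s0 L1h Eqh q1 e0.
by have [K' hK'] := jk K; exists K' => j /hK'; exact: hK.
Qed.

Let rare_crossing (x : nat -> R) (z : nat -> int) (k m : nat -> nat) :
  (forall j, 0 < x j) -> (forall j, (m j)%:R <= x j / 2) ->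
  (forall e : R, 0 < e -> exists K, forall j, (K <= j)%N ->
     (m j)%:R * (C * (x j / 4) `^ (- s)) <= e) ->
  rare P (fun j => [set w | x j < crossing_mean w (z j) (k j) (m j)]).
Proof.
move=> x0 mx small.
have ev j := event_probability P
  (obs_lt (obs_cst _ (ltW (x0 j))) (obs_crossing_mean (z j) (k j) (m j))).
split=> [j|e e0]; first by have [] := ev j.
have [K hK] := small e e0; exists K => j Kj.
have [_ ->] := ev j; rewrite lee_fin; apply: le_trans (hK j Kj).
exact: (crossing_mean_tail iidP s0 s1 L1s E1s L1h Eqh q1).
Qed.

Let generous_gt0 k : 0 < generous k. Proof. by rewrite powR_gt0// n0. Qed.

Lemma scale_le_generous k : n_ k <= generous k.
Proof.
apply: le_trans (scale_le_pow k) _; apply: ler_powR (n1 k) _ _ _.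
by rewrite lerDl invr_ge0 ltW.
Qed.

Let bottom_scale k : (2 * bottom D k)%:R <= n_ k / 2.
Proof.
rewrite ler_pdivlMr// -natrM ler_nat; apply: leq_trans (bottom_le D k).
by rewrite leq_mul2l (leq_trans _ D8)// orbT.
Qed.

(** Beyond the order n^(1/s) by a factor n^(1/D), the tail of the crossing mean is
    of order n^(-s/D). *)
Lemma rare_generous : rare P (fun k => [set w |
  generous k < crossing_mean w (- (scale k)%:Z) (scale k) (2 * bottom D k)]).
Proof.
apply: rare_crossing => [//|k|e e0].
  by apply: le_trans (bottom_scale k) _; rewrite ler_wpM2r ?invr_ge0// scale_le_generous.
pose c := C * 4 `^ s; pose x := (c / e) `^ (D%:R / s).
have c0 : 0 < c by rewrite mulr_gt0 ?C0// powR_gt0.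
exists (Num.truncn x).+1 => k kx.
have xn : x <= n_ k.
  apply: (@le_trans _ _ k%:R); last by rewrite ler_nat ltnW// scale_gt.
  by apply: le_trans (ltW (truncnS_gt x)) _; rewrite ler_nat.
have sD0 : 0 < s / D%:R by rewrite divr_gt0.
have pw : c / e <= n_ k `^ (s / D%:R).
  have -> : c / e = x `^ (s / D%:R).
    rewrite /x -powRrM [X in _ `^ X](_ : _ = 1) ?powRr1 ?divr_ge0 ?(ltW c0) ?(ltW e0)//.
    by field; rewrite !gt_eqF.
  by apply: ge0_ler_powR (ltW sD0) _ _ _ _ xn; rewrite nnegrE ?powR_ge0// ltW.
have -> : (generous k / 4) `^ (- s) = 4 `^ s * (n_ k * n_ k `^ (s / D%:R))^-1.
  rewrite (powRM _ (ltW (generous_gt0 k)) _) ?invr_ge0// mulrC; congr (_ * _).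
    by rewrite -powR_inv1// -powRrM mulrNN mul1r.
  rewrite /generous -powRrM mulrN powRN -/(n_ k); congr (_^-1).
  rewrite mulrDl mulVf ?gt_eqF// powRD ?(gt_eqF (n0 k)) ?implybT// powRr1 ?(ltW (n0 k))//.
  by rewrite [_^-1 * s]mulrC.
apply: (@le_trans _ _ (n_ k * (C * (4 `^ s * (n_ k * n_ k `^ (s / D%:R))^-1)))).
  rewrite ler_wpM2r//.
    apply: mulr_ge0 (ltW C0) _; apply: mulr_ge0 (powR_ge0 _ _) _.
    by rewrite invr_ge0 mulr_ge0 ?powR_ge0// ltW.
  by apply: le_trans (bottom_scale k) _; rewrite ler_pdivrMr// ler_peMr ?(ltW (n0 k))// ler1n.
have -> : n_ k * (C * (4 `^ s * (n_ k * n_ k `^ (s / D%:R))^-1)) = c / n_ k `^ (s / D%:R).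
  by rewrite /c; field; rewrite !gt_eqF ?powR_gt0// n0.
rewrite ler_pdivrMr ?powR_gt0 ?n0// mulrC -ler_pdivrMr//.
Qed.

(** Crossing k sites takes longer than the order n^(1/s) with probability of
    order k / n, and n is at least k^2. *)
Lemma rare_mild : rare P (fun k => [set w |
  mild k < crossing_mean w (- k%:Z) k k]).
Proof.
have kn k : k%:R <= n_ k by rewrite ler_nat ltnW// scale_gt.
apply: rare_crossing => [k|k|e e0]; first exact: mild_gt0.
  apply: le_trans (kn k) _; have := scale_le_mild k; have := n0 k; have := Dr.
  exact: scale_half.
exists (Num.truncn e^-1).+1 => k ke.
have k0 : (0 : R) < k%:R by rewrite ltr0n (leq_trans _ ke).
have ek : e^-1 <= k%:R.
  by apply: le_trans (ltW (truncnS_gt _)) _; rewrite ler_nat.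
rewrite mild_pow.
have t1 : C * (typical / 4) `^ (- s) <= 1.
  have := typical4; have := Dr; have : 0 <= C * (typical / 4) `^ (- s).
    by rewrite mulr_ge0 ?(ltW C0) ?powR_ge0.
  by rewrite -mulrA; exact: scale_unit.
apply: (@le_trans _ _ (k%:R / n_ k)).
  by rewrite !mulrA ler_pM2r ?invr_gt0 ?n0// -mulrA ler_piMr ?(ltW k0).
apply: (@le_trans _ _ k%:R^-1); last by rewrite -[e]invrK lef_pV2 ?posrE ?invr_gt0.
rewrite ler_pdivrMr ?n0// mulrC ler_pdivlMr// -natrM ler_nat.
exact: sqr_le_scale.
Qed.

Lemma rare_atypical : rare P atypical.
Proof.
have large k : (forall j, (j <= k j)%N) ->
    forall N, exists K, forall j, (K <= j)%N -> (N <= k j)%N.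
  by move=> jk N; exists N => j Nj; exact: leq_trans (jk j).
have idle j : (j <= scale j)%N by rewrite ltnW// scale_gt.
do 2 (apply: rareU; [by [exact: rare_generous|exact: rare_mild]|]).
apply: rareU; first by apply: rare_steep; exact: large.
apply: rareU; first by apply: rare_steep => N; exact: bottom_large.
apply: rareU; first by apply/rare_steep/large => j; rewrite (leq_trans (idle j))// leq_pmull.
by apply: rareU; apply: rare_steep; exact: large.
Qed.

Lemma trapping_scales m :
  P.-negligible [set w | forall k, (m <= k)%N -> favourable k w = 0 \/ atypical k w].
Proof.
have [c0 c00 [K hK]] := favourable_likely.
have le1 k w : favourable k w <= 1.
  by rewrite /favourable mulr_ile1 ?ler0n ?lern1 ?leq_b1.
apply: (infinitely_often iidP (@block_mono D) _ le1 c00 _ rare_atypical) => k Kk.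
  by have [] := hK k Kk.
by have [] := hK k Kk.
Qed.

(** The trap of a favourable scale starts at a = block k + i for some i, and the
    hitting time of 2 * bottom, about n/D, has its median at the required place;
    [quenched_median] applies with eta about D times the bound mild on the mean
    crossing time, that is the depth divided by 2D. *)
Lemma trapping_median : exists K, forall k, (K <= k)%N ->
  forall (w : env R) (Q : probability walk R), quenched_law w Q ->
  (forall i, 0 < env_at w i) -> favourable k w != 0 -> ~ atypical k w ->
  exists t : nat, [/\ (0 < t)%N, n_ k `^ s^-1 <= t%:R, t%:R <= 5 * generous k,
    forall x : int, (2 * bottom D k)%N%:Z <= x <= (D * scale k)%N%:Z ->
      `| pr Q [set X | X t <= x] - 2^-1 | <= 4 * D%:R^-1 &
    forall x : int, x <= 0 -> pr Q [set X | X t <= x] <= 3 * D%:R^-1].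
Proof.
have /andP[kap0 kap1] := rate01 s0 Eqh q1; set kap := rate s q in kap0 kap1.
have [K1 hK1] := window_fits D0.
have [N hN] : exists N, forall l, (N <= l)%N -> kap ^+ l / (1 - kap) <= D%:R^-1.
  have k1 : 0 < 1 - kap by rewrite subr_gt0.
  have e0 : 0 < D%:R^-1 * (1 - kap) by rewrite mulr_gt0// invr_gt0.
  have : kap ^+ l @[l --> \oo] --> 0 by apply: cvg_expr; rewrite ger0_norm// ltW.
  move=> /cvgrPdist_le /(_ _ e0)[N _ hN]; exists N => l /hN.
  by rewrite sub0r normrN ger0_norm ?exprn_ge0 ?(ltW kap0)// ler_pdivrMr.
have [K2 hK2] := bottom_large N D0.
exists (maxn K1 (maxn K2 N)) => k; rewrite !geq_max => /and3P[k1 k2 Nk] w Q HQ w_gt0 fav typ.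
have [k0 n8 fit] := hK1 k k1; have Nb := hK2 k k2.
have Nn : (N <= scale k)%N by rewrite (leq_trans Nk)// ltnW// scale_gt.
have small z l : (N <= l)%N -> ~ steep s q z l w -> small_return w z l D%:R^-1.
  move=> Nl st L; apply: le_trans (not_steep_sum s0 Eqh q1 st L) (hN l Nl).
have ND : (N <= D * scale k)%N by rewrite (leq_trans Nn)// leq_pmull.
have cross_n : crossing_mean w (- (scale k)%:Z) (scale k) (2 * bottom D k) <= generous k.
  by rewrite leNgt; apply/negP => h; apply: typ; left.
have cross_L : crossing_mean w (- k%:Z) k k <= mild k.
  by rewrite leNgt; apply/negP => h; apply: typ; right; left.
have ret_n : small_return w (- (scale k)%:Z) (scale k) D%:R^-1.
  by apply: small => // st; apply: typ; do 2 right; left.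
have ret_u : small_return w (bottom D k)%:Z (bottom D k) D%:R^-1.
  by apply: small => // st; apply: typ; do 3 right; left.
have ret_x : small_return w (D * scale k)%N%:Z (D * scale k) D%:R^-1.
  by apply: small => // st; apply: typ; do 4 right; left.
have ret_L : small_return w (- k%:Z) k D%:R^-1.
  by apply: small => // st; apply: typ; do 5 right; left.
have ret_0 : small_return w 0 k D%:R^-1.
  by apply: small => // st; apply: typ; do 6 right.
have mild0 := mild_gt0 k.
have [T0 S0] : trap (rightward (block D k)) (deep k) (width D k) (width D k) w != 0 /\
    crossing_mean w (bottom D k)%:Z (bottom D k) (2 * D * scale k - 2 * bottom D k) <= mild k.
  move: fav; rewrite /favourable mulf_eq0 negb_or => /andP[-> h]; split => //.
  by move: h; case: (_ <= _); rewrite ?eqxx.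
have deep0 : 0 < deep k := lt_le_trans ltr01 (deep_ge1 k).
have [i [l [iw lw deepl]]] := trapP (ltW deep0) T0.
have bn : (2 * bottom D k <= 2 * D * scale k)%N.
  apply: (@leq_trans (scale k)); last by rewrite leq_pmull// muln_gt0.
  by apply: leq_trans (bottom_le D k); rewrite leq_pmulr.
pose a := (2 * D * scale k.-1 + i)%N.
have aK : (a + (2 * bottom D k - a) = 2 * bottom D k)%N by rewrite /a subnKC//; clear -iw fit; lia.
have deep_res : deep k <= resistance w a (2 * bottom D k - a) 0.
  have -> : resistance w a (2 * bottom D k - a) 0 =
      \sum_(0 <= j < 2 * bottom D k - a) Pi (rightward (block D k)) i (i + j) w.
    by apply: eq_bigr => j _; rewrite -Pi_rightward.
  rewrite big_mkord; have lK : (l < 2 * bottom D k - a)%N.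
    by rewrite /a; clear -iw lw fit; lia.
  rewrite (bigD1 (Ordinal lK))//=; apply: (le_trans (ltW deepl)).
  by rewrite lerDl; apply: sumr_ge0 => j _; exact: Pi_ge0.
pose eta := (Num.truncn (mild k * D%:R)).+1.
have d8 : 0 < (D%:R^-1 : R) <= 8^-1.
  by rewrite invr_gt0 Dr0 lef_pV2 ?posrE.
have ub : (2 * bottom D k - bottom D k = bottom D k)%N by rewrite mul2n -addnn addnK.
have := @quenched_median R w Q HQ w_gt0 a (2 * bottom D k - a) (bottom D k)
  (2 * D * scale k) (D * scale k) (scale k) k eta (deep k) (mild k) (generous k) (mild k) D%:R^-1.
rewrite aK ub.
have -> : (2 * D * scale k - D * scale k = D * scale k)%N by rewrite -mulnA mul2n -addnn addnK.
have DV : D%:R^-1 * deep k = 2 * D%:R * mild k by rewrite /deep; field; rewrite gt_eqF.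
have Dmild : 8 * mild k <= D%:R * mild k by rewrite ler_wpM2r// ltW.
have mild1 : 1 <= mild k.
  by apply: mild_ge1 Dr (n1 k) (scale_le_mild k).
have etaD : mild k * D%:R <= eta%:R <= mild k * D%:R + 1.
  by rewrite ltW ?truncnS_gt//= -natr1 lerD2r truncn_le mulr_ge0 ?(ltW mild0).
have /andP[eta1 eta2] := etaD.
case.
- by clear -fit iw aK; lia.
- by clear -fit; lia.
- exact: bn.
- by rewrite muln_gt0 D0 scale_gt0 -mulnA mul2n -addnn -[ltnLHS]addn0 ltn_add2l muln_gt0 D0 scale_gt0.
- exact: scale_gt0.
- exact: k0.
- by [].
- exact: d8.
- exact: deep0.
- exact: deep_res.
- exact: ret_u.
- exact: S0.
- exact: ret_n.
- exact: cross_n.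
- exact: ret_x.
- exact: ret_L.
- exact: cross_L.
- exact: ret_0.
- by rewrite mulrC ler_pdivlMr.
- by rewrite DV; apply: eta_small etaD Dmild mild1.
- by rewrite mulrA DV; apply: half_deep Dmild mild0.
- by rewrite DV; apply: double_deep Dmild mild1.
move=> t [t0 tl tu near_u near_0]; exists t; split => //.
- apply: le_trans tl; have -> : deep k / 2 = D%:R * (D%:R * mild k) by rewrite /deep; field.
  apply: (@le_trans _ _ (mild k)); first by rewrite /mild ler_peMl ?powR_ge0// typical_ge1.
  by apply: twice_scaled Dr mild0.
- apply: le_trans tu _; have := le_trans (n1 k) (scale_le_generous k).
  by move: (generous k) => g; lra.
Qed.

End trap_scale.

(** * Convergence along favourable scales *)

Section limit.
Context {R : realType}.
Implicit Types (Q : probability walk R) (s x : R) (D k t : nat).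

(** The statement of the theorem at precision 1/D. *)
Definition halfway Q s D k t : Prop :=
  [/\ (0 < t)%N,
      (scale k)%:R `^ s^-1 <= (t%:R : R) <= (scale k)%:R `^ (s^-1 + 2 / D%:R),
      forall x, D%:R^-1 <= x <= D%:R ->
        `|pr Q [set X | (X t)%:~R / (scale k)%:R <= x] - 2^-1| <= 4 / D%:R &
      forall x, x <= 0 -> pr Q [set X | (X t)%:~R / (scale k)%:R <= x] <= 3 / D%:R].

Let position_floor k t x :
  [set X : walk | (X t)%:~R / (scale k)%:R <= x] = [set X | X t <= Num.floor (x * (scale k)%:R)].
Proof.
by apply/seteqP; split => X /=; rewrite ler_pdivrMr ?ltr0n ?scale_gt0// floor_ge_int.
Qed.

Let measurable_position k t x : measurable [set X : walk | (X t)%:~R / (scale k)%:R <= x].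
Proof. by apply: measurable_event; exists t => X Y h /=; rewrite h. Qed.

(** The factor 5 is absorbed in n^(1/D) once n is at least 5^D, and the integer
    positions up to x n are those up to its floor. *)
Lemma median_halfway Q s D k t : 0 < s -> (0 < D)%N -> (5 ^ D <= scale k)%N ->
  [/\ (0 < t)%N, (scale k)%:R `^ s^-1 <= t%:R :> R, t%:R <= 5 * generous s D k,
    forall y : int, (2 * bottom D k)%N%:Z <= y <= (D * scale k)%N%:Z ->
      `| pr Q [set X | X t <= y] - 2^-1 | <= 4 * D%:R^-1 &
    forall y : int, y <= 0 -> pr Q [set X | X t <= y] <= 3 * D%:R^-1] ->
  halfway Q s D k t.
Proof.
move=> s0 D0 n5 [t0 tl tu near_u near_0].
have n0 : (0 : R) < (scale k)%:R by rewrite ltr0n scale_gt0.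
have Dr0 : (0 : R) < D%:R by rewrite ltr0n.
split => //.
- rewrite tl /=; apply: (le_trans tu).
  have -> : s^-1 + 2 / D%:R = D%:R^-1 + (s^-1 + D%:R^-1) by field; rewrite !gt_eqF.
  rewrite powRD ?(gt_eqF n0) ?implybT// ler_wpM2r ?powR_ge0//.
  have -> : 5 = ((5 ^ D)%N%:R : R) `^ D%:R^-1.
    by rewrite natrX -powR_mulrn// -powRrM mulfV ?gt_eqF// powRr1.
  by apply: ge0_ler_powR; rewrite ?nnegrE ?invr_ge0 ?ler_nat.
- move=> x /andP[xl xu]; rewrite position_floor; apply: near_u; apply/andP; split.
    rewrite floor_ge_int; apply: (@le_trans _ _ (D%:R^-1 * (scale k)%:R)).
      rewrite ler_pdivlMl// mulrC -[leLHS]natrM ler_nat; exact: bottom_le.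
    by rewrite ler_wpM2r// ltW.
  rewrite -(ler_int R); apply: le_trans (floor_le _) _.
  by rewrite [leRHS]natrM ler_wpM2r// ltW.
- move=> x x0; rewrite position_floor; apply: near_0; rewrite -(ler_int R).
  by apply: le_trans (floor_le _) _; rewrite mulr_le0_ge0// ltW.
Qed.

Let cvg_of_rate (u : nat -> R) (l c : R) N :
  (forall m, (N <= m)%N -> `|u m - l| <= c / (m + 8)%:R) -> u @ \oo --> l.
Proof.
move=> h; apply/cvgrPdist_le => e e0.
exists (maxn N (Num.truncn (`|c| / e)).+1) => // m /=; rewrite geq_max => /andP[Nm cm].
rewrite distrC; apply: (le_trans (h m Nm)).
have m0 : (0 : R) < (m + 8)%:R by rewrite ltr0n addnS.
rewrite ler_pdivrMr//; apply: (le_trans (ler_norm c)).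
rewrite -ler_pdivrMl// mulrC; apply: (le_trans (ltW (truncnS_gt _))).
by rewrite ler_nat (leq_trans cm)// leq_addr.
Qed.

(** With D = m + 8 at the m-th scale, all errors are of order 1/m; D >= 8 is what
    the median argument needs. *)
Lemma halfway_limit Q s (k t : nat -> nat) : (forall m, (0 < k m)%N) ->
  (forall m, halfway Q s (m + 8) (k m) (t m)) ->
  (fun m => ln ((t m)%:R : R) / ln (scale (k m))%:R) @ \oo --> s^-1 /\
  forall x, (fun m => Q [set X | (X (t m))%:~R / (scale (k m))%:R <= x]) @ \oo -->
    (if x <= 0 then 0 else 2^-1)%:E.
Proof.
move=> k0 half; split.
  apply: (@cvg_of_rate _ _ 2 0) => m _; have [t0 /andP[tl tu] _ _] := half m.
  have n1 : (1 : R) < (scale (k m))%:R.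
    by rewrite ltr1n (leq_ltn_trans (k0 m))// scale_gt.
  have n0 := lt_trans ltr01 n1; have ln0 : 0 < ln ((scale (k m))%:R : R) := ln_gt0 n1.
  have tp : (0 : R) < (t m)%:R by rewrite ltr0n.
  have ll : s^-1 <= ln ((t m)%:R : R) / ln (scale (k m))%:R.
    by rewrite ler_pdivlMr// -ln_powR ler_ln ?posrE ?powR_gt0.
  have lu : ln ((t m)%:R : R) / ln (scale (k m))%:R <= s^-1 + 2 / (m + 8)%:R.
    by rewrite ler_pdivrMr// -ln_powR ler_ln ?posrE ?powR_gt0.
  by rewrite ger0_norm ?subr_ge0// lerBlDl.
move=> x; under eq_fun => m do rewrite prE//.
apply: cvg_EFin; first exact: nearW.
have [x0|x0] := leP x 0.
  apply: (@cvg_of_rate _ _ 3 0) => m _; have [_ _ _ h] := half m.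
  by rewrite /= subr0 ger0_norm; [exact: h|exact: fine_ge0].
apply: (@cvg_of_rate _ _ 4 (maxn (Num.truncn x) (Num.truncn x^-1)).+1) => m.
rewrite gtn_max => /andP[m1 m2]; have [_ _ h _] := half m.
apply: h; apply/andP; split.
  rewrite -[x]invrK lef_pV2 ?posrE ?invr_gt0 ?ltr0n ?(ltn_addl m)//.
  by apply: le_trans (ltW (truncnS_gt _)) _; rewrite ler_nat; exact: leq_trans m2 (leq_addr _ _).
by apply: le_trans (ltW (truncnS_gt _)) _; rewrite ler_nat; exact: leq_trans m1 (leq_addr _ _).
Qed.

End limit.

Section conclusion.
Context {R : realType} (P : probability (env R) R) (s : R).
Hypotheses (iidP : iid_product P) (s0 : 0 < s) (s1 : s < 1).
Hypothesis Hlog : (\int[P]_w lne (rho w 0) < 0)%E.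
Hypothesis Hs : (\int[P]_w poweR (rho w 0) s = 1)%E.
Hypothesis Hslog : (\int[P]_w (poweR (rho w 0) s * lne (rho w 0)) < +oo)%E.

Lemma halfway_infinitely_often : exists2 N : set (env R), P.-negligible N &
  forall w, ~ N w -> forall Q, quenched_law w Q ->
  forall D m, (8 <= D)%N -> exists k t, (m <= k)%N /\ halfway Q s D k t.
Proof.
have [L1s E1s] := odds_moment_s s0 Hs; have L1h := odds_moment_half s0 Hs.
pose q := E P (fun w => odds w 0 `^ (s / 2)).
have q1 : q < 1 := odds_moment_half_lt1 s0 Hlog Hs.
pose idle D m := [set w : env R |
  forall k, (m <= k)%N -> favourable s q (D + 8) k w = 0 \/ atypical s q (D + 8) k w].
exists ((~` [set w : env R | forall i, 0 < env_at w i]) `|` \bigcup_D \bigcup_m idle D m).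
  apply: negligibleU; first exact: (env_gt0_ae iidP s0 Hs).
  apply: negligible_bigcup => D; apply: negligible_bigcup => m.
  apply: (trapping_scales iidP s0 s1 L1s E1s L1h (erefl q) q1 _ _ m).
    by move=> e e0; exact: (overshoot_tail iidP s0 Hs Hslog e0).
  by rewrite leq_addl.
move=> w /not_orP[/contrapT w_gt0 busy] Q HQ D m D8.
have [K hK] := trapping_median (P := P) s0 s1 (erefl q) q1 D8.
pose m' := maxn (maxn m K) (5 ^ D).
have : ~ idle (D - 8)%N m' w by move=> h; apply: busy; exists (D - 8)%N => //; exists m'.
rewrite /idle /= subnK// => /existsNP[k /not_implyP[mk /not_orP[fav typ]]].
move: mk; rewrite !geq_max => /andP[/andP[mk Kk] Dk].
have [|t ht] := hK k Kk w Q HQ w_gt0 _ typ; first exact/eqP.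
exists k, t; split => //; apply: median_halfway ht => //.
  exact: leq_trans D8.
by rewrite (leq_trans Dk)// ltnW// scale_gt.
Qed.

End conclusion.

Theorem theorem1p3 (R : realType) (P : probability (env R) R) (s : R)
    (Pw : env R -> probability walk R)
    (HPw : forall w : env R, quenched_law w (Pw w))
    (Hiid : iid_product P)
    (Hlog : (\int[P]_w lne (rho w 0) < 0)%E)
    (Hs0 : 0 < s)
    (Hs : (\int[P]_w poweR (rho w 0) s = 1)%E)
    (Hnonlattice : nonlattice P)
    (Hslog : (\int[P]_w (poweR (rho w 0) s * lne (rho w 0)) < +oo)%E)
    (Hs1 : s < 1) :
  {ae P, forall w, exists (k : nat -> nat) (t : nat -> R),
    [/\ {homo k : i j / (i < j)%N},
        forall m, 0 < t m,
        (fun m => ln (t m) / ln (scale (k m))%:R) @ \oo --> s^-1 &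
        forall x : R,
          (fun m => Pw w [set X | (X (Num.truncn (t m)))%:~R
                                    / (scale (k m))%:R <= x]) @ \oo -->
          (if x <= 0 then 0 else 2^-1)%:E]}.
Proof.
have [N N0 hN] := halfway_infinitely_often Hiid Hs0 Hs1 Hlog Hs Hslog.
apply: negligibleS N0 => w /= no; apply: contrapT => /hN /(_ _ (HPw w)) often.
apply: no.
have /choice[f hf] : forall Dm : nat * nat, exists kt : nat * nat,
    (Dm.2 < kt.1)%N /\ halfway (Pw w) s (Dm.1 + 8) kt.1 kt.2.
  move=> [D m]; have [k [t [mk h]]] := often (D + 8)%N m.+1 (leq_addl _ _).
  by exists (k, t).
pose kt := fix kt m := if m is m'.+1 then f (m, (kt m').1) else f (0%N, 0%N).
have ktE m : halfway (Pw w) s (m + 8) (kt m).1 (kt m).2.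
  by case: m => [|m]; [have [] := hf (0, 0)%N|have [] := hf (m.+1, (kt m).1)].
have kt0 m : (0 < (kt m).1)%N.
  by case: m => [|m]; [have [] := hf (0, 0)%N|have [/(leq_ltn_trans (leq0n _))] := hf (m.+1, (kt m).1)].
have [lim_t lim_X] := halfway_limit kt0 ktE.
exists (fun m => (kt m).1), (fun m => ((kt m).2)%:R); split => //.
- apply: homo_ltn => [y x z|m]; first exact: ltn_trans.
  by have [] := hf (m.+1, (kt m).1).
- by move=> m; have [t0 _ _ _] := ktE m; rewrite ltr0n.
- by move=> x; under eq_fun => m do rewrite natrK; exact: lim_X.
Qed.
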